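(* Let $(W_1,S_1)$ and $(W_2,S_2)$ be Coxeter systems of finite rank, and let $(s_1,\dots,s_n)$ be an $n$-tuple with $S_1=\{s_1,\dots,s_k\}$ and $S_2=\{s_{k+1},\dots,s_n\}$. Let $(W,S)$ be the Coxeter system with $W=W_1*W_2$ and $S=S_1\sqcup S_2$. Identify $B_k\times B_{n-k}$ with the subgroup of $B_n$ generated by $\sigma_1,\dots,\sigma_{k-1},\sigma_{k+1},\dots,\sigma_{n-1}$ via $(\sigma_i,1)\mapsto\sigma_i$, $(1,\sigma_j)\mapsto\sigma_{k+j}$. Let $H_1=H(W_1,(s_1,\dots,s_k))$, $H_2=H(W_2,(s_{k+1},\dots,s_n))$, $H=H(W,(s_1,\dots,s_n))$, and similarly $\bar H_1,\bar H_2,\bar H$. Then $H=H_1\times H_2$ and $\bar H=\bar H_1\times\bar H_2$. In particular, if $(W_1,(s_1,\dots,s_k))$ and $(W_2,(s_{k+1},\dots,s_n))$ are well-stabilized, then so is $(W,(s_1,\dots,s_n))$.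
   Context: A Coxeter system $(W,S)$: $W=\langle S\mid (ss')^{m(s,s')}=1\text{ whenever } m(s,s')\neq\infty\rangle$ with $m$ symmetric, $m(s,s)=1$, $m(s,s')\in\{2,3,\dots,\infty\}$ for $s\neq s'$. The free product $W_1*W_2$ with $S_1\sqcup S_2$ is the Coxeter system whose Coxeter matrix restricts to those of $W_1,W_2$ and has $m(s,s')=\infty$ for $s\in S_1$, $s'\in S_2$. The braid group $B_m=\langle\sigma_1,\dots,\sigma_{m-1}\mid \sigma_i\sigma_{i+1}\sigma_i=\sigma_{i+1}\sigma_i\sigma_{i+1},\ \sigma_i\sigma_j=\sigma_j\sigma_i\ (|i-j|\ge2)\rangle$ acts on $G^m$ for any group $G$ (Hurwitz action) by $\sigma_i\cdot(g_1,\dots,g_m)=(g_1,\dots,g_{i-1},g_ig_{i+1}g_i^{-1},g_i,g_{i+2},\dots,g_m)$. The Artin group $\mathrm{Art}(W,S)$ of a Coxeter system with ordered generators $(s_1,\dots,s_n)$ is generated by $\bar s_1,\dots,\bar s_n$ subject to $\bar s_i\bar s_j\bar s_i\cdots=\bar s_j\bar s_i\bar s_j\cdots$ (both sides with $m(s_i,s_j)$ factors) whenever $m(s_i,s_j)\ne\infty$. For a Coxeter system $(V,\{r_1,\dots,r_m\})$ with the ordering $(r_1,\dots,r_m)$, $H(V,(r_1,\dots,r_m))\le B_m$ is the stabilizer of $(r_1,\dots,r_m)\in V^m$ and $\bar H(V,(r_1,\dots,r_m))\le B_m$ is the stabilizer of $(\bar r_1,\dots,\bar r_m)\in\mathrm{Art}(V,\{r_i\})^m$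 under the Hurwitz action; $(V,(r_1,\dots,r_m))$ is well-stabilized if these two subgroups are equal. *)

(* Defs.v *)
(* Groups given by presentations are modelled by words over
   the generators (letters (a, inv) with inv = true meaning a^-1) modulo the
   congruence generated by free cancellation and the defining relations. *)
From mathcomp Require Import all_boot.
From mathcomp Require Import zify.
Set Implicit Arguments. Unset Strict Implicit. Unset Printing Implicit Defensive.

Definition word (A : Type) := seq (A * bool).

Definition winv {A : Type} (w : word A) : word A :=
  rev (map (fun l => (l.1, ~~ l.2)) w).

Inductive peq {A : Type} (R : word A -> word A -> Prop) : word A -> word A -> Prop :=
| peq_refl w : peq R w w
| peq_sym u v : peq R u v -> peq R v u
| peq_trans u v w : peq R u v -> peq R v w -> peq R u w
| peq_cancel u v a b : peq R (u ++ (a, b) :: (a, ~~ b) :: v) (u ++ v)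
| peq_rel u v x y : R x y -> peq R (u ++ x ++ v) (u ++ y ++ v).

(* Coxeter matrix on the generators 'I_n; the value 0 encodes m = infinity. *)
Definition coxeter_matrix (n : nat) (m : 'I_n -> 'I_n -> nat) : Prop :=
  (forall i j, m i j = m j i) /\ (forall i, m i i = 1) /\
  (forall i j, i != j -> m i j != 1).

Definition cox_rel (n : nat) (m : 'I_n -> 'I_n -> nat) (x y : word 'I_n) : Prop :=
  exists i j, m i j != 0 /\
    x = flatten (nseq (m i j) [:: (i, false); (j, false)]) /\ y = [::].

Definition alt (n : nat) (i j : 'I_n) (p : nat) : word 'I_n :=
  mkseq (fun t => if odd t then (j, false) else (i, false)) p.

Definition art_rel (n : nat) (m : 'I_n -> 'I_n -> nat) (x y : word 'I_n) : Prop :=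
  exists i j, m i j != 0 /\ x = alt i j (m i j) /\ y = alt j i (m i j).

(* Braid group B_p: generators sigma_1..sigma_{p-1} indexed by 'I_(p.-1)
   (index i stands for sigma_{i+1}, acting on positions i, i+1, 0-based). *)
Definition braid_rel (p : nat) (x y : word 'I_(p.-1)) : Prop :=
  exists i j : 'I_(p.-1),
    (i.+1 = j :> nat /\ x = [:: (i, false); (j, false); (i, false)]
                      /\ y = [:: (j, false); (i, false); (j, false)])
    \/ (i.+1 < j /\ x = [:: (i, false); (j, false)] /\ y = [:: (j, false); (i, false)]).

Definition braid_eq (p : nat) := peq (@braid_rel p).

Definition hurwitz_letter {A : Type} (l : nat * bool) (t : seq (word A)) : seq (word A) :=
  let i := l.1 in
  let g := nth [::] t i in
  let h := nth [::] t i.+1 in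
  if ~~ l.2 then set_nth [::] (set_nth [::] t i (g ++ h ++ winv g)) i.+1 g
  else set_nth [::] (set_nth [::] t i h) i.+1 (winv h ++ g ++ h).

Definition hurwitz {A : Type} (p : nat) (b : word 'I_p) (t : seq (word A)) :=
  foldr (fun l t => hurwitz_letter (val l.1, l.2) t) t b.

Definition stabilizes {A : Type} (R : word A -> word A -> Prop) (p : nat)
  (t : seq (word A)) (b : word 'I_p) : Prop :=
  forall i, i < size t -> peq R (nth [::] (hurwitz b t) i) (nth [::] t i).

Definition gens (n : nat) : seq (word 'I_n) := [seq [:: (i, false)] | i <- enum 'I_n].

Definition H_cox (n : nat) (m : 'I_n -> 'I_n -> nat) (b : word 'I_(n.-1)) : Prop :=
  stabilizes (cox_rel m) (gens n) b.
Definition H_art (n : nat) (m : 'I_n -> 'I_n -> nat) (b : word 'I_(n.-1)) : Prop :=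
  stabilizes (art_rel m) (gens n) b.

Definition well_stabilized (n : nat) (m : 'I_n -> 'I_n -> nat) : Prop :=
  forall b, H_cox m b <-> H_art m b.

Definition free_product_matrix (k l : nat) (M1 : 'I_k -> 'I_k -> nat)
  (M2 : 'I_l -> 'I_l -> nat) (i j : 'I_(k + l)) : nat :=
  match split i, split j with
  | inl a, inl b => M1 a b
  | inr a, inr b => M2 a b
  | _, _ => 0
  end.

Lemma embL_proof k l : k.-1 <= (k + l).-1.
Proof. lia. Qed.

Lemma embR_proof k l (j : 'I_(l.-1)) : k + j < (k + l).-1.
Proof. have := ltn_ord j; lia. Qed.

Definition embL (k l : nat) (i : 'I_(k.-1)) : 'I_((k + l).-1) := widen_ord (embL_proof k l) i.
Definition embR (k l : nat) (j : 'I_(l.-1)) : 'I_((k + l).-1) := Ordinal (embR_proof k j).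

Definition map_word {A B : Type} (f : A -> B) (w : word A) : word B :=
  map (fun x => (f x.1, x.2)) w.

(* Main.v *)
(* The point is to show that a braid stabilizing the Coxeter generators of
   W_1 * W_2 splits. Let it send the free generators x_1, ..., x_n to
   y_1, ..., y_n. A prefix product p = y_1 ... y_i with i <= k and its complement
   p^-1 x_1 ... x_n are products of i and n - i conjugates of generators, and
   the reflection length of x_1 ... x_n is n, even in a linear representation
   in which the syllables satisfy the relations of W_1 and W_2. Writing p in
   syllables for F_k * F_(n-k), the two minimal products induce two noncrossing
   labellings of the syllables, and a syllable with trivial image would make the
   total cost drop below n. Hence the image of p in W_1 * W_2, which is that of
   x_1 ... x_i, has as many syllables as p, so p lies in F_k. With the analogous
   statement for suffixes, y_i lies in F_k for i <= k and in F_(n-k) for i > k;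
   combing one strand at a time, such a braid lies in B_k x B_(n-k). A braid
   stabilizing the Artin generators also stabilizes the Coxeter generators,
   hence splits too; the factors are then recovered by retracting W_1 * W_2 and
   its Artin group onto the factors. *)
Require Import Defs.
From HB Require Import structures.
From mathcomp Require Import all_boot all_fingroup all_algebra all_field.
From mathcomp Require Import generic_quotient boolp zify ring.
Set Implicit Arguments. Unset Strict Implicit. Unset Printing Implicit Defensive.

(** The drop in cost comes from counting in a planar bipartite graph: each syllable is an edge
    joining its block in the word of p to its block in the complement. Deleting letters from both
    words at once leaves the total product unchanged. By tightness a block that disappears entirely
    had cost 0, hence product 1, hence at least two letters, because no syllable is trivial. A
    finite graph with all degrees at least two has a cycle; the letters enclosed by a cycle of one
    type form such a graph of the other type, and descent on intervals shows that the graph is a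
    forest. A syllable with trivial image can be deleted while its blocks stay, so it is a bridge
    that cuts off a part with at most one vertex of degree one, and a cycle results again. The norm
    is the rank of [rho g - 1]: it is subadditive, conjugation invariant, at most 1 on generators,
    and blind to the kernel of [rho]. Combing works because the loops in a braid can be read off,
    once the first generator is forgotten, from any word for the image of that generator. *)

Section PeqTheory.
Context {A : Type}.
Implicit Types (R : word A -> word A -> Prop) (u v w : word A).

Lemma winv_cat u v : winv (u ++ v) = winv v ++ winv u.
Proof. by rewrite /winv map_cat rev_cat. Qed.

Lemma winv_cons a b u : winv ((a, b) :: u) = winv u ++ [:: (a, ~~ b)].
Proof. by rewrite -cat1s winv_cat. Qed.

Lemma winvK : involutive (@winv A).
Proof.
move=> u; rewrite /winv map_rev revK -map_comp.
by elim: u => //= -[a b] u ->; rewrite /= negbK.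
Qed.

Lemma peq_catl R w u v : peq R u v -> peq R (w ++ u) (w ++ v).
Proof.
elim=> {u v} [u|u v _ IH|u v x _ IH1 _ IH2|u v a b|u v x y r].
- exact: peq_refl.
- exact: peq_sym.
- exact: peq_trans IH1 IH2.
- rewrite !catA; exact: peq_cancel.
- by rewrite !catA -!(catA (w ++ u)); exact: peq_rel.
Qed.

Lemma peq_catr R w u v : peq R u v -> peq R (u ++ w) (v ++ w).
Proof.
elim=> {u v} [u|u v _ IH|u v x _ IH1 _ IH2|u v a b|u v x y r].
- exact: peq_refl.
- exact: peq_sym.
- exact: peq_trans IH1 IH2.
- rewrite -!catA; exact: peq_cancel.
- by rewrite -!catA; exact: peq_rel.
Qed.

Lemma peq_cat R u u' v v' : peq R u u' -> peq R v v' -> peq R (u ++ v) (u' ++ v').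
Proof.
by move=> hu hv; apply: peq_trans (peq_catr _ hu) (peq_catl _ hv).
Qed.

Lemma peq_mulVw R u : peq R (winv u ++ u) [::].
Proof.
elim: u => [|[a b] u IH]; first exact: peq_refl.
rewrite winv_cons -catA /=; apply: peq_trans IH.
have := peq_cancel R (winv u) u a (~~ b).
by rewrite negbK.
Qed.

Lemma peq_mulwV R u : peq R (u ++ winv u) [::].
Proof. by have := peq_mulVw R (winv u); rewrite winvK. Qed.

Lemma peq_winv R u v : peq R u v -> peq R (winv u) (winv v).
Proof.
move=> huv.
apply: peq_trans (_ : peq R (winv u ++ (v ++ winv v)) _).
  by rewrite -{1}[winv u]cats0; apply/peq_catl/peq_sym/peq_mulwV.
rewrite catA -[X in peq R _ X]cat0s; apply: peq_catr.
apply: peq_trans (peq_catl _ (peq_sym huv)) _.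
exact: peq_mulVw.
Qed.

Lemma peq_mono (R R' : word A -> word A -> Prop) :
  (forall x y, R x y -> peq R' x y) ->
  forall u v, peq R u v -> peq R' u v.
Proof.
move=> RR' u v; elim=> {u v} [u|u v _ IH|u v x _ IH1 _ IH2|u v a b|u v x y r].
- exact: peq_refl.
- exact: peq_sym.
- exact: peq_trans IH1 IH2.
- exact: peq_cancel.
- by apply/peq_catl/peq_catr/RR'.
Qed.

End PeqTheory.

(** Letters sent to [None] are erased, so one definition covers retractions that kill generators,
    inclusions and changes of index type. *)
Definition omap_word {A B : Type} (f : A -> option B) : word A -> word B :=
  pmap (fun x => omap (fun c => (c, x.2)) (f x.1)).

Lemma omap_word_cat {A B : Type} (f : A -> option B) u v :
  omap_word f (u ++ v) = omap_word f u ++ omap_word f v.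
Proof. exact: pmap_cat. Qed.

Lemma peq_omap {A B : Type} (f : A -> option B) (R : word A -> word A -> Prop)
    (R' : word B -> word B -> Prop) :
  (forall x y, R x y -> peq R' (omap_word f x) (omap_word f y)) ->
  forall u v, peq R u v -> peq R' (omap_word f u) (omap_word f v).
Proof.
move=> RR' u v; elim=> {u v} [u|u v _ IH|u v x _ IH1 _ IH2|u v a b|u v x y r].
- exact: peq_refl.
- exact: peq_sym.
- exact: peq_trans IH1 IH2.
- rewrite !omap_word_cat /=; case: (f a) => [c|] /=; last exact: peq_refl.
  exact: peq_cancel.
- by rewrite !omap_word_cat; apply/peq_catl/peq_catr/RR'.
Qed.

Lemma map_word_omap {A B : Type} (f : A -> B) u :
  map_word f u = omap_word (fun a => Some (f a)) u.
Proof. by elim: u => //= -[a b] u ->. Qed.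

(** * Presented groups as quotient types *)

Section Presented.
Variables (A : choiceType) (R : word A -> word A -> Prop).

(** The quotient construction expects a boolean relation; classical logic supplies it, as equality
    modulo [R] is in general undecidable. *)
Definition peqb : rel (word A) := fun u v => `[< peq R u v >].

Lemma peqb_equiv : equiv_class_of peqb.
Proof.
split=> [u|u v|v u w]; rewrite /peqb.
- by apply/asboolP; exact: peq_refl.
- by apply/asboolP/asboolP; exact: peq_sym.
- by move=> /asboolP uv /asboolP vw; apply/asboolP; exact: peq_trans uv vw.
Qed.

Canonical peqb_rel := EquivRelPack peqb_equiv.

Definition pgroup := {eq_quot peqb_rel}%qT.
HB.instance Definition _ := Choice.on pgroup.

Definition pin (u : word A) : pgroup := \pi_pgroup%qT u.

Lemma pinP u v : pin u = pin v <-> peq R u v.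
Proof.
rewrite /pin; split; first by move/eqP; rewrite eqmodE => /asboolP.
by move=> uv; apply/eqP; rewrite eqmodE; apply/asboolP.
Qed.

Lemma repr_pin u : peq R (repr (pin u)) u.
Proof. by apply/pinP; rewrite /pin reprK. Qed.

Lemma pin_repr (g : pgroup) : pin (repr g) = g.
Proof. by rewrite /pin reprK. Qed.

Definition pmul (g h : pgroup) : pgroup := pin (repr g ++ repr h).
Definition pinv (g : pgroup) : pgroup := pin (winv (repr g)).
Definition pone : pgroup := pin [::].

Lemma pmul_pin u v : pmul (pin u) (pin v) = pin (u ++ v).
Proof. by apply/pinP/peq_cat; exact: repr_pin. Qed.

Lemma pinv_pin u : pinv (pin u) = pin (winv u).
Proof. by apply/pinP/peq_winv; exact: repr_pin. Qed.

Lemma pmulA : associative pmul.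
Proof.
move=> g h k; rewrite -[g]pin_repr -[h]pin_repr -[k]pin_repr.
by rewrite !pmul_pin catA.
Qed.

Lemma pmul1g : left_id pone pmul.
Proof. by move=> g; rewrite -[g]pin_repr pmul_pin. Qed.

Lemma pmulg1 : right_id pone pmul.
Proof. by move=> g; rewrite -[g]pin_repr pmul_pin cats0. Qed.

Lemma pmulVg : left_inverse pone pinv pmul.
Proof.
by move=> g; rewrite -[g]pin_repr pinv_pin pmul_pin; apply/pinP/peq_mulVw.
Qed.

Lemma pmulgV : right_inverse pone pinv pmul.
Proof.
by move=> g; rewrite -[g]pin_repr pinv_pin pmul_pin; apply/pinP/peq_mulwV.
Qed.

HB.instance Definition _ := isGroup.Build pgroup
  pmulA pmul1g pmulg1 pmulVg pmulgV.

Local Open Scope group_scope.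

Lemma pin_cat u v : pin (u ++ v) = pin u * pin v.
Proof. by rewrite -pmul_pin. Qed.

Lemma pin_winv u : pin (winv u) = (pin u)^-1.
Proof. by rewrite -pinv_pin. Qed.

Lemma pin_inv a : pin [:: (a, true)] = (pin [:: (a, false)])^-1.
Proof. by rewrite -pin_winv. Qed.

Lemma pin_cons x u : pin (x :: u) = pin [:: x] * pin u.
Proof. by rewrite -pin_cat. Qed.

End Presented.

Section PresentedMap.
Local Open Scope group_scope.
Variables (A B : choiceType) (R : word A -> word A -> Prop) (R' : word B -> word B -> Prop).
Variable f : A -> option B.
Hypothesis fR : forall x y, R x y -> peq R' (omap_word f x) (omap_word f y).

Definition presmap (g : pgroup R) : pgroup R' := pin R' (omap_word f (repr g)).

Lemma presmap_pin u : presmap (pin R u) = pin R' (omap_word f u).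
Proof. by apply/pinP/(peq_omap fR)/repr_pin. Qed.

Lemma presmapM g h : presmap (g * h) = presmap g * presmap h.
Proof.
by rewrite -[g]pin_repr -[h]pin_repr -pin_cat !presmap_pin omap_word_cat pin_cat.
Qed.

Lemma presmap1 : presmap 1 = 1.
Proof. exact: (presmap_pin [::]). Qed.

Lemma presmapV g : presmap g^-1 = (presmap g)^-1.
Proof. by apply: (mulgI (presmap g)); rewrite -presmapM !mulgV presmap1. Qed.

End PresentedMap.

(** * The Hurwitz action on sequences of group elements *)

Section Hurwitz.
Local Open Scope group_scope.
Context {G : groupType}.
Implicit Types (t : nat -> G) (b : word nat).

(** Tuples are functions on all of [nat], so that generators act without bounds on their index and
    shifts need no change of type. *)
Definition hstep (l : nat * bool) t : nat -> G := fun j =>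
  let g := t l.1 in let h := t l.1.+1 in
  if j == l.1 then (if l.2 then h else g * h * g^-1)
  else if j == l.1.+1 then (if l.2 then h^-1 * g * h else g)
  else t j.

Definition hz b t : nat -> G := foldr hstep t b.

Lemma hz_cat b b' t : hz (b ++ b') t = hz b (hz b' t).
Proof. exact: foldr_cat. Qed.

Lemma hstep_ext l t t' : t =1 t' -> hstep l t =1 hstep l t'.
Proof. by move=> tt' j; rewrite /hstep !tt'. Qed.

Lemma hz_ext b t t' : t =1 t' -> hz b t =1 hz b t'.
Proof. by move=> tt'; elim: b => //= l b IH; apply: hstep_ext. Qed.

Lemma hstepK i (s : bool) t : hstep (i, s) (hstep (i, ~~ s) t) =1 t.
Proof.
move=> j; rewrite /hstep /= !eqxx.
have -> : (i.+1 == i) = false by lia.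
case: eqP => [->|_]; last case: eqP => [->|//].
  by case: s => //=; rewrite !mulgA mulgV mul1g mulgK.
by case: s => //=; rewrite !mulgA mulVg mul1g mulgVK.
Qed.

(** In both families [j] is the larger index, so the bound on [j] also bounds [i]. *)
Definition braid_nat (n : nat) (x y : word nat) : Prop :=
  exists i j, j < n.-1 /\
    ((i.+1 = j /\ x = [:: (i, false); (j, false); (i, false)]
               /\ y = [:: (j, false); (i, false); (j, false)])
    \/ (i.+1 < j /\ x = [:: (i, false); (j, false)]
                 /\ y = [:: (j, false); (i, false)])).

Lemma hz_braid_nat n x y t : braid_nat n x y -> hz x t =1 hz y t.
Proof.
move=> [i] [j] [_ [[<- [-> ->]]|[ij [-> ->]]]] q; rewrite /hz /= /hstep /= ?eqxx.
  have e1 m : (m.+1 == m) = false by lia.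
  have e2 m : (m == m.+1) = false by lia.
  have e3 : (i == i.+2) = false by lia.
  have e4 : (i.+2 == i) = false by lia.
  rewrite !(e1, e2, e3, e4) /=.
  case: (q =P i) => [->|qi].
    by rewrite !(e2, e3) !invgM !invgK !mulgA !mulgVK.
  by case: (q =P i.+1) => [_|_] //; case: eqP.
have -> : (j == i) = false by lia.
have e1 : (i == j) = false by lia.
have -> : (j.+1 == i) = false by lia.
have e2 : (i == j.+1) = false by lia.
have -> : (j == i.+1) = false by lia.
have e3 : (i.+1 == j) = false by lia.
have -> : (j.+1 == i.+1) = false by lia.
have e4 : (i.+1 == j.+1) = false by lia.
rewrite !(e1, e2, e3, e4).
case: (q =P i) => [->|qi]; first by rewrite e1 e2.
by case: (q =P i.+1) => [->|//]; rewrite e3 e4.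
Qed.

Lemma hz_peq n b b' t : peq (braid_nat n) b b' -> hz b t =1 hz b' t.
Proof.
move=> bb'; elim: bb' t => {b b'} [//|u v _ IH t|u v w _ IH1 _ IH2 t|u v a b t|u v x y r t].
- by move=> j; rewrite IH.
- by move=> j; rewrite IH1 IH2.
- rewrite !hz_cat; apply: hz_ext => j; exact: hstepK.
- by rewrite !hz_cat; apply/hz_ext/hz_braid_nat/r.
Qed.

Lemma hz_out b t j : all (fun l => (l.1 != j) && (l.1.+1 != j)) b -> hz b t j = t j.
Proof.
elim: b => //= -[i s] b IH /andP[/= /andP[ij i1j] /IH <-].
by rewrite {1}/hstep /= eq_sym (negPf ij) eq_sym (negPf i1j).
Qed.

Definition shiftw (k : nat) b : word nat := map_word (addn k) b.

Lemma shiftw_cat k u v : shiftw k (u ++ v) = shiftw k u ++ shiftw k v.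
Proof. exact: map_cat. Qed.

Lemma hz_shift k b t j : hz (shiftw k b) t (k + j) = hz b (fun i => t (k + i)) j.
Proof.
elim: b j => //= -[i s] b IH j; rewrite /hstep /=.
by rewrite -!addnS !eqn_add2l !IH.
Qed.

Lemma hz_shift_lt k b t j : j < k -> hz (shiftw k b) t j = t j.
Proof.
move=> jk; apply: hz_out; apply/allP => l /mapP[[i s] _ ->] /=; lia.
Qed.

Lemma hz_local k b t t' : all (fun l => l.1 < k.-1) b ->
  (forall j, j < k -> t j = t' j) -> forall j, j < k -> hz b t j = hz b t' j.
Proof.
move=> + tt'; elim: b => //= -[i s] b IH /andP[/= ik /IH{}IH] j jk.
have h1 := IH i ltac:(lia); have h2 := IH i.+1 ltac:(lia); have h3 := IH j jk.
by rewrite /hstep /= h1 h2 h3.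
Qed.

(** The pairs g h g^-1, g and h, h^-1 g h both multiply to g h, so each step preserves the
    product. *)
Lemma hz_prod n b t : all (fun l => l.1 < n.-1) b ->
  \prod_(0 <= j < n) hz b t j = \prod_(0 <= j < n) t j.
Proof.
elim: b => //= -[i s] b IH /andP[/= ik /IH <-]; move: (hz b t) => {IH}t'.
have in1 : i <= n by lia.
have in2 : i.+2 <= n by lia.
have in3 : i <= i.+2 by lia.
rewrite [LHS](@big_cat_nat _ _ _ i) // [RHS](@big_cat_nat _ _ _ i) //=; congr (_ * _).
  by apply: eq_big_nat => j /andP[_ ji]; rewrite /hstep /= !ifF //; lia.
rewrite [LHS](@big_cat_nat _ _ _ i.+2) // [RHS](@big_cat_nat _ _ _ i.+2) //=; congr (_ * _); last first.
  by apply: eq_big_nat => j /andP[ji _]; rewrite /hstep /= !ifF //; lia.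
rewrite !(@big_ltn _ _ _ i i.+2) ?(@big_ltn _ _ _ i.+1 i.+2) // !big_geq // ?mulg1 /hstep /= !eqxx.
have -> : (i.+1 == i) = false by lia.
by case: s; rewrite ?mulgA ?mulgV ?mul1g ?mulgVK.
Qed.

End Hurwitz.

Lemma hz_morph {G H : groupType} (f : G -> H) b (t : nat -> G) :
  (forall x y, f (x * y)%g = (f x * f y)%g) -> (forall x, f (x^-1)%g = (f x)^-1%g) ->
  (fun j => f (hz b t j)) =1 hz b (fun j => f (t j)).
Proof.
move=> fM fV; elim: b => //= -[i s] b IH j.
rewrite /hstep /=; case: (j == i); last case: (j == i.+1); case: s; by rewrite ?fM ?fV -?IH ?fM ?fV.
Qed.

Lemma pin_hurwitz (A : choiceType) (R : word A -> word A -> Prop) p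
    (b : word 'I_p) (t : seq (word A)) :
  (fun j => pin R (nth [::] (hurwitz b t) j)) =1
  hz (map_word val b) (fun j => pin R (nth [::] t j)).
Proof.
elim: b => //= -[i s] b IH j; rewrite /hurwitz_letter /hstep /= -!IH -/(hurwitz b t).
have e : (i.+1 == i :> nat) = false by lia.
case: s => /=; rewrite nth_set_nth /=; case: (j =P i.+1) => [->|_]; rewrite ?e;
  rewrite ?nth_set_nth /= ?e; try case: (j == i); by rewrite ?pin_cat ?pin_winv ?mulgA.
Qed.

(** * Even subsets of the edges of a bipartite multigraph *)

Section EvenSets.
Context {T : finType}.
Implicit Types (f : T -> nat) (K O : {set T}).

(* An element [x] is an edge joining the vertices [f1 x] and [f2 x] of the two
   sides; [even_for f1 f2 K] says that K is a cycle modulo 2. *)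
Definition even_for f K := forall v, ~~ odd #|[set x in K | f x == v]|.

Definition vertices f O : seq nat := undup [seq f x | x in O].

Lemma mem_vertices f O x : x \in O -> f x \in vertices f O.
Proof. by move=> xO; rewrite mem_undup; apply: image_f. Qed.

Lemma card_vertices f O :
  #|O| = \sum_(v <- vertices f O) #|[set x in O | f x == v]|.
Proof.
under eq_bigr => v _ do rewrite -sum1_card.
rewrite (exchange_big_dep (mem O)) /=; last by move=> v x _; rewrite inE => /andP[].
rewrite -sum1_card; apply: eq_bigr => x xO.
rewrite (eq_bigl (pred1 (f x))); last by move=> v; rewrite /= inE xO /= eq_sym.
rewrite -big_filter filter_pred1_uniq ?undup_uniq ?mem_vertices //.
by rewrite big_seq1.
Qed.

Lemma vertices_double f O :
  (forall x, x \in O -> exists y, [/\ y \in O, y != x & f y = f x]) ->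
  (size (vertices f O)).*2 <= #|O|.
Proof.
move=> h; rewrite (card_vertices f O) -muln2 -sum1_size big_distrl /=.
rewrite big_seq [leqRHS]big_seq; apply: leq_sum => v.
rewrite mem_undup mul1n => /imageP[x xO ->].
have [y [yO yx fyx]] := h x xO.
have -> : 2 = #|[set x; y]| by rewrite cards2 eq_sym yx.
apply/subset_leq_card/subsetP => z; rewrite !inE => /orP[] /eqP ->.
  by rewrite xO eqxx.
by rewrite yO fyx eqxx.
Qed.

Variables f1 f2 : T -> nat.

Section Incidence.
Import GRing.Theory.
Local Open Scope ring_scope.
Variable O : {set T}.
Let s1 := vertices f1 O.
Let s2 := vertices f2 O.

(** Rows are edges and columns are vertices of either side, so the left kernel is the cycle space
    modulo 2. *)
Definition incidence : 'M['F_2]_(#|O|, size s1 + size s2) :=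
  \matrix_(i, j) match split j with
    | inl a => (f1 (enum_val i) == nth 0%N s1 a)%:R
    | inr a => (f2 (enum_val i) == nth 0%N s2 a)%:R
    end.

Lemma sum_nth_eq (s : seq nat) v : uniq s -> v \in s ->
  \sum_(a < size s) (v == nth 0%N s a)%:R = 1 :> 'F_2.
Proof.
move=> us vs; have vi : (index v s < size s)%N by rewrite index_mem.
rewrite (bigD1 (Ordinal vi)) //= nth_index // eqxx big1 ?addr0 // => a.
move=> /eqP ai; case: (v =P _) => // va.
by case: ai; apply: val_inj; rewrite /= va index_uniq.
Qed.

Lemma natF2_odd n : (n%:R == 0 :> 'F_2) = ~~ odd n.
Proof.
rewrite -{1}[n]odd_double_half natrD -muln2 natrM.
have -> : (2%:R : 'F_2) = 0 by apply/eqP.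
by rewrite mulr0 addr0; case: (odd n).
Qed.

Lemma F2_bool (a : 'F_2) : a = (a == 1)%:R.
Proof. by case: a => -[|[|m]] //= hm; apply: val_inj. Qed.

Lemma even_for_row f (u : 'rV['F_2]_#|O|) :
  (forall v, v \in vertices f O ->
     \sum_i u 0 i * (f (enum_val i) == v)%:R = 0) ->
  even_for f [set enum_val i | i in 'I_#|O| & u 0 i == 1].
Proof.
move=> h v; have [/h|] := boolP (v \in vertices f O); last first.
  move=> vf; rewrite (_ : [set _ in _ | _] = set0) ?cards0 //.
  apply/setP => x; rewrite !inE; apply/negP => /andP[/imsetP[i _ ->] /eqP fv].
  by rewrite -fv mem_vertices ?enum_valP in vf.
rewrite -natF2_odd => e; apply/eqP; rewrite -[RHS]e.
rewrite (_ : [set _ in _ | _] =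
  [set enum_val i | i in 'I_#|O| & (u 0 i == 1) && (f (enum_val i) == v)]); last first.
  apply/setP => x; rewrite !inE; apply/andP/imsetP.
    by move=> [/imsetP[i]]; rewrite inE => /andP[_ ui] -> fi; exists i; rewrite // !inE ui.
  by move=> [i]; rewrite !inE => /and3P[_ ui fi] ->; rewrite fi; split=> //; apply: imset_f; rewrite !inE.
rewrite card_imset; last exact: enum_val_inj.
rewrite -sum1_card natr_sum big_mkcond /=; apply: eq_bigr => i _.
rewrite [u 0 i]F2_bool inE; case: (u 0 i == 1) => /=; last by rewrite mul0r.
by rewrite mul1r; case: ifP.
Qed.

Lemma incidence_ker : ~~ row_free incidence ->
  exists K, [/\ K != set0, K \subset O, even_for f1 K & even_for f2 K].
Proof.
rewrite -kermx_eq0 => /rowV0Pn[u /sub_kermxP uM u0].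
exists [set enum_val i | i in 'I_#|O| & u 0 i == 1]; split.
- have [i ui] : exists i, u 0 i != 0 by apply/rV0Pn.
  apply/set0Pn; exists (enum_val i); apply: imset_f; rewrite inE.
  by move: ui; rewrite {1}[u 0 i]F2_bool; case: (u 0 i == 1).
- by apply/subsetP => x /imsetP[i _ ->]; apply: enum_valP.
- apply: even_for_row => v vf; have vi : (index v s1 < size s1)%N by rewrite index_mem.
  have /matrixP/(_ 0 (lshift _ (Ordinal vi))) := uM.
rewrite !mxE => e; rewrite -[RHS]e; apply: eq_bigr => i _; rewrite !mxE.
  by rewrite (unsplitK (inl _)) /= nth_index.
- apply: even_for_row => v vf; have vi : (index v s2 < size s2)%N by rewrite index_mem.
  have /matrixP/(_ 0 (rshift _ (Ordinal vi))) := uM.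
  rewrite !mxE => e; rewrite -[RHS]e; apply: eq_bigr => i _; rewrite !mxE.
  by rewrite (unsplitK (inr _)) /= nth_index.
Qed.

(** An edge has one endpoint on each side, so every row sums to 1 + 1 = 0. *)
Lemma incidence_sum : incidence *m const_mx 1 = 0 :> 'cV_#|O|.
Proof.
apply/matrixP => i j; rewrite !mxE big_split_ord /=.
under eq_bigr => a _ do rewrite !mxE (unsplitK (inl _)) mulr1.
under [X in _ + X]eq_bigr => a _ do rewrite !mxE (unsplitK (inr _)) mulr1.
rewrite !sum_nth_eq ?undup_uniq ?mem_vertices ?enum_valP //.
by apply/eqP.
Qed.

(** The all-ones vector in the right kernel pushes the rank below the number of vertices, hence
    below the number of edges, and the rows are dependent. *)
Lemma even_exists : O != set0 -> (size s1 + size s2 <= #|O|)%N ->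
  exists K, [/\ K != set0, K \subset O, even_for f1 K & even_for f2 K].
Proof.
move=> /set0Pn[x xO] le; apply: incidence_ker; apply/negP => /eqP rk.
have := mulmx0_rank_max incidence_sum; rewrite rk.
have : (0 < \rank (const_mx 1%R : 'cV['F_2]_(size s1 + size s2)))%N.
  rewrite lt0n mxrank_eq0; apply/eqP => /matrixP.
  have p : (0 < size s1 + size s2)%N.
    have : f1 x \in s1 by apply: mem_vertices.
    by rewrite /s1; case: (vertices f1 O).
  by move=> /(_ (Ordinal p) 0); rewrite !mxE => /eqP.
lia.
Qed.

(* Dually, when there is no cycle every edge is a bridge, so it is the
   coboundary of a set of vertices. *)
Lemma bridge : (forall K, K \subset O -> even_for f1 K -> even_for f2 K -> K = set0) ->
  forall t, t \in O -> exists y1 y2 : nat -> bool,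
    forall x, x \in O -> y1 (f1 x) (+) y2 (f2 x) = (x == t).
Proof.
move=> noeven t tO.
(* Without cycles the incidence matrix has a right inverse; its column indexed by [t] holds the
   required vertex potential. *)
have /row_freeP[B MB] : row_free incidence.
  apply/negPn/negP => /incidence_ker[K [K0 KO e1 e2]].
  by rewrite (noeven K) ?eqxx in K0.
pose c := enum_rank_in tO t.
pose z1 v : 'F_2 := \sum_(a < size s1) (v == nth 0%N s1 a)%:R * B (lshift _ a) c.
pose z2 v : 'F_2 := \sum_(a < size s2) (v == nth 0%N s2 a)%:R * B (rshift _ a) c.
exists (fun v => z1 v == 1), (fun v => z2 v == 1) => x xO.
have : z1 (f1 x) + z2 (f2 x) = (x == t)%:R.
  have /matrixP/(_ (enum_rank_in tO x) c) := MB.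
  rewrite !mxE (can_in_eq (enum_rankK_in tO)) // => <-.
  rewrite big_split_ord /=; congr (_ + _); apply: eq_bigr => a _;
  by rewrite mxE ?(unsplitK (inl _)) ?(unsplitK (inr _)) enum_rankK_in.
rewrite [z1 _]F2_bool [z2 _]F2_bool.
by case: (z1 _ == 1); case: (z2 _ == 1); case: (x == t) => //= /eqP.
Qed.

End Incidence.
End EvenSets.

(** * Noncrossing labellings *)

Definition noncross (l : seq nat) : Prop :=
  forall a b, a != b -> ~~ subseq [:: a; b; a; b] l.

Lemma noncross_sub l1 l2 : subseq l1 l2 -> noncross l2 -> noncross l1.
Proof.
by move=> s12 nc a b ab; apply/negP => /subseq_trans/(_ s12); apply/negP/nc.
Qed.

Lemma subseq_consP (x : nat) s l :
  subseq (x :: s) l <-> exists2 i, i < size l /\ nth 0 l i = x & subseq s (drop i.+1 l).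
Proof.
split.
  elim: l => //= y l IH; case: (x =P y) => [->|_] h.
    by exists 0; rewrite ?drop0.
  by have [i [il ix] hs] := IH h; exists i.+1.
move=> [i [il <-] hs]; rewrite -{2}[l](cat_take_drop i) (drop_nth 0 il).
by apply: subseq_trans (suffix_subseq _ _); rewrite /= eqxx.
Qed.

Lemma subseq4P (a b c d : nat) l : subseq [:: a; b; c; d] l <->
  exists i j k m, [/\ i < j, j < k, k < m & m < size l] /\
    [/\ nth 0 l i = a, nth 0 l j = b, nth 0 l k = c & nth 0 l m = d].
Proof.
split.
  move=> /subseq_consP[i [il ia]] /subseq_consP[j [jl jb]].
  rewrite drop_drop => /subseq_consP[k [kl kc]].
  rewrite drop_drop => /subseq_consP[m [ml md] _].
  rewrite !size_drop !nth_drop in jl jb kl kc ml md.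
  exists i, (i.+1 + j), (j.+1 + i.+1 + k), (k.+1 + (j.+1 + i.+1) + m).
  by split; split=> //; lia.
move=> [i [j [k [m [[ij jk km ml] [ia jb kc md]]]]]].
apply/subseq_consP; exists i; first by split=> //; lia.
apply/subseq_consP; exists (j - i.+1).
  by rewrite size_drop nth_drop subnKC //; split=> //; lia.
rewrite drop_drop addSn subnK //; apply/subseq_consP; exists (k - j.+1).
  by rewrite size_drop nth_drop subnKC //; split=> //; lia.
rewrite drop_drop addSn subnK //; apply/subseq_consP; exists (m - k.+1); last exact: sub0seq.
by rewrite size_drop nth_drop subnKC //; split=> //; lia.
Qed.

Lemma noncrossP l : noncross l <-> forall i j k m, i < j -> j < k -> k < m -> m < size l ->
  nth 0 l i = nth 0 l k -> nth 0 l j = nth 0 l m -> nth 0 l i = nth 0 l j.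
Proof.
split=> [nc i j k m ij jk km ml ik jm|nc a b ab].
  apply/eqP/negPn/negP => ne; have := nc _ _ ne; apply/negP/negPn/subseq4P.
  by exists i, j, k, m; split.
apply/negP => /subseq4P[i [j [k [m [[ij jk km ml] [ia jb kc md]]]]]].
by move: ab; rewrite -ia -jb (nc i j k m) ?eqxx // ?ia ?jb.
Qed.

Section Blocks.
Local Open Scope group_scope.
Variables (G : groupType) (N : G -> nat).
Hypothesis N1 : N 1 = 0%N.
Hypothesis NM : forall x y, N (x * y) <= N x + N y.
Hypothesis NJ : forall x y, N (x * y * x^-1) = N y.

Definition block (v : seq (nat * G)) (L : nat) : G :=
  \big[*%g/1]_(p <- v | p.1 == L) p.2.

Definition wprod (v : seq (nat * G)) : G := \big[*%g/1]_(p <- v) p.2.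

Lemma block_cat v w L : block (v ++ w) L = block v L * block w L.
Proof. by rewrite /block big_cat. Qed.

Lemma block_out v L : L \notin unzip1 v -> block v L = 1.
Proof.
move=> Lv; rewrite /block big_seq_cond big1 // => p /andP[pv /eqP pL].
by move: Lv; rewrite -pL (map_f fst pv).
Qed.

Lemma wprod_cat v w : wprod (v ++ w) = wprod v * wprod w.
Proof. by rewrite /wprod big_cat. Qed.

(** If the first label recurs, then s Z s' w = (s Z s^-1) (s s') w. Conjugation invariance discards
    the conjugator, and noncrossing keeps the labels of the enclosed stretch Z apart from those of
    the rest. *)
Lemma norm_wprod v : noncross (unzip1 v) ->
  N (wprod v) <= \sum_(L <- undup (unzip1 v)) N (block v L).
Proof.
have [n] := ubnP (size v); elim: n v => // n IH [|[L s] v] /=.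
  by rewrite /wprod !big_nil N1.
rewrite ltnS => vn nc.
have -> : wprod ((L, s) :: v) = s * wprod v by rewrite /wprod big_cons.
have [Lv|Lv] := boolP (L \in unzip1 v); last first.
  rewrite big_cons; apply: leq_trans (NM _ _) _; apply: leq_add.
    by rewrite /block big_cons /= eqxx [X in s * X]block_out // mulg1.
  have nc' : noncross (unzip1 v) by apply: noncross_sub nc; apply: subseq_cons.
  apply: leq_trans (IH _ vn nc') _; rewrite big_seq [leqRHS]big_seq.
  apply: leq_sum => M; rewrite mem_undup => Mv; rewrite /block big_cons /=.
  by case: (L =P M) => // LM; rewrite LM Mv in Lv.
(* v = Z ++ (L, s') :: w with L not occurring in Z *)
have [Z [s' [w [vE LZ]]]] : exists Z s' w, v = Z ++ (L, s') :: w /\ L \notin unzip1 Z.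
  elim: (v) Lv => // -[M x] u IHu; rewrite in_cons.
  case: (L =P M) => [-> _|LM /= /IHu[Z [s' [w [-> LZ]]]]]; first by exists [::], x, u.
  by exists ((M, x) :: Z), s', w; rewrite in_cons negb_or LZ; split=> //; case: eqP.
have nc1 : noncross (unzip1 Z).
  apply: noncross_sub nc; rewrite vE /unzip1 map_cat; apply: subseq_trans (subseq_cons _ _).
  exact: prefix_subseq.
have nc2 : noncross (unzip1 ((L, (s * s')%g) :: w)).
  apply: noncross_sub nc; rewrite vE /unzip1 map_cat; apply: subseq_trans (subseq_cons _ _).
  exact: suffix_subseq.
have disj M : M \in unzip1 Z -> M \in unzip1 ((L, s') :: w) -> False.
  move=> MZ Mw; have ML : M != L by apply: contraNneq LZ => <-.
  have LM : L != M by rewrite eq_sym.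
  move/negP: (nc _ _ LM); apply.
  move: Mw; rewrite /= in_cons (negPf ML) /= => Mw.
  rewrite eqxx vE /unzip1 map_cat; apply: (@cat_subseq _ [:: M] [:: L; M]).
    by rewrite sub1seq.
  by rewrite /= eqxx sub1seq.
have -> : s * wprod v = (s * wprod Z * s^-1) * wprod ((L, (s * s')%g) :: w).
  by rewrite vE wprod_cat /wprod !big_cons /= !mulgA mulgVK.
apply: leq_trans (NM _ _) _; rewrite NJ.
have sz : size Z < n /\ size ((L, (s * s')%g) :: w) < n.
  by move: vn; rewrite vE size_cat /=; lia.
apply: leq_trans (leq_add (IH Z sz.1 nc1) (IH _ sz.2 nc2)) _.
have -> : \sum_(M <- undup (unzip1 v)) N (block ((L, s) :: v) M) =
   \sum_(M <- undup (unzip1 Z) ++ undup (unzip1 ((L, s') :: w))) N (block ((L, s) :: v) M).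
  apply: perm_big; apply: uniq_perm; rewrite ?undup_uniq //.
    rewrite cat_uniq !undup_uniq andTb andbT; apply/hasPn => M; rewrite !mem_undup => Mw.
    by apply/negP => MZ; exact: disj M MZ Mw.
  move=> M; rewrite mem_cat !mem_undup vE /unzip1 map_cat /= !(in_cons, mem_cat).
  by case: (M == L); rewrite ?orbT.
rewrite big_cat; apply: leq_add.
  rewrite big_seq [leqRHS]big_seq; apply: leq_sum => M; rewrite mem_undup => MZ.
  have ML : (L == M) = false by apply: contraNF LZ => /eqP ->.
  rewrite vE -cat1s !block_cat [X in _ <= N (X * _)]/block big_cons /= ML big_nil mul1g.
  by rewrite (@block_out (_ :: w)) ?mulg1 //; apply/negP => /(disj _ MZ).
rewrite big_seq [leqRHS]big_seq; apply: leq_sum => M; rewrite mem_undup => Mw.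
rewrite vE -(cat1s (L, s)) !block_cat (@block_out Z) ?mul1g; last by apply/negP => /disj; apply.
by rewrite /block !big_cons big_nil /=; case: ifP; rewrite ?mul1g ?mulg1 ?mulgA.
Qed.

End Blocks.

(** * A pair of noncrossing labellings of minimal cost *)

Lemma sum_undup_sub (s s' : seq nat) (m : nat -> nat) : {subset s' <= s} ->
  \sum_(L <- undup s') m L + \sum_(L <- undup s | L \notin s') m L =
  \sum_(L <- undup s) m L.
Proof.
move=> ss'; rewrite [RHS](bigID (mem s')) /=; congr (_ + _).
rewrite -[RHS]big_filter; apply: perm_big; apply: uniq_perm.
- exact: undup_uniq.
- by rewrite filter_uniq ?undup_uniq.
by move=> L; rewrite mem_filter !mem_undup; case: (boolP (L \in s')) => // /ss' ->.
Qed.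

Section Meander.
Local Open Scope group_scope.
Variables (G : groupType) (N : G -> nat) (K : G -> Prop).
Hypothesis N1 : N 1 = 0%N.
Hypothesis NM : forall x y, N (x * y) <= N x + N y.
Hypothesis NJ : forall x y, N (x * y * x^-1) = N y.
Hypothesis NK : forall z a b, K z -> N (a * z * b) = N (a * b).
Hypothesis KV : forall z, K z -> K z^-1.

Variables (r : nat) (g : 'I_r -> G) (ty : 'I_r -> bool) (lab1 lab2 : 'I_r -> nat).
Variables (c1 c2 : G) (d1 d2 : nat) (ty1 : bool) (m1 m2 : nat -> nat).

Definition word1 (s : seq 'I_r) := [seq (lab1 x, g x) | x <- s].
(** The complement of [word1 s]: the reversed inverse letters cancel against [word1 s] for every
    choice of [s], which is what makes deletion harmless. *)
Definition word2 (s : seq 'I_r) :=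
  [seq (lab2 x, (g x)^-1) | x <- rev s] ++ [:: (d1, c1); (d2, c2)].

Let all := enum 'I_r.
Let size_all : size all = r := size_enum_ord r.
Hypothesis nc1 : noncross (unzip1 (word1 all)).
Hypothesis nc2 : noncross (unzip1 (word2 all)).
Hypothesis pure1 : forall x y, lab1 x = lab1 y -> ty x = ty y.
Hypothesis pure2 : forall x y, lab2 x = lab2 y -> ty x = ty y.
Hypothesis pured1 : forall x, lab2 x = d1 -> ty x = ty1.
Hypothesis pured2 : forall x, lab2 x = d2 -> ty x = ~~ ty1.
Hypothesis alternate : forall x y : 'I_r, x.+1 = y :> nat -> ty y = ~~ ty x.
Hypothesis g_neq1 : forall x, g x != 1.
Hypothesis cost1 : forall L, L \in unzip1 (word1 all) -> N (block (word1 all) L) <= m1 L.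
Hypothesis cost2 : forall L, L \in unzip1 (word2 all) -> N (block (word2 all) L) <= m2 L.
Hypothesis free1 : forall L, L \in unzip1 (word1 all) -> m1 L = 0%N -> block (word1 all) L = 1.
Hypothesis free2 : forall L, L \in unzip1 (word2 all) -> m2 L = 0%N -> block (word2 all) L = 1.
Hypothesis tight : (\sum_(L <- undup (unzip1 (word1 all))) m1 L +
  \sum_(L <- undup (unzip1 (word2 all))) m2 L <= N (c1 * c2))%N.

Lemma prodg_rev_inv (T : Type) (s : seq T) (h : T -> G) :
  \big[*%g/1]_(x <- rev s) (h x)^-1 = (\big[*%g/1]_(x <- s) h x)^-1.
Proof.
elim: s => [|x s IH]; first by rewrite !big_nil invg1.
by rewrite rev_cons -cats1 big_cat big_seq1 big_cons invgM IH.
Qed.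

Lemma wprod_words s : wprod (word1 s) * wprod (word2 s) = c1 * c2.
Proof.
rewrite wprod_cat /wprod /word1 !big_map prodg_rev_inv mulgA mulgV mul1g.
by rewrite !big_cons big_nil mulg1.
Qed.

(** The dropped letters lie in [K], and [NK] ignores each of them inside any product. *)
Lemma norm_prod_drop (T : Type) (s : seq T) (P D : pred T) (h : T -> G) a b :
  (forall x, P x -> D x -> K (h x)) ->
  N (a * (\big[*%g/1]_(x <- s | P x && ~~ D x) h x) * b) =
  N (a * (\big[*%g/1]_(x <- s | P x) h x) * b).
Proof.
move=> hK; elim: s a => [|x s IH] a; first by rewrite !big_nil.
rewrite !big_cons; have := hK x; case: (P x) => //= hx.
case Dx: (D x) hx => /= hx; last by rewrite !mulgA IH.
by rewrite IH -!mulgA [a * (h x * _)]mulgA NK ?mulgA //; apply: hx.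
Qed.

Section Deletion.
Variable Del : {set 'I_r}.
Definition full1 x := [forall y, (lab1 y == lab1 x) ==> (y \in Del)].
(** The blocks of [d1] and [d2] keep an end letter that is never deleted, so they cannot
    disappear. *)
Definition full2 x := [&& lab2 x != d1, lab2 x != d2 &
   [forall y, (lab2 y == lab2 x) ==> (y \in Del)]].
Hypothesis del1 : forall x, x \in Del -> full1 x \/ K (g x).
Hypothesis del2 : forall x, x \in Del -> full2 x \/ K (g x).
Let kept := [seq x <- all | x \notin Del].

Lemma mem_word1 s x : x \in s -> lab1 x \in unzip1 (word1 s).
Proof. by move=> xs; rewrite /unzip1 /word1 -map_comp; apply: map_f. Qed.

Lemma word1P s L : L \in unzip1 (word1 s) -> exists2 x, x \in s & L = lab1 x.
Proof. by rewrite /unzip1 /word1 -map_comp => /mapP. Qed.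

Lemma mem_word2 s x : x \in s -> lab2 x \in unzip1 (word2 s).
Proof.
by move=> xs; rewrite /unzip1 /word2 map_cat mem_cat -map_comp map_f ?mem_rev.
Qed.

Lemma word2P s L : L \in unzip1 (word2 s) ->
  [\/ exists2 x, x \in s & L = lab2 x, L = d1 | L = d2].
Proof.
rewrite /unzip1 /word2 map_cat mem_cat -map_comp => /orP[/mapP[x]|].
  by rewrite mem_rev => xs ->; constructor 1; exists x.
by rewrite !inE => /orP[] /eqP; [constructor 2|constructor 3].
Qed.

Lemma block_word1 s L : block (word1 s) L = \big[*%g/1]_(x <- s | lab1 x == L) g x.
Proof. by rewrite /block big_map. Qed.

Lemma block_word2 s L : block (word2 s) L =
  \big[*%g/1]_(x <- rev s | lab2 x == L) (g x)^-1 * block [:: (d1, c1); (d2, c2)] L.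
Proof. by rewrite block_cat {1}/block big_map. Qed.

Lemma kept_cost1 L : L \in unzip1 (word1 kept) -> N (block (word1 kept) L) <= m1 L.
Proof.
move=> /word1P[x]; rewrite mem_filter mem_enum andbT => xD ->.
apply: leq_trans (cost1 (mem_word1 (mem_enum _ x))).
rewrite !block_word1 big_filter_cond -[X in N X]mulg1 -[X in N (X * _)]mul1g.
rewrite (eq_bigl (fun y => (lab1 y == lab1 x) && ~~ (y \in Del))); last by move=> y; rewrite andbC.
rewrite norm_prod_drop ?mul1g ?mulg1 // => y /eqP yx /del1[/forallP/(_ x)|//].
by rewrite yx eqxx (negPf xD).
Qed.

Lemma kept_cost2 L : L \in unzip1 (word2 kept) -> N (block (word2 kept) L) <= m2 L.
Proof.
move=> Lk; apply: leq_trans (cost2 (_ : L \in unzip1 (word2 all))); last first.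
  case: (word2P Lk) => [[x _ ->]|->|->]; first by rewrite mem_word2 // mem_enum.
    by rewrite /unzip1 map_cat mem_cat !inE eqxx orbT.
  by rewrite /unzip1 map_cat mem_cat !inE eqxx !orbT.
rewrite !block_word2 /kept -filter_rev big_filter_cond -[X in N (X * _)]mul1g.
rewrite (eq_bigl (fun y => (lab2 y == L) && ~~ (y \in Del))); last by move=> y; rewrite andbC.
rewrite norm_prod_drop ?mul1g // => y /eqP yL /del2[|/KV //] /and3P[y1 y2 /forallP yD].
case: (word2P Lk) => [[x]|Ld|Ld].
- rewrite mem_filter => /andP[xD _] Lx; move: (yD x).
  by rewrite yL Lx eqxx (negPf xD).
- by rewrite yL Ld eqxx in y1.
- by rewrite yL Ld eqxx in y2.
Qed.

Lemma kept_sum m v : noncross (unzip1 v) ->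
  (forall L, L \in unzip1 v -> N (block v L) <= m L) ->
  N (wprod v) <= \sum_(L <- undup (unzip1 v)) m L.
Proof.
move=> nc h; apply: leq_trans (norm_wprod N1 NM NJ nc) _.
by rewrite big_seq [leqRHS]big_seq; apply: leq_sum => L; rewrite mem_undup => /h.
Qed.

(* Deleting letters that lie in completely deleted blocks, or that are killed
   by the norm, must not save anything. *)
Lemma deleted_free : (forall x, full1 x -> m1 (lab1 x) = 0%N) /\
  (forall x, full2 x -> m2 (lab2 x) = 0%N).
Proof.
have kall : subseq kept all by apply: filter_subseq.
have s1 : subseq (unzip1 (word1 kept)) (unzip1 (word1 all)) by do 2!apply: map_subseq.
have s2 : subseq (unzip1 (word2 kept)) (unzip1 (word2 all)).
  rewrite /unzip1 !map_cat; apply: cat_subseq => //; do 2!apply: map_subseq.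
  by rewrite subseq_rev.
have h1 := kept_sum (noncross_sub s1 nc1) kept_cost1.
have h2 := kept_sum (noncross_sub s2 nc2) kept_cost2.
(* The kept words still multiply to [c1 * c2], so the costs of their blocks already reach its norm,
   while [tight] caps the total of all costs by the same norm. *)
have h := NM (wprod (word1 kept)) (wprod (word2 kept)); rewrite wprod_words in h.
have e1 := sum_undup_sub m1 (mem_subseq s1).
have e2 := sum_undup_sub m2 (mem_subseq s2).
have := leq_trans tight (leq_trans h (leq_add h1 h2)).
rewrite -e1 -e2 addnACA -[leqRHS]addn0 leq_add2l leqn0 addn_eq0 => /andP[/eqP z1 /eqP z2].
split=> x fx; apply/eqP.
  move/eqP: z1; rewrite sum_nat_seq_eq0 => /allP/(_ (lab1 x)).
  rewrite mem_undup mem_word1 ?mem_enum // => /(_ isT)/implyP; apply.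
  apply/negP => /word1P[y]; rewrite mem_filter => /andP[yD _] xy.
  by move/forallP: fx => /(_ y); rewrite xy eqxx (negPf yD).
move/eqP: z2; rewrite sum_nat_seq_eq0 => /allP/(_ (lab2 x)).
rewrite mem_undup mem_word2 ?mem_enum // => /(_ isT)/implyP; apply.
case/and3P: fx => x1 x2 /forallP fx; apply/negP => /word2P[[y]|/eqP|/eqP]; rewrite ?(negPf x1) ?(negPf x2) //.
by rewrite mem_filter => /andP[yD _] xy; move: (fx y); rewrite xy eqxx (negPf yD).
Qed.

(** A block of cost 0 has product 1, which a single nontrivial letter cannot have. *)
Lemma deleted_double1 x : full1 x -> exists y, y != x /\ lab1 y = lab1 x.
Proof.
move=> fx; have := free1 (mem_word1 (mem_enum _ x)) (deleted_free.1 x fx).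
have [/existsP[y /andP[yx /eqP yl]]|] := boolP [exists y, (y != x) && (lab1 y == lab1 x)].
  by exists y.
move=> /existsPn h; rewrite block_word1 (eq_bigl (pred1 x)); last first.
  by move=> y /=; have := h y; case: (y =P x) => [->|_] /=; rewrite ?eqxx // => /negPf.
rewrite -big_filter filter_pred1_uniq ?enum_uniq ?mem_enum //.
by rewrite big_seq1 => /eqP; rewrite (negPf (g_neq1 x)).
Qed.

Lemma deleted_double2 x : full2 x -> exists y, y != x /\ lab2 y = lab2 x.
Proof.
move=> fx; have := free2 (mem_word2 (mem_enum _ x)) (deleted_free.2 x fx).
have [/existsP[y /andP[yx /eqP yl]]|] := boolP [exists y, (y != x) && (lab2 y == lab2 x)].
  by exists y.
move=> /existsPn h; rewrite block_word2 (eq_bigl (pred1 x)); last first.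
  by move=> y /=; have := h y; case: (y =P x) => [->|_] /=; rewrite ?eqxx // => /negPf.
case/and3P: fx => x1 x2 _.
rewrite block_out ?mulg1; last by rewrite !inE negb_or x1 x2.
rewrite -big_filter filter_pred1_uniq ?rev_uniq ?enum_uniq ?mem_rev ?mem_enum //.
by rewrite big_seq1 => /eqP; rewrite invg_eq1 (negPf (g_neq1 x)).
Qed.

End Deletion.

Lemma nth_word1 (i : 'I_r) : nth 0%N (unzip1 (word1 all)) i = lab1 i.
Proof.
rewrite /unzip1 /word1 -map_comp (nth_map i) ?size_all ?ltn_ord //=.
by rewrite nth_ord_enum.
Qed.

Lemma noncross_lab1 (i j k m : 'I_r) : i < j -> j < k -> k < m ->
  lab1 i = lab1 k -> lab1 j = lab1 m -> lab1 i = lab1 j.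
Proof.
move=> ij jk km; have /noncrossP/(_ i j k m ij jk km) := nc1.
by rewrite !nth_word1 2!size_map size_all => /(_ (ltn_ord m)).
Qed.

Lemma nth_word2 (i : 'I_r) : nth 0%N (unzip1 (word2 all)) (r - i.+1) = lab2 i.
Proof.
have ir := ltn_ord i.
have e : (r - (r - i.+1).+1 = i)%N by lia.
have lt : (r - i.+1 < size all)%N by rewrite size_all; lia.
rewrite /unzip1 /word2 map_cat nth_cat -map_comp size_map size_rev lt.
rewrite (nth_map i) ?size_rev //= (nth_rev _ lt) size_all e.
by rewrite nth_ord_enum.
Qed.

Lemma size_word2 : size (unzip1 (word2 all)) = r.+2.
Proof. by rewrite size_map size_cat size_map size_rev size_all /= addn2. Qed.

Lemma noncross_lab2 (i j k m : 'I_r) : i < j -> j < k -> k < m ->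
  lab2 i = lab2 k -> lab2 j = lab2 m -> lab2 i = lab2 j.
Proof.
move=> ij jk km; have := ltn_ord m => mr ik jm.
have /noncrossP/(_ (r - m.+1) (r - k.+1) (r - j.+1) (r - i.+1))%N := nc2.
rewrite size_word2 !nth_word2 ik jm => -> //; lia.
Qed.

(** In [word2] the end letters come after all others, so the one labelled like [k] completes the
    crossing pattern m, k, j, end. *)
Lemma noncross_end (j k m : 'I_r) : j < k -> k < m -> lab2 m = lab2 j ->
  lab2 k = d1 \/ lab2 k = d2 -> lab2 m = lab2 k.
Proof.
move=> jk km mj kd; have := ltn_ord m => mr.
have [e er] : exists2 e, (r <= e < r.+2)%N & nth 0%N (unzip1 (word2 all)) e = lab2 k.
  have nthD i : nth 0%N (unzip1 (word2 all)) (r + i) = nth 0%N [:: d1; d2] i.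
    rewrite /unzip1 /word2 map_cat nth_cat 2!size_map size_rev size_all.
    by rewrite ifF; [rewrite addKn|lia].
  case: kd => ->; [exists (r + 0)%N|exists (r + 1)%N]; rewrite ?nthD //; lia.
move=> ek; have /noncrossP/(_ (r - m.+1) (r - k.+1) (r - j.+1) e)%N := nc2.
rewrite size_word2 !nth_word2 ek mj => -> //; lia.
Qed.

Lemma even_classes (f : 'I_r -> nat) (E B : {set 'I_r}) : even_for f E ->
  B \subset E -> (forall x y, x \in B -> y \in E -> f x = f y -> y \in B) ->
  ~~ odd #|B|.
Proof.
move=> eE BE hB; rewrite (card_vertices f B) -dvdn2 big_seq; apply: dvdn_sum => v.
rewrite mem_undup => /imageP[x xB ->]; rewrite dvdn2.
rewrite (_ : [set _ in B | _] = [set y in E | f y == f x]) ?eE //.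
apply/setP => y; rewrite !inE; case: (f y =P f x) => [yx|_]; rewrite ?andbF // !andbT.
by apply/idP/idP => [/(subsetP BE)//|yE]; apply: hB yE _; last exact: esym yx.
Qed.

(** Its parity decides whether [y] is enclosed by the closed curves that an even set [E] draws, as
    in the Jordan curve theorem. *)
Definition below (E : {set 'I_r}) (y : 'I_r) := #|[set x in E | x < y]|.

Lemma below_split E (y z : 'I_r) : y < z ->
  below E z = (below E y + #|[set x in E | y <= x < z]|)%N.
Proof.
move=> yz; rewrite /below -cardsUI (_ : _ :&: _ = set0) ?cards0 ?addn0.
  apply: eq_card => x; rewrite !inE; case: (x \in E) => //=; lia.
apply/setP => x; rewrite !inE; case: (x \in E) => //=; lia.
Qed.

(** By noncrossing, a class of [E] with one member between [y] and [z] has all its members there, so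
    [E] has an even number of letters in between. *)
Lemma parity_class (f : 'I_r -> nat) (E : {set 'I_r}) (y z : 'I_r) :
  (forall i j k m : 'I_r, i < j -> j < k -> k < m ->
     f i = f k -> f j = f m -> f i = f j) ->
  even_for f E -> (forall x, x \in E -> f x != f y) ->
  f y = f z -> odd (below E y) = odd (below E z).
Proof.
move=> nc eE Ey; wlog yz : y z Ey / y <= z.
  move=> hw yz; case: (leqP y z) => [|/ltnW] le; first exact: hw.
  by apply/esym/hw => // x /Ey; rewrite yz.
move=> fyz; move: yz; rewrite leq_eqVlt => /orP[/eqP/val_inj ->//|yz].
rewrite (below_split E yz) oddD.
suff /negPf-> : ~~ odd #|[set x in E | y <= x < z]| by rewrite addbF.
apply: (even_classes eE); first by apply/subsetP => x; rewrite inE => /andP[].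
move=> x x'; rewrite !inE => /and3P[xE yx xz] x'E xx'; rewrite x'E /=.
have nxy := Ey x xE; have nx'y := Ey x' x'E.
have xy : y != x :> nat by apply: contraNneq nxy => /val_inj ->.
have x'y : y != x' :> nat by apply: contraNneq nx'y => /val_inj ->.
have x'z : z != x' :> nat by apply: contraNneq nx'y => /val_inj <-; rewrite fyz.
apply/negPn/negP => h; move: nxy.
have [lt|lt] : (x' < y)%N \/ (z < x')%N by lia.
  by rewrite xx' (nc x' y x z) ?eqxx //; lia.
by rewrite -(nc y x z x') ?eqxx //; lia.
Qed.

Definition even_pure (E : {set 'I_r}) t :=
  [/\ even_for lab1 E, even_for lab2 E & forall x, x \in E -> ty x = t].

Lemma even_two (f : 'I_r -> nat) E x : even_for f E -> x \in E ->
  exists y, [/\ y \in E, y != x & f y = f x].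
Proof.
move=> /(_ (f x)) eE xE; have : x \in [set y in E | f y == f x] by rewrite inE xE eqxx.
move=> xI; move: eE; rewrite (cardsD1 x) xI /=.
case: (set_0Vmem ([set y in E | f y == f x] :\ x)) => [->|[y]]; first by rewrite cards0.
by rewrite !inE => /and3P[yx yE /eqP fyx] _; exists y.
Qed.

(* An even set of one type encloses letters of the other type, which contain
   an even set within a strictly smaller interval. *)
Lemma even_pure_eq0 n a b E t : b - a < n -> even_pure E t ->
  (forall x, x \in E -> a <= x < b) -> E = set0.
Proof.
elim: n a b E t => // n IH a b E t ban [e1 e2 Et] Eab.
case: (set_0Vmem E) => // -[x0 x0E].
pose lo := [arg min_(x < x0 in E) (x : nat)].
pose hi := [arg max_(x > x0 in E) (x : nat)].
have [loE lomin] : lo \in E /\ forall x, x \in E -> lo <= x.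
  by rewrite /lo; case: arg_minnP.
have [hiE himax] : hi \in E /\ forall x, x \in E -> x <= hi.
  by rewrite /hi; case: arg_maxnP.
clearbody lo hi.
(* The enclosed letters of the other type; since labels are pure, their blocks are disjoint from
   those of [E]. *)
pose O := [set y | (ty y != t) && odd (below E y)].
have Obnd y : y \in O -> lo < y < hi.
  rewrite inE => /andP[yt oy].
  have ylo : y != lo :> nat by apply: contraNneq yt => /val_inj ->; rewrite Et.
  have yhi : y != hi :> nat by apply: contraNneq yt => /val_inj ->; rewrite Et.
  case: (ltnP lo y) => [_|yl] /=.
    rewrite ltn_neqAle yhi /= leqNgt; apply/negP => hy; move: oy.
    rewrite /below (_ : [set _ in E | _] = E).
      by apply/negP/(even_classes e1) => // x y' _.
    by apply/setP => x; rewrite inE; case: (boolP (x \in E)) => //= /himax; lia.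
  move: oy; rewrite /below (_ : [set _ in E | _] = set0) ?cards0 //.
  by apply/setP => x; rewrite !inE; apply/negP => /andP[/lomin]; lia.
have lohi : lo < hi.
  have [y [yE ylo _]] := even_two e1 loE.
  have ylo' : y != lo :> nat by apply: contraNneq ylo => /val_inj ->.
  by have := lomin y yE; have := himax y yE; lia.
have lr : lo.+1 < r by apply: leq_ltn_trans lohi (ltn_ord hi).
have tyO y : y \in O -> forall x, x \in E -> ty x != ty y.
  by rewrite inE => /andP[yt _] x /Et ->; rewrite eq_sym.
(* By alternation the successor of [lo] has the other type, and [lo] is the only letter of [E]
   before it. *)
have nextO : Ordinal lr \in O.
  rewrite inE (@alternate lo) ?Et // /below (_ : [set _ in E | _] = [set lo]).
    by rewrite cards1; case: (t).
  apply/setP => x; rewrite !inE /= ltnS; apply/andP/eqP => [[xE xlo]|->//].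
  by apply: val_inj => /=; have := lomin x xE; lia.
have cl1 y z : y \in O -> lab1 z = lab1 y -> z \in O.
  move=> yO zy; move: (yO); rewrite !inE (pure1 zy).
  rewrite (@parity_class lab1 E y z) //; first exact: noncross_lab1.
  by move=> x xE; apply/negP => /eqP /pure1 h; have := tyO y yO x xE; rewrite h eqxx.
have cl2 y z : y \in O -> lab2 z = lab2 y -> z \in O.
  move=> yO zy; move: (yO); rewrite !inE (pure2 zy).
  rewrite (@parity_class lab2 E y z) //; first exact: noncross_lab2.
  by move=> x xE; apply/negP => /eqP /pure2 h; have := tyO y yO x xE; rewrite h eqxx.
(* If [y] shared a block with an end letter, no class of [E] could straddle [y], and the letters of
   [E] before [y] would be even in number. *)
have end2 y : y \in O -> ~ (lab2 y = d1 \/ lab2 y = d2).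
  move=> yO yd; move: (yO); rewrite inE => /andP[_]; apply/negP.
  have ne x : x \in E -> lab2 x != lab2 y.
    move=> xE; apply/negP => /eqP /pure2 h; have := tyO y yO x xE; by rewrite h eqxx.
  apply: (even_classes e2); first by apply/subsetP => x; rewrite inE => /andP[].
  move=> x x'; rewrite !inE => /andP[xE xy] x'E xx'; rewrite x'E /=.
  have := ne x' x'E; apply: contraNT; rewrite -leqNgt => yx'.
  apply/eqP; apply: (@noncross_end x y x') => //.
  rewrite ltn_neqAle yx' andbT; apply: contraNneq (ne x' x'E) => /val_inj ->.
  by rewrite eqxx.
have f1 y : y \in O -> full1 O y.
  by move=> yO; apply/forallP => z; apply/implyP => /eqP /(cl1 _ _ yO).
have f2 y : y \in O -> full2 O y.
  move=> yO; have h := end2 y yO; apply/and3P; split.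
  - by apply/eqP => e; apply: h; left.
  - by apply/eqP => e; apply: h; right.
  - by apply/forallP => z; apply/implyP => /eqP /(cl2 _ _ yO).
have d1' : forall x, x \in O -> full1 O x \/ K (g x) by move=> x /f1; left.
have d2' : forall x, x \in O -> full2 O x \/ K (g x) by move=> x /f2; left.
have v1 : (size (vertices lab1 O)).*2 <= #|O|.
  apply: vertices_double => x xO.
  by have [y [yx e]] := deleted_double1 d1' d2' (f1 x xO); exists y; split=> //; apply: cl1 xO e.
have v2 : (size (vertices lab2 O)).*2 <= #|O|.
  apply: vertices_double => x xO.
  by have [y [yx e]] := deleted_double2 d1' d2' (f2 x xO); exists y; split=> //; apply: cl2 xO e.
have O0 : O != set0 by apply/set0Pn; exists (Ordinal lr).
(* All blocks met by [O] are deleted whole, so each contains at least two edges, and each side has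
   at most |O|/2 vertices. *)
have sz : (size (vertices lab1 O) + size (vertices lab2 O) <= #|O|)%N.
  by move: v1 v2; lia.
have [E' [/negP E'0 E'O e1' e2']] := even_exists O0 sz.
case: E'0; apply/eqP; apply: (IH lo.+1 hi _ (~~ t)).
- by have := Eab lo loE; have := Eab hi hiE; lia.
- split=> // x /(subsetP E'O); rewrite inE => /andP[]; by case: (ty x); case: (t).
- by move=> x /(subsetP E'O)/Obnd.
Qed.

(** Labels are pure, so the letters of one type in an even set form an even set themselves. *)
Lemma even_eq0 E : even_for lab1 E -> even_for lab2 E -> E = set0.
Proof.
move=> e1 e2.
have sub (f : 'I_r -> nat) t : (forall x y, f x = f y -> ty x = ty y) -> even_for f E ->
    even_for f [set x in E | ty x == t].
  move=> pf ef v; case: (set_0Vmem [set x in [set x in E | ty x == t] | f x == v]) => [->|[x]].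
    by rewrite cards0.
  rewrite !inE => /andP[/andP[xE /eqP xt] /eqP xv].
  rewrite (_ : [set _ in _ | _] = [set x in E | f x == v]) ?ef //.
  apply/setP => y; rewrite !inE; case: (f y =P v) => [yv|_]; rewrite ?andbF // !andbT.
  by rewrite -xt (pf y x) ?eqxx ?andbT // yv xv.
have z t : [set x in E | ty x == t] = set0.
  apply: (@even_pure_eq0 r.+1 0 r _ t); rewrite ?subn0 //; last by move=> x _; rewrite /= ltn_ord.
  by split; [apply: sub|apply: sub|move=> x; rewrite inE => /andP[_ /eqP]].
apply/setP => x; rewrite inE; apply/negP => xE.
by have /setP/(_ x) := z (ty x); rewrite !inE xE eqxx.
Qed.

Lemma vertices_sub (f : 'I_r -> nat) (A B : {set 'I_r}) : A \subset B ->
  size (vertices f A) <= size (vertices f B).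
Proof.
move=> AB; apply: uniq_leq_size; first exact: undup_uniq.
by move=> v; rewrite mem_undup => /imageP[x /(subsetP AB) xB ->]; apply: mem_vertices.
Qed.

(** Without [t] there are at most |B|/2 vertices on the [h1] side and at most (|B| - 1)/2 on the
    [h2] side, which by integrality is no more than the |B| - 1 remaining edges. *)
Lemma bridge_count (h1 h2 : 'I_r -> nat) (B : {set 'I_r}) t : t \in B ->
  (forall x, x \in B -> exists y, [/\ y \in B, y != x & h1 y = h1 x]) ->
  (forall x, x \in B :\ t -> exists y, [/\ y \in B :\ t, y != x & h2 y = h2 x]) ->
  exists2 E, E != set0 & even_for h1 E /\ even_for h2 E.
Proof.
move=> tB hB hBt; have v1 := vertices_double hB; have v2 := vertices_double hBt.
have v3 := vertices_sub h1 (subsetDl B [set t]).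
have B0 : B :\ t != set0.
  by have [y [yB yt _]] := hB t tB; apply/set0Pn; exists y; rewrite !inE yt yB.
have cB := cardsD1 t B; rewrite tB add1n in cB.
have sz : (size (vertices h1 (B :\ t)) + size (vertices h2 (B :\ t)) <= #|B :\ t|)%N.
  have arith a b c n m : a.*2 <= n -> b.*2 <= m -> c <= a -> n = m.+1 -> (c + b <= m)%N.
    by lia.
  exact: arith v1 v2 v3 cB.
have [E [E0 _ e1 e2]] := even_exists B0 sz.
by exists E.
Qed.

Theorem meander_faithful t : ~ K (g t).
Proof.
move=> Kt.
have noE (E : {set 'I_r}) : E \subset [set: 'I_r] -> even_for lab1 E -> even_for lab2 E -> E = set0.
  by move=> _; apply: even_eq0.
have [y1 [y2 hy]] := bridge noE (in_setT t).
(* Adding the constant [e] to both potentials preserves their sum and makes [z2] vanish at the end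
   block whose type is that of [t]; no block selected below then contains an end letter. *)
pose e := y2 (if ty t == ty1 then d1 else d2).
pose z1 v := y1 v (+) e; pose z2 v := y2 v (+) e.
have hz u : z1 (lab1 u) (+) z2 (lab2 u) = (u == t).
  by rewrite /z1 /z2 addbACA addbb addbF hy ?inE.
(* On an edge other than [t] the two potentials agree, so every other member of [B] lies in two
   blocks that are deleted whole, while [t] may be deleted because it is in [K]. *)
pose B := [set u | (ty u == ty t) && (z1 (lab1 u) || z2 (lab2 u))].
have inB1 u : ty u = ty t -> z1 (lab1 u) -> u \in B by rewrite inE => -> ->; rewrite eqxx.
have inB2 u : ty u = ty t -> z2 (lab2 u) -> u \in B by rewrite inE => -> ->; rewrite eqxx orbT.
have tyB u : u \in B -> ty u = ty t by rewrite inE => /andP[/eqP].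
have full1B u : u \in B -> z1 (lab1 u) -> full1 B u.
  move=> uB zu; apply/forallP => w; apply/implyP => /eqP wu.
  by apply: inB1; rewrite ?wu // (pure1 wu) tyB.
have full2B u : u \in B -> z2 (lab2 u) -> full2 B u.
  move=> uB zu; have ut := tyB u uB; apply/and3P; split.
  - apply/eqP => ud; move: zu; rewrite /z2 /e -ut (pured1 ud) eqxx ud addbb //.
  - apply/eqP => ud; move: zu; rewrite /z2 /e -ut (pured2 ud) ud.
    by case: (ty1); rewrite /= addbb.
  - apply/forallP => w; apply/implyP => /eqP wu.
    by apply: inB2; rewrite ?wu // (pure2 wu).
have zB u : u \in B -> u != t -> z1 (lab1 u) /\ z2 (lab2 u).
  rewrite inE => /andP[_]; have := hz u.
  by case: (z1 _); case: (z2 _); case: (u == t).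
have del1B u : u \in B -> full1 B u \/ K (g u).
  move=> uB; case: (eqVneq u t) => [->|/(zB _ uB)[/(full1B _ uB)]]; by [right|left].
have del2B u : u \in B -> full2 B u \/ K (g u).
  move=> uB; case: (eqVneq u t) => [->|/(zB _ uB)[_ /(full2B _ uB)]]; by [right|left].
have db1 u : u \in B -> z1 (lab1 u) -> exists w, [/\ w \in B, w != u & lab1 w = lab1 u].
  move=> uB zu; have [w [wu e1]] := deleted_double1 del1B del2B (full1B u uB zu).
  by exists w; split=> //; apply: inB1; rewrite ?e1 // (pure1 e1) tyB.
have db2 u : u \in B -> z2 (lab2 u) -> exists w, [/\ w \in B, w != u & lab2 w = lab2 u].
  move=> uB zu; have [w [wu e1]] := deleted_double2 del1B del2B (full2B u uB zu).
  by exists w; split=> //; apply: inB2; rewrite ?e1 // (pure2 e1) tyB.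
(* Exactly one endpoint of [t] has potential 1, and the count is made from that side. *)
have := hz t; rewrite eqxx.
case Z1: (z1 (lab1 t)); case Z2: (z2 (lab2 t)) => // _.
- have [||E E0 [e1 e2]] := @bridge_count lab1 lab2 B t (inB1 t erefl Z1).
  + by move=> u uB; apply: db1 => //; case: (eqVneq u t) => [->|/(zB _ uB)[]].
  + move=> u; rewrite in_setD1 => /andP[ut uB].
    have [w [wB wu e1]] := db2 u uB (zB u uB ut).2.
    exists w; split=> //; rewrite in_setD1 wB andbT.
    by apply/eqP => wt; move: (zB u uB ut).2; rewrite -e1 wt Z2.
  by rewrite (even_eq0 e1 e2) eqxx in E0.
- have [||E E0 [e2 e1]] := @bridge_count lab2 lab1 B t (inB2 t erefl Z2).
  + by move=> u uB; apply: db2 => //; case: (eqVneq u t) => [->|/(zB _ uB)[]].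
  + move=> u; rewrite in_setD1 => /andP[ut uB].
    have [w [wB wu e1]] := db1 u uB (zB u uB ut).1.
    exists w; split=> //; rewrite in_setD1 wB andbT.
    by apply/eqP => wt; move: (zB u uB ut).1; rewrite -e1 wt Z1.
  by rewrite (even_eq0 e1 e2) eqxx in E0.
Qed.

End Meander.

(** * Planar certificates for words in a free product *)

Lemma noncross_dup l1 L l2 : noncross (l1 ++ L :: l2) -> noncross (l1 ++ L :: L :: l2).
Proof.
move=> /noncrossP nc; apply/noncrossP => i j k m ij jk km.
pose f q := if q <= size l1 then q else q.-1.
have fE q : nth 0 (l1 ++ L :: L :: l2) q = nth 0 (l1 ++ L :: l2) (f q).
  rewrite /f !nth_cat; case: (ltngtP q (size l1)) => [lt|lt|->].
  - by rewrite lt.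
  - rewrite ifF; last by lia.
    case: q lt => // q lt; rewrite subSn //=; case: (q - size l1) => //.
  - by rewrite ltnn subnn.
have fS q q' : q < q' -> nth 0 (l1 ++ L :: l2) (f q) <> nth 0 (l1 ++ L :: l2) (f q') ->
    f q < f q'.
  move=> qq' ne; have : f q <= f q' by rewrite /f; do 2!case: ifP; lia.
  by rewrite leq_eqVlt => /orP[/eqP e|//]; rewrite e in ne.
rewrite !fE !size_cat /= => ml ik jm.
have [//|/eqP ne] := eqVneq (nth 0 (l1 ++ L :: l2) (f i)) (nth 0 (l1 ++ L :: l2) (f j)).
apply: (nc (f i) (f j) (f k) (f m)) => //.
- exact: fS.
- by apply: fS => // e; apply: ne; rewrite ik e.
- by apply: fS => // e; apply: ne; rewrite ik jm e.
- by rewrite size_cat /= /f; case: ifP; lia.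
Qed.

Definition rename (L L' : nat) : nat -> nat := fun M => if M == L' then L else M.

(** Two blocks meeting at adjacent positions may be fused: a label that crosses the union without
    crossing either block would have to separate these neighbours. *)
Lemma noncross_rename l1 L L' l2 : noncross (l1 ++ L :: L' :: l2) ->
  noncross (map (rename L L') (l1 ++ L :: L' :: l2)).
Proof.
set l := l1 ++ _ => /noncrossP nc; apply/noncrossP => i j k m ij jk km.
rewrite size_map => ml; rewrite !(nth_map 0); try lia.
have lq : nth 0 l (size l1) = L by rewrite nth_cat ltnn subnn.
have lq1 : nth 0 l (size l1).+1 = L' by rewrite nth_cat ltnNge leqnSn subSn // subnn.
have q1l : (size l1).+1 < size l by rewrite size_cat /=; lia.
move: lq lq1 q1l; set q := size l1 => lq lq1 q1l.
pose C M := (M == L) || (M == L').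
have rC M M' : rename L L' M = rename L L' M' -> M = M' \/ C M && C M'.
  rewrite /rename /C; case: (M =P L') => [->|ML']; case: (M' =P L') => [->|M'L'] e.
  - by left.
  - by right; rewrite -e !eqxx ?orbT.
  - by right; rewrite e !eqxx ?orbT.
  - by left.
have Cr M M' : C M -> C M' -> rename L L' M = rename L L' M'.
  rewrite /rename /C; case: (M =P L') => [->|ML'] /=; case: (M' =P L') => [->|M'L'] //=;
    rewrite ?orbF; [move=> _ /eqP ->|move=> /eqP ->|move=> /eqP -> /eqP ->]; done.
(* among the adjacent positions q, q+1 both labels of the class occur *)
have pick x : C (nth 0 l x) -> exists2 y, (y = q) \/ (y = q.+1) & nth 0 l y = nth 0 l x.
  by move=> /orP[] /eqP ->; [exists q; [left|]|exists q.+1; [right|]].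
move=> /rC ik /rC jm; case: ik => [ik|/andP[Ci Ck]]; case: jm => [jm|/andP[Cj Cm]].
- by rewrite (nc i j k m).
- have [Ci|Ci] := boolP (C (nth 0 l i)); first exact: Cr.
  have neC x : C (nth 0 l x) -> x <> i /\ x <> k.
    by move=> Cx; split=> e; subst x; [|rewrite -ik in Cx]; rewrite Cx in Ci.
  have [x xq xm] := pick m Cm; have [y yq yj] := pick j Cj.
  have [q1 q2] : q <> i /\ q <> k by apply: neC; rewrite lq /C eqxx.
  have [q3 q4] : q.+1 <> i /\ q.+1 <> k by apply: neC; rewrite lq1 /C eqxx orbT.
  exfalso; move/negP: Ci; apply.
  have [[ix xk]|[yi|yk]] : (i < x /\ x < k) \/ (y < i \/ k < y) by lia.
  + by rewrite (nc i x k m) ?xm //.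
  + by rewrite -(nc y i j k) ?yj //; lia.
  + by rewrite (nc i j k y) ?yj //; lia.
- have [Cj|Cj] := boolP (C (nth 0 l j)); first exact: Cr.
  have neC x : C (nth 0 l x) -> x <> j /\ x <> m.
    by move=> Cx; split=> e; subst x; [|rewrite -jm in Cx]; rewrite Cx in Cj.
  have [x xq xi] := pick i Ci; have [y yq yk] := pick k Ck.
  have [q1 q2] : q <> j /\ q <> m by apply: neC; rewrite lq /C eqxx.
  have [q3 q4] : q.+1 <> j /\ q.+1 <> m by apply: neC; rewrite lq1 /C eqxx orbT.
  exfalso; move/negP: Cj; apply.
  have [[jx xm]|[yj|ym]] : (j < x /\ x < m) \/ (y < j \/ m < y) by lia.
  + by rewrite -(nc i j x m) ?xi //; lia.
  + by rewrite -(nc y j k m) ?yk //; lia.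
  + by rewrite (nc j k m y) ?yk //; lia.
- exact: Cr.
Qed.

Lemma noncross_fresh l1 B l2 : B \notin l1 ++ l2 -> noncross (l1 ++ l2) ->
  noncross (l1 ++ B :: l2).
Proof.
move=> Bl nc a b ab; apply/negP => h.
have cB : count_mem B (l1 ++ B :: l2) = 1.
  rewrite count_cat /= eqxx; move: Bl; rewrite mem_cat negb_or => /andP[].
  by move=> /count_memPn -> /count_memPn ->.
have aB : a != B.
  apply: contraTneq h => ->; apply/negP => h.
  by have := leq_count_subseq (pred1 B) h; rewrite cB /= !eqxx; case: (_ == _).
have bB : b != B.
  apply: contraTneq h => ->; apply/negP => h.
  by have := leq_count_subseq (pred1 B) h; rewrite cB /= !eqxx; case: (_ == _).
have /negP := nc _ _ ab; apply.
have <- : [seq x <- l1 ++ B :: l2 | x != B] = l1 ++ l2.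
  rewrite filter_cat /= eqxx /= -filter_cat; apply/all_filterP/allP => x xl.
  by apply: contraNneq Bl => <-.
by rewrite subseq_filter h /= aB bB.
Qed.

Lemma noncross_wrap B l : B \notin l -> noncross l -> noncross (B :: rcons l B).
Proof.
move=> Bl nc a b ab; apply/negP => h.
have cB : count_mem B (B :: rcons l B) = 2.
  rewrite /= eqxx -cats1 count_cat /= eqxx; move: Bl.
  by move=> /count_memPn ->.
have [aB|aB] := eqVneq a B.
  have bB : b != B by rewrite -aB eq_sym.
  rewrite {}aB in ab h; have h' : subseq [:: b; B; b] (rcons l B) by move: h; rewrite /= eqxx.
  move: h'; rewrite -(subseq_rev [:: b; B; b]) rev_rcons /= (negPf bB).
  by move/mem_subseq/(_ B); rewrite !inE eqxx orbT mem_rev (negPf Bl) => /(_ isT).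
have [bB|bB] := eqVneq b B.
  rewrite {}bB in ab h aB; have h' : subseq [:: a; B; a; B] (rcons l B).
    by move: h; rewrite /= (negPf aB).
  move: h'; rewrite -(subseq_rev [:: a; B; a; B]) rev_rcons /= eqxx.
  by move/mem_subseq/(_ B); rewrite !inE eqxx orbT mem_rev (negPf Bl) => /(_ isT).
have /negP := nc _ _ ab; apply.
have <- : [seq x <- B :: rcons l B | x != B] = l.
  rewrite /= eqxx /= filter_rcons eqxx /=; apply/all_filterP/allP => x xl.
  by apply: contraNneq Bl => <-.
by rewrite subseq_filter h /= aB bB.
Qed.

Lemma map_eq_cat (S T : Type) (f : S -> T) v X Y : map f v = X ++ Y ->
  exists V W, [/\ v = V ++ W, X = map f V & Y = map f W].
Proof.
move=> e; exists (take (size X) v), (drop (size X) v).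
by rewrite cat_take_drop map_take map_drop e take_size_cat ?drop_size_cat.
Qed.

Lemma noncross_cat l1 l2 : noncross l1 -> noncross l2 ->
  (forall L, L \in l1 -> L \notin l2) -> noncross (l1 ++ l2).
Proof.
move=> /noncrossP n1 /noncrossP n2 dj; apply/noncrossP => i j k m ij jk km.
have side x y : x < size (l1 ++ l2) -> y < size (l1 ++ l2) ->
    nth 0 (l1 ++ l2) x = nth 0 (l1 ++ l2) y -> (x < size l1) = (y < size l1).
  rewrite size_cat !nth_cat => xs ys.
  case: ltnP => xl; case: ltnP => yl // e; exfalso.
    by have := dj _ (mem_nth 0 xl); rewrite e mem_nth // ltn_subLR.
  by have := dj _ (mem_nth 0 yl); rewrite -e mem_nth // ltn_subLR.
move=> ml ik jm; have s1 := side i k ltac:(lia) ltac:(lia) ik.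
have s2 := side j m ltac:(lia) ml jm.
move: ml ik jm; rewrite size_cat !nth_cat -s1 -s2.
case: (ltnP i (size l1)) s1 s2 => il s1 s2.
  have jl : j < size l1 by lia.
  rewrite jl; move=> _; apply: n1; lia.
have jl : (j < size l1) = false by lia.
rewrite jl => ml; apply: n2; lia.
Qed.

Lemma noncross_shift B l : noncross l -> noncross (map (addn B) l).
Proof.
move=> /noncrossP nc; apply/noncrossP => i j k m ij jk km; rewrite size_map => ml.
rewrite !(nth_map 0); try lia.
by move=> /addnI ik /addnI jm; rewrite (nc i j k m).
Qed.

Section Cert.
Local Open Scope group_scope.
Variables (G : groupType) (N : G -> nat).
Hypothesis N1 : N 1 = 0%N.
Hypothesis NM : forall x y, N (x * y) <= N x + N y.
Hypothesis NJ : forall x y, N (x * y * x^-1) = N y.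
Implicit Types (u X Y : seq (bool * G)) (v V W : seq (nat * G)).

(** A nontrivial element of the kernel also has norm 0, so triviality of free blocks is recorded
    separately; it later forces them to have two letters. *)
Definition good (m : nat -> nat) v := forall L, L \in unzip1 v ->
  N (block v L) <= m L /\ (m L = 0%N -> block v L = 1).

Definition typed (ty : nat -> bool) v : seq (bool * G) := [seq (ty p.1, p.2) | p <- v].

Definition cost (m : nat -> nat) v := \sum_(L <- undup (unzip1 v)) m L.

(** A planar proof that [u] is cheap. The price [m] of a block may exceed its norm, so prices can
    simply be added when blocks are fused. *)
Definition cert u (a : nat) : Prop := exists v ty m,
  [/\ u = typed ty v, noncross (unzip1 v), good m v & cost m v <= a].

Lemma typed_cat ty V W : typed ty (V ++ W) = typed ty V ++ typed ty W.
Proof. exact: map_cat. Qed.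

Lemma unzip1_cat V W : unzip1 (V ++ W) = unzip1 V ++ unzip1 W.
Proof. exact: map_cat. Qed.

Lemma block_cons L p v : block (p :: v) L = (if p.1 == L then p.2 else 1) * block v L.
Proof. by rewrite /block big_cons; case: ifP; rewrite ?mul1g. Qed.

Lemma fresh_label (s : seq nat) : exists B, forall L, L \in s -> L < B.
Proof.
exists (\max_(L <- s) L).+1 => L Ls; rewrite ltnS.
by rewrite (big_rem _ Ls) /= leq_maxl.
Qed.

Lemma fresh_notin (s : seq nat) : exists B, B \notin s.
Proof. by have [B h] := fresh_label s; exists B; apply/negP => /h; rewrite ltnn. Qed.

Lemma eq_cost m m' v : (forall L, L \in unzip1 v -> m L = m' L) -> cost m v = cost m' v.
Proof. by move=> mm'; apply: eq_big_seq => L; rewrite mem_undup => /mm'. Qed.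

Lemma eq_typed ty ty' v : (forall L, L \in unzip1 v -> ty L = ty' L) -> typed ty v = typed ty' v.
Proof. by move=> h; apply/eq_in_map => p pv; rewrite h // (map_f fst pv). Qed.

Lemma good_sub m v v' : {subset unzip1 v' <= unzip1 v} ->
  (forall L, L \in unzip1 v' -> block v' L = block v L) -> good m v -> good m v'.
Proof. by move=> s e gd L Lv; rewrite e //; apply: gd (s _ Lv). Qed.

Lemma cost_sub m v v' : {subset unzip1 v' <= unzip1 v} -> cost m v' <= cost m v.
Proof. by move=> s; rewrite /cost -(sum_undup_sub m s) leq_addr. Qed.

Lemma cert_del1 X t Y a : cert (X ++ (t, 1) :: Y) a -> cert (X ++ Y) a.
Proof.
move=> [v [ty [m [/esym/map_eq_cat[V [W' [-> -> e]]] nc gd le]]]].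
case: W' e nc gd le => // -[L s] W [_ <- ->] nc gd le.
have sub : subseq (unzip1 (V ++ W)) (unzip1 (V ++ (L, 1) :: W)).
  by rewrite !unzip1_cat /= cat_subseq // subseq_cons.
exists (V ++ W), ty, m; split.
- by rewrite typed_cat.
- exact: noncross_sub nc.
- apply: good_sub gd; first exact: mem_subseq.
  by move=> M _; rewrite !block_cat block_cons /= if_same mul1g.
- by apply: leq_trans le; apply/cost_sub/mem_subseq.
Qed.

(** The trivial letter gets a fresh block of its own, at price 0. *)
Lemma cert_ins1 X t Y a : cert (X ++ Y) a -> cert (X ++ (t, 1) :: Y) a.
Proof.
move=> [v [ty [m [/esym/map_eq_cat[V [W [-> -> ->]]] nc gd le]]]].
have [B Bv] := fresh_notin (unzip1 (V ++ W)).
have neB L : L \in unzip1 (V ++ W) -> (L == B) = false.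
  by move=> Lv; apply: contraNF Bv => /eqP <-.
pose m' L := if L == B then 0%N else m L.
exists (V ++ (B, 1) :: W), (fun L => if L == B then t else ty L), m'; split.
- rewrite typed_cat /= eqxx; congr (_ ++ _ :: _); apply: eq_typed => L Lv;
  by rewrite neB // unzip1_cat mem_cat Lv ?orbT.
- by rewrite unzip1_cat /=; apply: noncross_fresh; rewrite -?unzip1_cat.
- move=> L; rewrite /m' block_cat block_cons /= if_same mul1g -block_cat.
  rewrite unzip1_cat mem_cat /= in_cons orbCA -mem_cat -unzip1_cat.
  case: (L =P B) => [->|_ /= Lv]; first by rewrite block_out ?N1.
  exact: gd.
- rewrite /cost (perm_big (B :: undup (unzip1 (V ++ W)))).
    rewrite big_cons (_ : m' B = 0%N); last by rewrite /m' eqxx.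
    rewrite [leqLHS]/= add0n -/(cost m' _) (@eq_cost m' m) //.
    by move=> L Lv; rewrite /m' neB.
  apply: uniq_perm; rewrite ?undup_uniq //= ?mem_undup ?Bv ?undup_uniq //.
  by move=> L; rewrite in_cons !mem_undup !unzip1_cat !mem_cat /= in_cons orbCA.
Qed.

Lemma cert_split X t s s' Y a : cert (X ++ (t, s * s') :: Y) a ->
  cert (X ++ [:: (t, s), (t, s') & Y]) a.
Proof.
move=> [v [ty [m [/esym/map_eq_cat[V [W' [-> -> e]]] nc gd le]]]].
case: W' e nc gd le => // -[L s0] W [-> <- ->] nc gd le.
have sub : {subset unzip1 (V ++ [:: (L, s), (L, s') & W]) <= unzip1 (V ++ (L, s * s') :: W)}.
  by move=> M; rewrite !unzip1_cat !mem_cat /= !in_cons; case: (M == L).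
exists (V ++ [:: (L, s), (L, s') & W]), ty, m; split.
- by rewrite typed_cat.
- by rewrite unzip1_cat /=; apply: noncross_dup; rewrite unzip1_cat in nc.
- apply: good_sub gd => // M _; rewrite !block_cat !block_cons /=.
  by case: ifP; rewrite ?mul1g ?mulgA.
- by apply: leq_trans le; apply: cost_sub.
Qed.

Lemma merge_same ty m V L s s' W a :
  noncross (unzip1 (V ++ [:: (L, s), (L, s') & W])) -> good m (V ++ [:: (L, s), (L, s') & W]) ->
  cost m (V ++ [:: (L, s), (L, s') & W]) <= a ->
  cert (typed ty V ++ (ty L, s * s') :: typed ty W) a.
Proof.
move=> nc gd le.
have sub : subseq (unzip1 (V ++ (L, s * s') :: W)) (unzip1 (V ++ [:: (L, s), (L, s') & W])).
  by rewrite !unzip1_cat cat_subseq //; apply: (subseq_cons (L :: unzip1 W)).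
exists (V ++ (L, s * s') :: W), ty, m; split.
- by rewrite typed_cat.
- exact: noncross_sub nc.
- apply: good_sub gd; first exact: mem_subseq.
  move=> M _; rewrite !block_cat !block_cons /=.
  by case: ifP; rewrite ?mul1g ?mulgA.
- by apply: leq_trans le; apply/cost_sub/mem_subseq.
Qed.

Definition block2 v L L' : G := \big[*%g/1]_(p <- v | (p.1 == L) || (p.1 == L')) p.2.

Lemma block2_cons v L L' p :
  block2 (p :: v) L L' = (if (p.1 == L) || (p.1 == L') then p.2 else 1) * block2 v L L'.
Proof. by rewrite /block2 big_cons; case: ifP; rewrite ?mul1g. Qed.

Lemma block2_cat V W L L' : block2 (V ++ W) L L' = block2 V L L' * block2 W L L'.
Proof. by rewrite /block2 big_cat. Qed.

Lemma block2_sorted v L L' : L != L' -> ~~ subseq [:: L; L'] (unzip1 v) ->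
  block2 v L L' = block v L' * block v L.
Proof.
move=> LL'; elim: v => [|[M s] v IH]; first by rewrite /block2 /block !big_nil mulg1.
rewrite block2_cons !block_cons /=; case: (L =P M) => [<-|LM].
  rewrite eqxx (negPf LL') /= sub1seq => L'v.
  rewrite (block_out L'v) !mul1g; congr (_ * _).
  rewrite /block2 /block big_seq_cond [RHS]big_seq_cond; apply: eq_bigl => p.
  case: (boolP (p \in v)) => //= pv; rewrite orbC; case: eqP => // pL'.
  by rewrite -pL' (map_f fst pv) in L'v.
move=> /IH ->; rewrite (_ : (M == L) = false); last by apply/eqP => e; apply: LM.
by rewrite /= mul1g mulgA.
Qed.

Lemma block_rename v L L' : L != L' ->
  block [seq (rename L L' p.1, p.2) | p <- v] L = block2 v L L'.
Proof.
move=> LL'; rewrite /block /block2 big_map; apply: eq_bigl => p /=.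
by rewrite /rename; case: (p.1 =P L') => [->|_]; rewrite ?eqxx ?orbT ?orbF.
Qed.

Lemma block_rename_out v L L' M : L != M -> L' != M ->
  block [seq (rename L L' p.1, p.2) | p <- v] M = block v M.
Proof.
move=> LM L'M; rewrite /block big_map; apply: eq_bigl => p /=.
by rewrite /rename; case: (p.1 =P L') => [->|_ //]; rewrite (negPf LM) (negPf L'M).
Qed.

(* Adjacent letters of distinct noncrossing blocks: one block is inserted
   at a single place of the other one. *)
Lemma block2_nested V L s L' s' W :
  L != L' -> noncross (unzip1 (V ++ [:: (L, s), (L', s') & W])) ->
  let v := V ++ [:: (L, s), (L', s') & W] in
  exists P Q b, block2 v L L' = P * b * Q /\
    ((block v L = P * Q /\ block v L' = b) \/ (block v L' = P * Q /\ block v L = b)).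
Proof.
move=> LL' nc v; have L'L : L' != L by rewrite eq_sym.
have vE : unzip1 v = unzip1 V ++ [:: L, L' & unzip1 W] by rewrite unzip1_cat.
have b2 : block2 v L L' = block2 V L L' * s * s' * block2 W L L'.
  by rewrite block2_cat !block2_cons /= !eqxx orbT /= !mulgA.
have bL : block v L = block V L * s * block W L.
  by rewrite block_cat !block_cons /= eqxx (negPf L'L) mul1g mulgA.
have bL' : block v L' = block V L' * s' * block W L'.
  by rewrite block_cat !block_cons /= eqxx (negPf LL') mul1g mulgA.
(* A subsequence [L], [L'] on either side of the adjacent pair [L], [L'] would complete a crossing,
   so in [W], and likewise in [V], the letters of [L'] precede those of [L]. *)
have W2 : block2 W L L' = block W L' * block W L.
  apply: block2_sorted => //; apply/negP => h; move/negP: (nc _ _ LL'); apply.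
  rewrite -/v vE; apply: subseq_trans (suffix_subseq _ _).
  by rewrite /= !eqxx.
have V2 : block2 V L L' = block V L' * block V L.
  apply: block2_sorted => //; apply/negP => h; move/negP: (nc _ _ LL'); apply.
  by rewrite -/v vE; apply: (@cat_subseq _ [:: L; L'] [:: L; L']); rewrite //= !eqxx sub0seq.
have [L'V|L'V] := boolP (L' \in unzip1 V); last first.
  exists (block V L * s), (block W L), (s' * block W L'); split.
    by rewrite b2 V2 W2 (block_out L'V) mul1g !mulgA.
  by left; rewrite bL bL' (block_out L'V) mul1g.
have LW : L \notin unzip1 W.
  apply/negP => LW; move/negP: (nc _ _ L'L); apply.
  rewrite -/v vE; apply: (@cat_subseq _ [:: L'] [:: L; L'; L]); rewrite ?sub1seq //.
  by rewrite /= !eqxx sub1seq.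
exists (block V L'), (s' * block W L'), (block V L * s); split.
  by rewrite b2 V2 W2 (block_out LW) mulg1 !mulgA.
by right; rewrite bL bL' (block_out LW) mulg1 mulgA.
Qed.

Lemma norm_nested P Q b : N (P * b * Q) <= N (P * Q) + N b.
Proof.
have -> : P * b * Q = (P * b * P^-1) * (P * Q) by rewrite !mulgA mulgVK.
by rewrite addnC; apply: leq_trans (NM _ _) _; rewrite NJ.
Qed.

(** If the labels differ, their blocks are fused: one is nested at a single place of the other, so
    the norm of the union is at most the sum of the norms. *)
Lemma cert_merge X t s s' Y a : cert (X ++ [:: (t, s), (t, s') & Y]) a ->
  cert (X ++ (t, s * s') :: Y) a.
Proof.
move=> [v [ty [m [/esym/map_eq_cat[V [W' [-> -> e]]] nc gd le]]]].
case: W' e nc gd le => // -[L s0] [//|[L' s0'] W] [-> <- tL' <- ->] nc gd le.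
have [LL'|LL'] := eqVneq L L'; first by subst L'; apply: merge_same nc gd le.
have [P [Q [b [b2 bb]]]] := block2_nested LL' nc.
clear v; set v := V ++ _ in nc gd le b2 bb.
have Lv : L \in unzip1 v by rewrite unzip1_cat mem_cat /= in_cons eqxx orbT.
have L'v : L' \in unzip1 v by rewrite unzip1_cat mem_cat /= !in_cons eqxx !orbT.
pose m' M := if M == L then (m L + m L')%N else m M.
pose ren w := [seq (rename L L' p.1, p.2) | p <- w] : seq (nat * G).
have renL : rename L L' L = L by rewrite /rename if_same.
have renL' : rename L L' L' = L by rewrite /rename eqxx.
have unzr w : unzip1 (ren w) = map (rename L L') (unzip1 w).
  by rewrite /unzip1 /ren -!map_comp.
have tyr w : typed ty (ren w) = typed ty w.
  rewrite /typed /ren -map_comp; apply: eq_map => -[M x] /=.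
  by rewrite /rename; case: (M =P L') => // ->; rewrite -tL'.
rewrite -/(typed ty V) -/(typed ty W) -(tyr V) -(tyr W).
have rv : ren v = ren V ++ [:: (L, s), (L, s') & ren W].
  by rewrite /ren map_cat /= renL renL'.
have memr M : M \in unzip1 (ren v) -> (M != L') /\ M \in unzip1 v.
  rewrite unzr => /mapP[M' M'v ->]; rewrite /rename.
  by case: (M' =P L') => [_|/eqP]; rewrite ?LL' ?Lv.
apply: (@merge_same ty m'); rewrite -rv.
- by rewrite unzr /v unzip1_cat /=; apply: noncross_rename; rewrite /v unzip1_cat in nc.
- move=> M /memr[ML' Mv]; rewrite /m'; case: (M =P L) => [->|/eqP ML]; last first.
    by rewrite block_rename_out 1?eq_sym //; apply: gd.
  rewrite block_rename // b2.
  have [g1 z1] := gd L Lv; have [g2 z2] := gd L' L'v.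
  case: bb => -[e1 e2]; rewrite e1 e2 in g1 z1 g2 z2.
    split; first by apply: leq_trans (norm_nested _ _ _) _; apply: leq_add.
    by move/eqP; rewrite addn_eq0 => /andP[/eqP/z1 h1 /eqP/z2 ->]; rewrite mulg1.
  split; first by apply: leq_trans (norm_nested _ _ _) _; rewrite addnC leq_add.
  by move/eqP; rewrite addn_eq0 => /andP[/eqP/z1 -> /eqP/z2 h]; rewrite mulg1.
- apply: leq_trans le; rewrite /cost.
  rewrite (perm_big (rem L' (undup (unzip1 v)))); last first.
    apply: uniq_perm; rewrite ?rem_uniq ?undup_uniq // => M.
    rewrite (mem_rem_uniq _ (undup_uniq _)) !inE !mem_undup.
    apply/idP/andP => [/memr[]//|[ML' Mv]]; rewrite unzr; apply/mapP; exists M => //.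
    by rewrite /rename (negPf ML').
  rewrite [leqRHS](big_rem L') ?mem_undup //=.
  have LR : L \in rem L' (undup (unzip1 v)).
    by rewrite (mem_rem_uniq _ (undup_uniq _)) !inE mem_undup LL'.
  rewrite (big_rem L LR) [X in _ <= _ + X](big_rem L LR) /= {1}/m' eqxx.
  rewrite addnA [(m L' + _)%N]addnC leq_add2l big_seq [leqRHS]big_seq.
  apply: leq_sum => M; rewrite (mem_rem_uniq _ (rem_uniq _ (undup_uniq _))) !inE => /andP[ML _].
  by rewrite /m' (negPf ML).
Qed.

Lemma cert_nil : cert [::] 0.
Proof.
exists [::], (fun=> true), (fun=> 0%N); split=> //.
- by rewrite /cost /= big_nil.
Qed.

Lemma cert_gen t x : N x <= 1 -> cert [:: (t, x)] 1.
Proof.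
move=> Nx; exists [:: (0%N, x)], (fun=> t), (fun=> 1%N); split=> //=.
- by move=> a b ab; apply/negP => /size_subseq.
- by move=> L; rewrite inE => /eqP ->; rewrite block_cons /= block_out ?mulg1.
- by rewrite /cost /= big_seq1.
Qed.

(** Conjugation is free: [x] and its inverse form one enclosing block with product 1 and price 0. *)
Lemma cert_wrap t x u a : cert u a -> cert ((t, x) :: u ++ [:: (t, x^-1)]) a.
Proof.
move=> [v [ty [m [-> nc gd le]]]].
have [B Bv] := fresh_notin (unzip1 v).
have neB L : L \in unzip1 v -> (L == B) = false.
  by move=> Lv; apply: contraNF Bv => /eqP <-.
pose m' L := if L == B then 0%N else m L.
exists ((B, x) :: v ++ [:: (B, x^-1)]), (fun L => if L == B then t else ty L), m'; split.
- rewrite /= typed_cat /= eqxx; congr (_ :: _ ++ _); apply: eq_typed => L Lv.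
  by rewrite neB.
- by rewrite /= unzip1_cat cats1; apply: noncross_wrap.
- move=> L; rewrite /m' block_cons block_cat block_cons (@block_out _ [::]) // mulg1 /=.
  rewrite in_cons unzip1_cat mem_cat /= mem_seq1 [_ == B]eq_sym.
  case: (B =P L) => [<- _|/eqP BL].
    by rewrite block_out // mul1g mulgV N1.
  rewrite orbF /= mul1g mulg1; exact: gd.
- rewrite /cost (perm_big (B :: undup (unzip1 v))).
    rewrite big_cons (_ : m' B = 0%N); last by rewrite /m' eqxx.
    rewrite [leqLHS]/= add0n -/(cost m' _) (@eq_cost m' m) //.
    by move=> L Lv; rewrite /m' neB.
  apply: uniq_perm; rewrite ?undup_uniq // ?cons_uniq ?mem_undup ?Bv ?undup_uniq //.
  move=> L; rewrite in_cons !mem_undup /= in_cons unzip1_cat mem_cat /= mem_seq1.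
  by case: (L == B); rewrite ?orbF.
Qed.

Lemma cert_cat u u' a b : cert u a -> cert u' b -> cert (u ++ u') (a + b).
Proof.
move=> [v [ty [m [-> nc gd le]]]] [v' [ty' [m' [-> nc' gd' le']]]].
have [B hB] := fresh_label (unzip1 v).
(* Shifting by a strict bound on the labels of [v] makes the two sets of labels disjoint. *)
pose w := [seq (B + p.1, p.2)%N | p <- v'] : seq (nat * G).
have wE : unzip1 w = map (addn B) (unzip1 v') by rewrite /unzip1 /w -!map_comp.
have memw L : (L \in unzip1 w) = (B <= L) && (L - B \in unzip1 v').
  rewrite wE; apply/mapP/andP => [[M Mv ->]|[BL Mv]]; first by rewrite leq_addr addKn.
  by exists (L - B)%N; rewrite // subnKC.
have disj L : L \in unzip1 v -> L \in unzip1 w -> False.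
  by move=> /hB lt; rewrite memw => /andP[le1 _]; lia.
pose tyy L := if L < B then ty L else ty' (L - B)%N.
pose mm L := if L < B then m L else m' (L - B)%N.
have bw L : B <= L -> block w L = block v' (L - B).
  move=> BL; rewrite /block /w big_map; apply: eq_bigl => p /=.
  by apply/eqP/eqP; lia.
exists (v ++ w), tyy, mm; split.
- rewrite typed_cat; congr (_ ++ _).
    by apply: eq_typed => L /hB; rewrite /tyy => ->.
  rewrite /typed /w -map_comp; apply: eq_map => p /=.
  by rewrite /tyy ifF ?addKn //; lia.
- rewrite unzip1_cat; apply: noncross_cat => // [|L /disj h]; last exact/negP.
  by rewrite wE; apply: noncross_shift.
- move=> L; rewrite unzip1_cat mem_cat block_cat /mm => /orP[Lv|Lw].
    rewrite (hB _ Lv) (@block_out _ w) ?mulg1; first exact: gd.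
    by apply/negP => /(disj _ Lv).
  rewrite (@block_out _ v) ?mul1g; last by apply/negP => /disj; apply.
  move: Lw; rewrite memw => /andP[BL Lv]; rewrite ltnNge BL /= bw //; exact: gd'.
- apply: leq_trans (leq_add le le').
  rewrite /cost (perm_big (undup (unzip1 v) ++ undup (unzip1 w))); last first.
    apply: uniq_perm; rewrite ?undup_uniq //.
      rewrite cat_uniq !undup_uniq andTb andbT; apply/hasPn => L; rewrite !mem_undup => Lw.
      by apply/negP => /disj; apply.
    by move=> L; rewrite mem_cat !mem_undup unzip1_cat mem_cat.
  rewrite big_cat; apply: leq_add.
    rewrite big_seq [leqRHS]big_seq; apply: leq_sum => L.
    by rewrite mem_undup => /hB; rewrite /mm => ->.
  have -> : undup (unzip1 w) = map (addn B) (undup (unzip1 v')).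
    by rewrite wE undup_map_inj //; apply: addnI.
  rewrite big_map; apply: leq_sum => L _.
  by rewrite /mm ifF ?addKn //; lia.
Qed.

End Cert.

(** * Syllables of elements of small reflection length *)

Definition free_rel (u v : word nat) : Prop := False.
Definition free_group := pgroup free_rel.
Definition fpin (u : word nat) : free_group := pin free_rel u.
Definition gen (i : nat) : free_group := fpin [:: (i, false)].

Lemma fpin_cons l w : fpin (l :: w) = (fpin [:: l] * fpin w)%g.
Proof. exact: pin_cons. Qed.

Lemma fpin_cat u v : fpin (u ++ v) = (fpin u * fpin v)%g.
Proof. exact: pin_cat. Qed.

Lemma fpin_winv u : fpin (winv u) = ((fpin u)^-1)%g.
Proof. exact: pin_winv. Qed.

Lemma fpin_inv l : fpin [:: (l.1, ~~ l.2)] = ((fpin [:: l])^-1)%g.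
Proof. by case: l => i s; rewrite -fpin_winv. Qed.

Section Syllables.
Local Open Scope group_scope.
Variables (N : free_group -> nat) (K : free_group -> Prop).
Hypothesis N1 : N 1 = 0%N.
Hypothesis NM : forall x y, N (x * y) <= N x + N y.
Hypothesis NJ : forall x y, N (x * y * x^-1) = N y.
Hypothesis NK : forall z a b, K z -> N (a * z * b) = N (a * b).
Hypothesis KV : forall z, K z -> K z^-1.
Hypothesis Ngen : forall i, N (gen i) <= 1.
Variable k : nat.

Definition side (l : nat * bool) := l.1 < k.

Definition lift_word (w : word nat) : seq (bool * free_group) :=
  [seq (side l, fpin [:: l]) | l <- w].

Lemma lift_cat u v : lift_word (u ++ v) = lift_word u ++ lift_word v.
Proof. exact: map_cat. Qed.

Lemma cert_word X t w Y a : all (fun l => side l == t) w ->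
  cert N (X ++ lift_word w ++ Y) a <-> cert N (X ++ (t, fpin w) :: Y) a.
Proof.
elim: w X => [|l w IH] X /=.
  by move=> _; split; [exact: cert_ins1|exact: cert_del1].
move=> /andP[/eqP lt /IH{}IH]; rewrite lt.
rewrite -cat_rcons IH cat_rcons /fpin (pin_cons _ l w).
by split; [apply: cert_merge|apply: cert_split].
Qed.

(** A cancelling pair lies on one side, so it fuses into a trivial letter, which may be inserted or
    deleted. *)
Lemma cert_peq u v a : peq free_rel u v -> cert N (lift_word u) a <-> cert N (lift_word v) a.
Proof.
elim=> {u v} [//|u v _ IH|u v w _ IH1 _ IH2|u v i b|//].
- by rewrite IH.
- by rewrite IH1.
- rewrite !lift_cat (_ : lift_word ((i, b) :: _) = lift_word [:: (i, b); (i, ~~ b)] ++ lift_word v) //.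
  rewrite (@cert_word _ (i < k)) /= ?eqxx // (_ : fpin _ = 1); last first.
    by apply/pinP; apply: (peq_cancel _ [::] [::]).
  by split; [apply: cert_del1|apply: cert_ins1].
Qed.

Definition certg (g : free_group) a := cert N (lift_word (repr g)) a.

Lemma certgE w a : certg (fpin w) a <-> cert N (lift_word w) a.
Proof. by apply: cert_peq; apply: repr_pin. Qed.

Lemma free_ind (P : free_group -> Prop) : (forall w, P (fpin w)) -> forall g, P g.
Proof. by move=> h g; have := h (repr g); rewrite /fpin pin_repr. Qed.

Lemma certgM g h a b : certg g a -> certg h b -> certg (g * h) (a + b).
Proof.
elim/free_ind: g => u; elim/free_ind: h => v.
by rewrite -fpin_cat !certgE lift_cat; apply: cert_cat.
Qed.

Lemma certg1 : certg 1 0.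
Proof. by rewrite -[1]/(fpin [::]) certgE; exact: cert_nil. Qed.

Lemma certg_gen i : certg (gen i) 1.
Proof. by rewrite certgE; apply: cert_gen; exact: Ngen. Qed.

Lemma certgJ g h a : certg h a -> certg (g * h * g^-1) a.
Proof.
elim/free_ind: g => u; elim/free_ind: h => v hv.
rewrite (_ : _ * _ = fpin ((u ++ v) ++ winv u)); last by rewrite !fpin_cat fpin_winv.
rewrite certgE; move/certgE: hv.
elim: u => [|[i b] u IH] hv; first by rewrite /= cats0.
rewrite winv_cons catA /= lift_cat /=.
rewrite (_ : fpin [:: (i, ~~ b)] = (fpin [:: (i, b)])^-1); last by rewrite -fpin_inv.
by apply: cert_wrap => //; exact: IH.
Qed.

(** Hurwitz moves only permute and conjugate the entries, and conjugation is free. *)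
Lemma certg_hz b i : certg (hz b gen i) 1.
Proof.
elim: b i => [|[j s] b IH] i /=; first exact: certg_gen.
rewrite /hstep /=; case: ifP => _; first by case: s; [|apply: certgJ].
case: ifP => // _; case: s => //.
by have := certgJ (hz b gen j.+1)^-1 (IH j); rewrite invgK.
Qed.

Lemma certg_prod (f : nat -> free_group) m n : (forall i, certg (f i) 1) ->
  certg (\big[*%g/1]_(m <= i < n) f i) (n - m).
Proof.
move=> h; rewrite -[X in certg _ X]muln1 -sum_nat_const_nat.
rewrite unlock; elim: (index_iota m n) => [|i s IH] /=; first exact: certg1.
exact: certgM.
Qed.

Definition syllables := seq (bool * word nat).
Definition is_syllables (u : syllables) : Prop :=
  [/\ all (fun p => all (fun l => side l == p.1) p.2) u,
      sorted (fun p q => p.1 != q.1) u & all (fun p => fpin p.2 != 1) u].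

Definition flat (u : syllables) : word nat := flatten (unzip2 u).

Lemma syllables_exist g : exists2 u, is_syllables u & fpin (flat u) = g.
Proof.
elim/free_ind: g; elim=> [|l w [u [a b c] e]].
  by exists [::].
rewrite fpin_cons -{}e.
case: u a b c => [|[t ws] u] a b c.
  case: (eqVneq (fpin [:: l]) 1) => [e|ne].
    by exists [::]; rewrite // e mul1g.
  exists [:: (side l, [:: l])]; first by split=> //=; rewrite ?eqxx ?ne.
  by rewrite /flat /= mulg1.
have flE : fpin (flat ((t, ws) :: u)) = fpin ws * fpin (flat u) by exact: fpin_cat.
case: (eqVneq (side l) t) => [lt|lt].
  case: (eqVneq (fpin (l :: ws)) 1) => [e|ne].
    exists u.
      split.
      - by case/andP: a.
      - by apply: path_sorted b.
      - by case/andP: c.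
    by rewrite flE mulgA -fpin_cons e mul1g.
  exists ((t, l :: ws) :: u).
    split=> //=.
    - by rewrite lt eqxx.
    - by case: (u) b.
    - by rewrite ne; case/andP: c.
  by rewrite flE mulgA -fpin_cons -fpin_cat.
case: (eqVneq (fpin [:: l]) 1) => [e|ne].
  by exists ((t, ws) :: u); rewrite // e mul1g.
exists ((side l, [:: l]) :: (t, ws) :: u).
  split=> //=.
  - by rewrite eqxx.
  - by rewrite lt.
  - by rewrite ne.
exact: (fpin_cat [:: l]).
Qed.

Lemma cert_flat X u Y a : all (fun p => all (fun l => side l == p.1) p.2) u ->
  cert N (X ++ lift_word (flat u) ++ Y) a ->
  cert N (X ++ [seq (p.1, fpin p.2) | p <- u] ++ Y) a.
Proof.
elim: u X => [//|[t w] u IH] X /= /andP[wt ut].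
rewrite /flat /= lift_cat -catA => /(cert_word _ _ _ wt).
by move=> h; rewrite /= -cat_rcons; apply: IH; rewrite ?cat_rcons.
Qed.

Definition rev_inv (u : syllables) : syllables := [seq (p.1, winv p.2) | p <- rev u].

Lemma flat_rev_inv u : flat (rev_inv u) = winv (flat u).
Proof.
elim: u => // -[t w] u IH; rewrite /rev_inv rev_cons -cats1 map_cat /flat /unzip2 map_cat.
by rewrite flatten_cat -/(unzip2 _) -/(rev_inv u) -/(flat (rev_inv u)) IH /= cats0 winv_cat.
Qed.

Lemma rev_inv_side u : all (fun p => all (fun l => side l == p.1) p.2) u ->
  all (fun p => all (fun l => side l == p.1) p.2) (rev_inv u).
Proof.
move=> /allP hu; apply/allP => p /mapP[q]; rewrite mem_rev => /hu /allP hq ->.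
apply/allP => l; rewrite /= /winv mem_rev => /mapP[l' l'q ->].
exact: hq l'q.
Qed.

(* Both [g] and its complement in [w1 w2] are short, so the syllables of [g]
   survive in every quotient in which the norm of [w1 w2] is as large. *)
Theorem syllables_survive g a a' (u : syllables) w1 w2 :
  certg g a -> certg (g^-1 * (fpin w1 * fpin w2)) a' ->
  all (fun l => side l == true) w1 -> all (fun l => side l == false) w2 ->
  a + a' <= N (fpin w1 * fpin w2) ->
  is_syllables u -> fpin (flat u) = g ->
  forall p, p \in u -> ~ K (fpin p.2).
Proof.
move=> c1 c2 s1 s2 le [us ualt une] ug.
have {c1} : cert N [seq (p.1, fpin p.2) | p <- u] a.
  have := @cert_flat [::] u [::] a us; rewrite !cats0; apply.
  by apply/certgE; rewrite ug.
(* The complement is spelled with the same syllables, reversed and inverted, followed by the two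
   one-sided factors; both certificates thus label the same letters. *)
have {c2} : cert N ([seq (p.1, fpin p.2) | p <- rev_inv u] ++
    [:: (true, fpin w1); (false, fpin w2)]) a'.
  have := @cert_flat [::] (rev_inv u) [:: (true, fpin w1); (false, fpin w2)] a'.
  apply; first exact: rev_inv_side.
  rewrite cat0s; have {c2} : cert N (lift_word (flat (rev_inv u)) ++ lift_word w1 ++ lift_word w2 ++ [::]) a'.
    rewrite cats0 -!lift_cat; apply/certgE.
    by rewrite !fpin_cat flat_rev_inv fpin_winv ug.
  move=> /(cert_word _ _ _ s1); set X := lift_word _ => h.
  have := cert_word (rcons X (true, fpin w1)) [::] a' s2.
  by rewrite !cat_rcons => -[/(_ h)].
move=> [v2 [ty2 [m2 [e2 nc2 gd2 le2]]]] [v1 [ty1 [m1 [e1 nc1 gd1 le1]]]].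
pose d : bool * word nat := (true, [::]); pose r := size u.
pose g0 (x : 'I_r) := fpin (nth d u x).2; pose ty (x : 'I_r) := (nth d u x).1.
have sz1 : size v1 = r by rewrite -[RHS](size_map (fun p => (p.1, fpin p.2))) e1 size_map.
have sz2 : size v2 = r.+2.
  have := congr1 size e2; rewrite size_cat !size_map size_rev /= addn2 => <- //.
have nth1 i : i < r -> (ty1 (nth 0%N (unzip1 v1) i), nth 1 (unzip2 v1) i) =
    ((nth d u i).1, fpin (nth d u i).2).
  move=> ir; have := congr1 (nth (true, 1) ^~ i) e1.
  rewrite (nth_map d) // /typed (nth_map (0%N, 1)) ?sz1 // => ->.
  by rewrite !(nth_map (0%N, 1)) ?sz1.
have nth2 i : i < r -> (ty2 (nth 0%N (unzip1 v2) i), nth 1 (unzip2 v2) i) =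
    ((nth d u (r - i.+1)).1, (fpin (nth d u (r - i.+1)).2)^-1).
  move=> ir; have ir2 : i < size v2 by rewrite sz2; lia.
  have := congr1 (nth (true, 1) ^~ i) e2.
  rewrite nth_cat size_map size_map size_rev ir (nth_map d) ?size_map ?size_rev //.
  rewrite (nth_map d) ?size_rev // nth_rev // /typed (nth_map (0%N, 1)) //= fpin_winv => ->.
  by rewrite !(nth_map (0%N, 1)).
have nthD i : i < 2 -> (ty2 (nth 0%N (unzip1 v2) (r + i)), nth 1 (unzip2 v2) (r + i)) =
    nth (true, 1) [:: (true, fpin w1); (false, fpin w2)] i.
  move=> i2; have ir2 : r + i < size v2 by rewrite sz2; lia.
  have := congr1 (nth (true, 1) ^~ (r + i)%N) e2.
  rewrite nth_cat size_map size_map size_rev -/r ifF ?addKn; last (by lia) => ->.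
  by rewrite /typed (nth_map (0%N, 1)) // !(nth_map (0%N, 1)).
pose lab1 (x : 'I_r) := nth 0%N (unzip1 v1) x.
(* The complement lists the syllables backwards, so syllable [x] sits at position [r - x.+1], and
   the end letters sit at [r] and [r + 1]. *)
pose lab2 (x : 'I_r) := nth 0%N (unzip1 v2) (r - x.+1).
pose d1 := nth 0%N (unzip1 v2) (r + 0)%N; pose d2 := nth 0%N (unzip1 v2) (r + 1)%N.
have zipE (v : seq (nat * free_group)) i : i < size v ->
    nth (0%N, 1) v i = (nth 0%N (unzip1 v) i, nth 1 (unzip2 v) i).
  by move=> iv; rewrite !(nth_map (0%N, 1)) //; case: (nth _ _ _).
have W1 : word1 g0 lab1 (enum 'I_r) = v1.
  apply: (@eq_from_nth _ (0%N, 1)); first by rewrite size_map size_enum_ord sz1.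
  move=> i; rewrite size_map size_enum_ord => ir.
  rewrite (nth_map (Ordinal ir)) ?size_enum_ord // zipE ?sz1 //.
  rewrite (_ : nth _ _ _ = Ordinal ir); last exact: (nth_ord_enum (Ordinal ir) (Ordinal ir)).
  by congr (_, _); have [_ ->] := nth1 i ir.
have W2 : word2 g0 lab2 (fpin w1) (fpin w2) d1 d2 (enum 'I_r) = v2.
  apply: (@eq_from_nth _ (0%N, 1)).
    by rewrite size_cat size_map size_rev size_enum_ord sz2 addn2.
  move=> i; rewrite size_cat size_map size_rev size_enum_ord addn2 => ir2.
  rewrite nth_cat size_map size_rev size_enum_ord [RHS]zipE ?sz2 //.
  case: ltnP => ir.
    have jr : r - i.+1 < r by lia.
    rewrite (nth_map (Ordinal ir)) ?size_rev ?size_enum_ord // nth_rev ?size_enum_ord //.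
    rewrite (_ : nth _ _ _ = Ordinal jr); last exact: (nth_ord_enum (Ordinal ir) (Ordinal jr)).
    have [_ ->] := nth2 i ir; rewrite /lab2 /=.
    by have -> : (r - (r - i.+1).+1 = i)%N by lia.
  have [ei|ei] : (i = r + 0 \/ i = r + 1)%N by lia.
    by rewrite ei addKn /=; have [_ ->] := nthD 0%N isT.
  by rewrite ei addKn /=; have [_ ->] := nthD 1%N isT.
move=> p /(nthP d)[i ir <-].
have ty1E x : ty x = ty1 (lab1 x) by have [-> _] := nth1 x (ltn_ord x).
have ty2E (x : 'I_r) : ty x = ty2 (lab2 x).
  have xr := ltn_ord x; have [-> _] := nth2 (r - x.+1)%N ltac:(lia).
  by have -> : (r - (r - x.+1).+1 = x)%N by lia.
have td1 : ty2 d1 = true by have [-> _] := nthD 0%N isT.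
have td2 : ty2 d2 = false by have [-> _] := nthD 1%N isT.
apply: (@meander_faithful _ N K N1 NM NJ NK KV r g0 ty lab1 lab2 (fpin w1) (fpin w2)
  d1 d2 true m1 m2 _ _ _ _ _ _ _ _ _ _ _ _ _ (Ordinal ir)); rewrite ?W1 ?W2 //.
- by move=> x y; rewrite !ty1E => ->.
- by move=> x y; rewrite !ty2E => ->.
- by move=> x; rewrite ty2E => ->.
- by move=> x; rewrite ty2E => ->; rewrite td2.
- move=> x y xy; rewrite /ty -xy; have /(sortedP d)/(_ x) := ualt.
  rewrite xy ltn_ord => /(_ isT); by case: (nth d u x).1; case: (nth d u y).1.
- by move=> x; have /allP := une; apply; rewrite mem_nth.
- by move=> L /gd1[].
- by move=> L /gd2[].
- by move=> L /gd1[].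
- by move=> L /gd2[].
- by apply: leq_trans le; apply: leq_add.
Qed.

End Syllables.

(** * Reflections with linearly independent roots and coroots *)

Section Dihedral.
Import GRing.Theory.
Local Open Scope ring_scope.

Lemma mulr_scalar_mx (d : nat) (x : algC) (X : 'M[algC]_d) : X * x%:M = x *: X.
Proof. exact: mul_mx_scalar. Qed.

Lemma mul_scalar_mxr (d : nat) (x : algC) (X : 'M[algC]_d) : x%:M * X = x *: X.
Proof. exact: mul_scalar_mx. Qed.

(** On the image of (T - 1)(T - v) right multiplication by T is the scalar w, so the geometric sum
    vanishes there; the same holds with v and w exchanged. Subtracting leaves the nonzero scalar w -
    v times T^m - 1. *)
Lemma expr_roots_unity (d m : nat) (T : 'M[algC]_d) (w v : algC) :
  w ^+ m = 1 -> v ^+ m = 1 -> w != 1 -> v != 1 -> w != v ->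
  (T - 1) * ((T - v%:M) * (T - w%:M)) = 0 -> T ^+ m = 1.
Proof.
move=> wm vm w1 v1 wv h.
have geo (z : algC) : z ^+ m = 1 -> z != 1 -> \sum_(i < m) z ^+ i = 0.
  move=> zm z1; have /eqP := subrX1 z m; rewrite zm subrr eq_sym mulf_eq0 subr_eq0.
  by rewrite (negPf z1) => /eqP.
have sC (x : algC) : x%:M * T = T * x%:M by rewrite -!mulmxE scalar_mxC.
have key (x y : algC) : (T - 1) * ((T - y%:M) * (T - x%:M)) = 0 -> x ^+ m = 1 -> x != 1 ->
    (T - 1) * (T - y%:M) * \sum_(i < m) T ^+ i = 0.
  move=> hxy xm x1; set P := _ * (T - _).
  have PT : P * T = P * x%:M by apply/eqP; rewrite -subr_eq0 -mulrBr /P -mulrA hxy.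
  have PTi i : P * T ^+ i = P * (x ^+ i)%:M.
    elim: i => [|i IH]; first by rewrite !expr0.
    rewrite exprSr mulrA IH -mulrA sC mulrA PT -mulrA; congr (_ * _).
    by rewrite -!mulmxE -scalar_mxM mulrC -exprSr.
  rewrite mulr_sumr; under eq_bigr => i _ do rewrite PTi.
  rewrite -mulr_sumr -raddf_sum /= geo // (_ : 0%:M = 0) ?mulr0 //.
  exact: raddf0.
have h' : (T - 1) * ((T - w%:M) * (T - v%:M)) = 0.
  rewrite -h; congr (_ * _); rewrite !mulrBl !mulrBr !sC -!mulmxE -!scalar_mxM.
  rewrite [v * w]mulrC; move: (T * T) (T * w%:M) (T * v%:M) => A B C.
  by apply/matrixP => i j; rewrite !mxE; ring.
have e1 := key w v h wm w1; have e2 := key v w h' vm v1.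
have : (T - 1) * (T - v%:M - (T - w%:M)) * \sum_(i < m) T ^+ i = 0.
  by rewrite mulrBr mulrBl e1 e2 subrr.
rewrite (_ : T - v%:M - (T - w%:M) = (w - v)%:M); last first.
  by apply/matrixP => i j; rewrite !mxE; case: (i == j) => /=; ring.
rewrite mulr_scalar_mx -[LHS]scalemxAl mulmxE.
move/eqP; rewrite scaler_eq0 subr_eq0 (negPf wv) /= -subrX1 subr_eq0.
by move/eqP.
Qed.

(* For rank-one [P], [Q] with [PQP = c P], [QPQ = c Q] the product [T] of the
   reflections satisfies [T + 1/T = 2 - 2P - 2Q + PQ + QP]. *)
Lemma refl_prod_order (d m : nat) (P Q : 'M[algC]_d) (c : algC) :
  P * P = P *+ 2 -> Q * Q = Q *+ 2 -> P * Q * P = c *: P -> Q * P * Q = c *: Q ->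
  (2 < m)%N -> (exists2 z : algC, m.-primitive_root z & c = 2 + z + z^-1) ->
  ((1 - P) * (1 - Q)) ^+ m = 1.
Proof.
move=> PP QQ PQP QPQ m2 [z zm cz]; set T := _ * _.
have zX := prim_expr_order zm.
have z0 : z != 0.
  apply/eqP => z00; move: zX; rewrite z00 expr0n; apply/eqP.
  by case: (m) m2 => //= *; rewrite eq_sym oner_eq0.
have z1 : z != 1.
  apply/eqP => z1; have := prim_order_dvd zm 1; rewrite expr1 z1 eqxx dvdn1 => /eqP.
  by move=> e; rewrite e in m2.
have z2 : z != z^-1.
  apply/eqP => e; have := prim_order_dvd zm 2; rewrite expr2 {1}e mulVf // eqxx => /dvdn_leq.
  by move=> /(_ isT); rewrite leqNgt m2.
have zV1 : z^-1 != 1 by rewrite invr_eq1.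
have zVX : z^-1 ^+ m = 1 by rewrite exprVn zX invr1.
apply: (expr_roots_unity zX zVX z1 zV1 z2).
pose T' := (1 - Q) * (1 - P).
have TV : T * T' = 1.
  have sq (X : 'M[algC]_d) : X * X = X *+ 2 -> (1 - X) * (1 - X) = 1.
    move=> XX; rewrite mulrBl mul1r mulrBr mulr1 XX mulr2n.
    by apply/matrixP => i j; rewrite !mxE; ring.
  by rewrite /T /T' mulrA -[X in X * _]mulrA sq // mulr1 sq.
(* The product of [T - z^-1] and [T - z] is [T * Z], and [T - 1] is - P - Q + P Q, so it suffices
   that [P] and [Q] annihilate [Z] from the left. *)
pose Z := T + T' - (z + z^-1)%:M.
have ZE : Z = (4 - c)%:M - P *+ 2 - Q *+ 2 + P * Q + Q * P.
  have zc : z + z^-1 = c - 2 by rewrite cz; ring.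
  rewrite /Z /T /T' zc !mulrBl !mulrBr !mul1r !mulr1.
  move: (P * Q) (Q * P) => A B.
  by apply/matrixP => i j; rewrite !mxE; case: (i == j) => /=; ring.
have PZ : P * Z = 0.
  rewrite ZE !mulr2n !opprD !mulrDr !mulrN !mulrA PQP PP mulr_scalar_mx !mulr2n !mulrDl.
  move: (P * Q) => A.
  by apply/matrixP => i j; rewrite !mxE; ring.
have QZ : Q * Z = 0.
  rewrite ZE !mulr2n !opprD !mulrDr !mulrN !mulrA QPQ QQ mulr_scalar_mx !mulr2n !mulrDl.
  move: (Q * P) => A.
  by apply/matrixP => i j; rewrite !mxE; ring.
have -> : (T - z^-1%:M) * (T - z%:M) = T * Z.
  rewrite /Z !mulrBl !mulrBr mulrDr TV !mul_scalar_mxr !mulr_scalar_mx ?scale_scalar_mx mulVf //.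
  move: (T * T) => A.
  by apply/matrixP => i j; rewrite !mxE; ring.
have -> : (T - 1) * (T * Z) = T * ((T - 1) * Z).
  by rewrite mulrA [RHS]mulrA; congr (_ * _); rewrite mulrBl mul1r mulrBr mulr1.
have -> : (T - 1) * Z = - (P * Z) - Q * Z + P * (Q * Z).
  have -> : T - 1 = - P - Q + P * Q.
    rewrite /T mulrBl mul1r mulrBr mulr1; move: (P * Q) => A.
    by apply/matrixP => i j; rewrite !mxE; ring.
  by rewrite !mulrDl !mulNr mulrA.
by rewrite PZ QZ !mulr0 oppr0 !addr0 mulr0.
Qed.

End Dihedral.

(** * Reflection length as a rank *)

Section Reflections.
Import GRing.Theory.
Local Open Scope ring_scope.
Variables (n : nat) (C : nat -> nat -> algC).
Hypothesis Cdiag : forall i, C i i = 2.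

(* The second block of coordinates makes the coroots linearly independent
   whatever the matrix [C]. *)
Definition root (i : nat) : 'cV[algC]_(n + n) := \col_j ((j : nat) == i)%:R.
Definition coroot (i : nat) : 'rV[algC]_(n + n) :=
  \row_j (if (j < n)%N then C i j else ((j : nat) == n + i)%N%:R).
Definition rank1 (i : nat) : 'M[algC]_(n + n) := root i *m coroot i.
(** Generators of index at least [n] act trivially, so the free group on all of [nat] is
    represented. *)
Definition refl (i : nat) : 'M[algC]_(n + n) := if (i < n)%N then 1 - rank1 i else 1.

Lemma coroot_root i j : (j < n)%N -> coroot i *m root j = (C i j)%:M.
Proof.
move=> jn; have jnn : (j < n + n)%N by lia.
apply/matrixP => a b; rewrite !ord1 !mxE (bigD1 (Ordinal jnn)) //= !mxE /= jn eqxx.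
rewrite mulr1 big1 ?addr0 // => x xj; rewrite !mxE (_ : (_ == j) = false) ?mulr0 //.
by apply/negbTE; apply: contraNneq xj => e; apply/eqP/val_inj.
Qed.

Lemma rank1M i j : (j < n)%N -> rank1 i * rank1 j = C i j *: (root i *m coroot j).
Proof.
move=> jn; rewrite -mulmxE /rank1 mulmxA -[root i *m _ *m _]mulmxA coroot_root //.
by rewrite mul_mx_scalar -scalemxAl.
Qed.

Lemma rank1_sq i : (i < n)%N -> rank1 i * rank1 i = rank1 i *+ 2.
Proof. by move=> i_n; rewrite rank1M // Cdiag scaler_nat. Qed.

Lemma rank1_braid i j : (i < n)%N -> (j < n)%N ->
  rank1 i * rank1 j * rank1 i = (C i j * C j i) *: rank1 i.
Proof.
move=> i_n jn; rewrite rank1M // -mulmxE -scalemxAl /rank1 mulmxA.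
by rewrite -[root i *m coroot j *m _]mulmxA coroot_root // mul_mx_scalar -!scalemxAl scalerA.
Qed.

Lemma refl_sq i : refl i * refl i = 1.
Proof.
rewrite /refl; case: ifP => i_n; last by rewrite mulr1.
rewrite mulrBl mul1r mulrBr mulr1 rank1_sq //.
by apply/matrixP => a b; rewrite !mxE; ring.
Qed.

Lemma refl_order i j m : (i < n)%N -> (j < n)%N ->
  [\/ m = 1%N /\ i = j, m = 2 /\ (C i j = 0 /\ C j i = 0) |
   (2 < m)%N /\ exists2 z : algC, m.-primitive_root z & C i j * C j i = 2 + z + z^-1] ->
  (refl i * refl j) ^+ m = 1.
Proof.
move=> i_n jn [[-> ->]|[-> [cij cji]]|[m2 hz]].
- by rewrite expr1 refl_sq.
- have comm : refl i * refl j = refl j * refl i.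
    rewrite /refl i_n jn !mulrBl !mulrBr !mul1r !mulr1 !rank1M // cij cji !scale0r.
    by apply/matrixP => a b; rewrite !mxE; ring.
  by rewrite expr2 {2}comm mulrA -[refl i * refl j * _]mulrA refl_sq mulr1 refl_sq.
- rewrite /refl i_n jn; apply: refl_prod_order m2 hz; rewrite ?rank1_sq ?rank1_braid //.
  by rewrite mulrC.
Qed.

Definition rho_word (w : word nat) : 'M[algC]_(n + n) := \prod_(l <- w) refl l.1.

Lemma rho_word_cat u v : rho_word (u ++ v) = rho_word u * rho_word v.
Proof. exact: big_cat. Qed.

Lemma rho_word_peq u v : peq free_rel u v -> rho_word u = rho_word v.
Proof.
elim=> {u v} [//|u v _ IH|u v w _ IH1 _ IH2|u v i b|//].
- by [].
- by rewrite IH1.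
- by rewrite !rho_word_cat /rho_word !big_cons /= [refl i * (refl i * _)]mulrA refl_sq mul1r.
Qed.

Definition rho (g : free_group) : 'M[algC]_(n + n) := rho_word (repr g).

Lemma rho_fpin w : rho (fpin w) = rho_word w.
Proof. by apply: rho_word_peq; apply: repr_pin. Qed.

Lemma rhoM g h : rho (g * h)%g = rho g * rho h.
Proof.
elim/free_ind: g => u; elim/free_ind: h => v.
by rewrite -fpin_cat !rho_fpin rho_word_cat.
Qed.

Lemma rho1 : rho 1%g = 1.
Proof. by rewrite -[1%g]/(fpin [::]) rho_fpin /rho_word big_nil. Qed.

Lemma rhoVl g : rho g^-1%g * rho g = 1.
Proof. by rewrite -rhoM mulVg rho1. Qed.

Lemma rhoVr g : rho g * rho g^-1%g = 1.
Proof. by rewrite -rhoM mulgV rho1. Qed.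

(** The codimension of the fixed space, a lower bound for the number of conjugates of generators
    needed to spell [g]. *)
Definition rnorm (g : free_group) : nat := \rank (rho g - 1).

Lemma rnorm1 : rnorm 1%g = 0%N.
Proof. by rewrite /rnorm rho1 subrr mxrank0. Qed.

Lemma rnormM g h : (rnorm (g * h)%g <= rnorm g + rnorm h)%N.
Proof.
rewrite /rnorm rhoM (_ : _ - 1 = (rho g - 1) *m rho h + (rho h - 1)).
  by apply: leq_trans (mxrank_add _ _) _; rewrite leq_add2r mxrankM_maxl.
by rewrite mulmxE mulrBl mul1r addrA subrK.
Qed.

Lemma rnormJ g h : rnorm (g * h * g^-1)%g = rnorm h.
Proof.
have le x y : (rnorm (x * y * x^-1)%g <= rnorm y)%N.
  rewrite /rnorm !rhoM (_ : _ - 1 = rho x *m (rho y - 1) *m rho x^-1%g).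
    exact: leq_trans (mxrankM_maxl _ _) (mxrankM_maxr _ _).
  by rewrite !mulmxE mulrBr mulrBl mulr1 rhoVr.
apply/eqP; rewrite eqn_leq le /=.
have := le g^-1%g (g * h * g^-1)%g.
by rewrite invgK !mulgA mulVg mul1g mulgVK.
Qed.

Lemma rnorm_gen i : (rnorm (gen i) <= 1)%N.
Proof.
rewrite /rnorm rho_fpin /rho_word big_seq1 /refl; case: ifP => _.
  rewrite addrAC subrr add0r mxrank_opp; apply: leq_trans (mxrankM_maxl _ _) _.
  exact: rank_leq_col.
by rewrite subrr mxrank0.
Qed.

Definition rker (g : free_group) : Prop := rho g = 1.

Lemma rker_norm z a b : rker z -> rnorm (a * z * b)%g = rnorm (a * b)%g.
Proof. by move=> kz; rewrite /rnorm !rhoM kz mulr1. Qed.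

Lemma rkerV z : rker z -> rker z^-1%g.
Proof. by rewrite /rker => kz; have := rhoVl z; rewrite kz mulr1. Qed.

Definition cox m : 'M[algC]_(n + n) := \prod_(0 <= i < m) refl i.

Lemma coxS m : cox m.+1 = cox m * refl m.
Proof. by rewrite /cox big_nat_recr. Qed.

Lemma cox_entry m (i j : 'I_(n + n)) (mn : (m < n + n)%N) : (m < n)%N ->
  cox m.+1 i j = cox m i j - cox m i (Ordinal mn) * coroot m 0 j.
Proof.
move=> mlt; rewrite coxS /refl mlt mulrBr mulr1 /rank1 -mulmxE mulmxA.
rewrite [in LHS]mxE [X in _ + X]mxE; congr (_ - _).
rewrite [LHS]mxE big_ord1; congr (_ * _).
rewrite [LHS]mxE (bigD1 (Ordinal mn)) //= mxE eqxx mulr1 big1 ?addr0 // => x xm.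
rewrite mxE (_ : (_ == m) = false) ?mulr0 //.
by apply/negbTE; apply: contraNneq xm => e; apply/eqP/val_inj.
Qed.

Lemma cox_below m (i j : 'I_(n + n)) : (m <= n)%N -> (m <= i)%N -> cox m i j = (i == j)%:R.
Proof.
elim: m j => [|m IH] j mn mi; first by rewrite /cox big_geq // mxE.
have mnn : (m < n + n)%N by lia.
have im : i != Ordinal mnn by apply/eqP => e; move: mi; rewrite e /= ltnn.
rewrite (cox_entry _ _ mnn) // !IH ?(ltnW mn) ?(ltnW mi) //.
by rewrite (negPf im) mul0r subr0.
Qed.

(** Only factor [j] alters column [n + j], and when it is applied row [i] is still a row of the
    identity because [j <= i]. *)
Lemma cox_upper m (i j : 'I_n) : (m <= n)%N -> (j < m)%N -> (j <= i)%N ->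
  cox m (lshift n i) (rshift n j) = - (i == j)%:R.
Proof.
elim: m => [//|m IH] mn jm ji.
have mnn : (m < n + n)%N by lia.
rewrite (cox_entry _ _ mnn) // /coroot mxE /= ltnNge leq_addr /= eqn_add2l.
have [jm'|jm'] : (j < m)%N \/ j = m :> nat by lia.
  by rewrite IH ?(ltnW mn) // (_ : (_ == m) = false) ?mulr0 ?subr0 //; lia.
rewrite jm' eqxx mulr1 !cox_below /= ?(ltnW mn) -?jm' //.
rewrite (_ : (lshift n i == rshift n j) = false) ?sub0r; last first.
  by apply/eqP => /(congr1 val) /=; have := ltn_ord i; lia.
have -> : (lshift n i == Ordinal mnn) = (i == j).
  apply/eqP/eqP => [/(congr1 val) /= e|->]; last by apply: val_inj; rewrite /= jm'.
  by apply: val_inj; rewrite /= e jm'.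
by [].
Qed.

(** The upper right block of [cox n - 1] is triangular with diagonal -1, whatever the off-diagonal
    entries of [C]. *)
Lemma rnorm_cox : (n <= rnorm (\big[*%g/1%g]_(0 <= i < n) gen i))%N.
Proof.
have -> : rnorm (\big[*%g/1%g]_(0 <= i < n) gen i) = \rank (cox n - 1).
  rewrite /rnorm; congr (\rank (_ - _)); rewrite /cox.
  elim/big_rec2: _ => [|i y x _ <-]; first exact: rho1.
  by rewrite rhoM rho_fpin /rho_word big_seq1.
pose A := ursubmx (cox n - 1).
have Aij (i j : 'I_n) : (j <= i)%N -> A i j = - (i == j)%:R.
  move=> ji; rewrite /A [LHS]mxE [LHS]mxE mxE cox_upper // mxE mxE.
  rewrite (_ : (lshift n i == rshift n j) = false) ?oppr0 ?addr0 //.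
  by apply/eqP => /(congr1 val) /=; have := ltn_ord i; lia.
have Au : A \in unitmx.
  rewrite unitmxE -det_tr det_trig.
    rewrite unitfE; apply/prodf_neq0 => i _; rewrite mxE Aij // eqxx.
    by rewrite oppr_eq0 oner_eq0.
  apply/is_trig_mxP => i j ij; rewrite mxE Aij ?(ltnW ij) //.
  by rewrite (_ : (j == i) = false) ?oppr0 //; apply/eqP => e; move: ij; rewrite e ltnn.
have rA : \rank A = n by apply/mxrank_unit.
rewrite -[X in (X <= _)%N]rA.
rewrite /A /ursubmx -[X in rsubmx X]mulmx1 -mulmx_rsub.
apply: leq_trans (mxrankM_maxl _ _) _.
rewrite -[X in usubmx X]mul1mx -mul_usub_mx; exact: mxrankM_maxr.
Qed.

End Reflections.

(** * Normal forms in a free product *)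

Section NormalForms.
Import GRing.Theory.
Local Open Scope ring_scope.
Variables (R : pzRingType).
Implicit Types (t : bool) (g h : R) (s : seq (bool * R)).

(** Left multiplication by a syllable on reduced sequences, as in van der Waerden's proof of the
    normal form theorem. *)
Definition act t g s : seq (bool * R) :=
  if s is (t', h) :: s' then
    if t' == t then (if g * h == 1 then s' else (t, g * h) :: s')
    else if g == 1 then s else (t, g) :: s
  else if g == 1 then [::] else [:: (t, g)].

Definition reduced s : bool :=
  sorted (fun p q => p.1 != q.1) s && all (fun p => p.2 != 1) s.

Lemma reduced_cons p s : reduced (p :: s) ->
  [/\ reduced s, p.2 != 1 & (if s is q :: _ then p.1 != q.1 else true)].
Proof.
rewrite /reduced /= => /and3P[ps p1 s1]; rewrite s1 (path_sorted ps) p1.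
by split=> //; case: s ps {s1} => //= q s /andP[].
Qed.

Lemma cons_reduced p s : reduced s -> p.2 != 1 ->
  (if s is q :: _ then p.1 != q.1 else true) -> reduced (p :: s).
Proof. by rewrite /reduced /= => /andP[so ->] ->; case: s so => //= q s -> ->. Qed.

Lemma act_reduced t g s : reduced s -> reduced (act t g s).
Proof.
case: s => [|[t' h] s] red /=; first by case: ifP => // /negbT g1; rewrite /reduced /= g1.
have [red' h1 ht] := reduced_cons red.
case: (t' =P t) => [<-|/eqP tt]; case: ifP => // /negbT g1; apply: cons_reduced => //=.
by case: (s) ht.
by rewrite eq_sym.
Qed.

Lemma act_one t s : reduced s -> act t 1 s = s.
Proof.
case: s => [|[t' h] s] red /=; first by rewrite eqxx.
have [_ h1 _] := reduced_cons red; rewrite mul1r eqxx.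
by case: (t' =P t) => [<-|//]; rewrite (negPf h1).
Qed.

Lemma act_mul t g h s : reduced s -> act t g (act t h s) = act t (g * h) s.
Proof.
case: s => [|[t' x] s] red /=.
  by case: (eqVneq h 1) => [->|h1] /=; rewrite ?mulr1 ?eqxx.
have [red' x1 xt] := reduced_cons red.
case: (t' =P t) => [<-|/eqP tt].
  case: (eqVneq (h * x) 1) => [hx|hx1] /=; last by rewrite eqxx mulrA.
  rewrite -mulrA hx mulr1.
  case: s red xt {red'} => [|[t2 y] s] red xt //=.
  by rewrite eq_sym (negPf xt).
case: (eqVneq h 1) => [->|h1] /=; first by rewrite (negPf tt) mulr1.
by rewrite eqxx.
Qed.

Variables (k : nat) (f : nat -> R).
Hypothesis f_sq : forall i, f i * f i = 1.

(** Signs of letters are ignored, here and in [evalw], because every [f i] is an involution. *)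
Definition actw (w : word nat) s := foldr (fun l => act (l.1 < k)%N (f l.1)) s w.

Definition evalw (w : word nat) : R := \prod_(l <- w) f l.1.

Lemma actw_cat u v s : actw (u ++ v) s = actw u (actw v s).
Proof. exact: foldr_cat. Qed.

Lemma actw_reduced w s : reduced s -> reduced (actw w s).
Proof. by move=> red; elim: w => //= l w; apply: act_reduced. Qed.

Lemma actw_side t w s : all (fun l => side k l == t) w -> reduced s ->
  actw w s = act t (evalw w) s.
Proof.
move=> + red; elim: w => [_|l w IH] /=; first by rewrite /evalw big_nil act_one.
move=> /andP[/eqP lt ws]; rewrite IH // -[(l.1 < k)%N]/(side k l) lt act_mul //.
by rewrite /evalw big_cons.
Qed.

Lemma actw_peq u v s : peq free_rel u v -> reduced s -> actw u s = actw v s.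
Proof.
move=> uv red; elim: uv => {u v} [//|u v _ IH|u v w _ IH1 _ IH2|u v i b|//].
- by [].
- by rewrite IH1.
- rewrite !actw_cat /= act_mul ?actw_reduced //.
  by rewrite f_sq act_one ?actw_reduced.
Qed.

Lemma actw_syllables u : is_syllables k u -> (forall p, p \in u -> evalw p.2 != 1) ->
  actw (flat u) [::] = [seq (p.1, evalw p.2) | p <- u].
Proof.
elim: u => // -[t w] u IH [/= /andP[wt us] so /andP[_ une]] ne.
have so' := path_sorted so.
have isu : is_syllables k u by split.
have ne' p : p \in u -> evalw p.2 != 1 by move=> pu; apply: ne; rewrite in_cons pu orbT.
have {}IH := IH isu ne'.
rewrite /flat /= actw_cat -/(flat u) IH (actw_side wt).
  have w1 : evalw w != 1 by apply: (ne (t, w)); apply: mem_head.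
  case: u so {us so' une isu IH ne ne'} => [|[t' w'] u] /=; first by rewrite (negPf w1).
  by move=> /andP[tt _]; rewrite eq_sym (negPf tt) (negPf w1).
rewrite -IH; exact: actw_reduced.
Qed.

Lemma actw_nil_side t w : all (fun l => side k l == t) w ->
  exists2 s, actw w [::] = s & (size s <= 1)%N /\ all (fun p => p.1 == t) s.
Proof.
move=> wt; exists (actw w [::]) => //; rewrite (actw_side wt) //=.
by case: ifP => //=; rewrite eqxx.
Qed.

(** The normal form of [flat u] has one entry per syllable, while that of a one-sided word has at
    most one entry; hence [u] has at most one syllable. *)
Lemma syllables_side t w u : is_syllables k u -> (forall p, p \in u -> evalw p.2 != 1) ->
  all (fun l => side k l == t) w -> actw (flat u) [::] = actw w [::] ->
  exists2 v, all (fun l => side k l == t) v & fpin v = fpin (flat u).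
Proof.
move=> isu ne wt; rewrite actw_syllables // => e.
have [s es [s1 st]] := actw_nil_side wt; rewrite -{}es -{}e in s1 st.
case: u isu {ne} s1 st => [|[t' v] [|//]] [/= us _ _] _ => [_|/andP[/eqP tt _]].
  by exists [::].
exists v; last by rewrite /flat /= cats0.
by case/andP: us => + _; rewrite tt.
Qed.

End NormalForms.

(** * Hurwitz stabilizers of Coxeter generators of a free product *)

Section CoxeterStabilizer.
Variables (n k : nat) (m : 'I_n -> 'I_n -> nat).
Hypothesis mcox : coxeter_matrix m.
Hypothesis kn : k <= n.
Hypothesis msplit : forall i j, m i j != 0 -> (i < k) = (j < k).

Definition zeta (p : nat) : algC :=
  if p is q.+1 then sval (C_prim_root_exists (ltn0Sn q)) else 0%R.

Lemma zetaP p : 0 < p -> p.-primitive_root%R (zeta p).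
Proof. by case: p => // p _; rewrite /zeta; case: C_prim_root_exists. Qed.

Definition coxn (i j : nat) : nat :=
  if (insub i : option 'I_n) is Some a then
    if (insub j : option 'I_n) is Some b then m a b else 0
  else 0.

Lemma coxnE (a b : 'I_n) : coxn a b = m a b.
Proof. by rewrite /coxn !valK. Qed.

(* [cartan i j * cartan j i = 4 cos^2 (pi / m i j) = 2 + z + z^-1]. *)
Definition cartan (i j : nat) : algC :=
  if i == j then 2%R else
  if coxn i j <= 2 then 0%R else
  if i < j then 1%R else (2 + zeta (coxn i j) + (zeta (coxn i j))^-1)%R.

Lemma cartan_diag i : cartan i i = 2%R.
Proof. by rewrite /cartan eqxx. Qed.

Local Notation f := (refl n cartan).

Lemma f_sq i : (f i * f i = 1)%R.
Proof. exact: refl_sq cartan_diag i. Qed.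

Lemma f_order (i j : 'I_n) : m i j != 0 -> ((f i * f j) ^+ m i j = 1)%R.
Proof.
move=> mij; have [msym [mdiag mne]] := mcox.
apply: (refl_order cartan_diag (ltn_ord i) (ltn_ord j)).
have [<-|ij] := eqVneq i j; first by constructor 1; rewrite mdiag.
have ijn : (i == j :> nat) = false by apply/negbTE; apply: contraNneq ij => e; apply/eqP/val_inj.
have jin : (j == i :> nat) = false by rewrite eq_sym.
have m1 := mne _ _ ij.
have [m2|m2] := leqP (m i j) 2.
  constructor 2; split; first by move: m2 mij m1; case: (m i j) => [|[|[|]]].
  by rewrite /cartan ijn jin !coxnE (msym j i) m2.
constructor 3; split=> //; exists (zeta (m i j)); first by apply: zetaP; lia.
rewrite /cartan ijn jin !coxnE (msym j i) leqNgt m2 /=.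
by case: ltngtP ijn => // _ _; rewrite ?GRing.mul1r ?GRing.mulr1.
Qed.

Local Notation actn := (actw k f).

(** By [msplit] a relator lies on one side, so it acts as a single syllable, and its matrix is 1 by
    [f_order]. *)
Lemma actw_cox (u v : word 'I_n) s : peq (cox_rel m) u v -> reduced s ->
  actn (map_word val u) s = actn (map_word val v) s.
Proof.
move=> uv red; elim: uv => {u v} [//|u v _ IH|u v w _ IH1 _ IH2|u v a b|u v x y].
- by [].
- by rewrite IH1.
- rewrite /map_word !map_cat !actw_cat /= act_mul ?actw_reduced //.
  by rewrite f_sq act_one ?actw_reduced.
- move=> [i [j [mij [-> ->]]]]; rewrite /map_word !map_cat !actw_cat; congr (actn _ _).
  set s' := actn _ s; have red' : reduced s' by apply: actw_reduced.
  have sd : all (fun l => side k l == (i < k)) (map_word val (flatten (nseq (m i j) [:: (i, false); (j, false)]))).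
    elim: (m i j) => //= p IHp; by rewrite /side /= eqxx -(msplit mij) eqxx.
  rewrite (actw_side _ sd) // (_ : evalw f _ = 1%R) ?act_one //.
  rewrite -(f_order mij); elim: (m i j) => [|p IHp].
    by rewrite /evalw /= big_nil GRing.expr0.
  by rewrite /evalw /= !big_cons -/(evalw f _) IHp GRing.mulrA GRing.exprS.
Qed.

Variable b : word 'I_(n.-1).
Hypothesis Hb : H_cox m b.
Local Notation bn := (map_word val b).

Definition entry (j : nat) : word 'I_n := nth [::] (hurwitz b (gens n)) j.
Definition entryn j : word nat := map_word val (entry j).

Lemma nth_gens (j : 'I_n) : nth [::] (gens n) j = [:: (j, false)].
Proof. by rewrite /gens (nth_map j) ?size_enum_ord // nth_ord_enum. Qed.

Lemma bn_bound : all (fun l => l.1 < n.-1) bn.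
Proof. by apply/allP => l /mapP[[i s] _ ->] /=. Qed.

Lemma fpin_entry j : j < n -> fpin (entryn j) = hz bn gen j.
Proof.
move=> jn; pose R0 := (fun _ _ : word 'I_n => False); pose f (i : 'I_n) := Some (val i).
have fR x y : R0 x y -> peq free_rel (omap_word f x) (omap_word f y) by [].
have phiE u : presmap free_rel f (pin R0 u) = fpin (map_word val u).
  by rewrite (presmap_pin fR) map_word_omap.
rewrite -phiE /entry pin_hurwitz (hz_morph _ _ (presmapM fR) (presmapV fR)).
apply: (hz_local bn_bound) => // i i_n.
by rewrite (nth_gens (Ordinal i_n)) phiE.
Qed.

Lemma act_entries i j s : i <= j <= n -> reduced s ->
  actn (flatten [seq entryn x | x <- index_iota i j]) s =
  actn [seq (x, false) | x <- index_iota i j] s.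
Proof.
move=> /andP[ij jn] red.
have : forall x, x \in index_iota i j -> x < n by move=> x; rewrite mem_index_iota => /andP[_ /leq_trans]; apply.
elim: (index_iota i j) => //= x l IH hl.
rewrite actw_cat IH => [|y yl]; last by apply: hl; rewrite in_cons yl orbT.
have xn : x < n by apply: hl; rewrite mem_head.
rewrite /entryn (@actw_cox _ [:: (Ordinal xn, false)]) ?actw_reduced //.
have := Hb (i := x); rewrite size_map size_enum_ord => /(_ xn).
by rewrite (nth_gens (Ordinal xn)).
Qed.

Lemma fpin_entries i j : i <= j <= n ->
  fpin (flatten [seq entryn x | x <- index_iota i j]) = \big[*%g/1%g]_(i <= x < j) hz bn gen x.
Proof.
move=> /andP[ij jn].
have : forall x, x \in index_iota i j -> x < n by move=> x; rewrite mem_index_iota => /andP[_ /leq_trans]; apply.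
elim: (index_iota i j) => [_|x l IH hl]; first by rewrite big_nil.
rewrite big_cons /= fpin_cat fpin_entry ?IH //.
  by move=> y yl; apply: hl; rewrite in_cons yl orbT.
by apply: hl; rewrite mem_head.
Qed.

Local Notation N := (rnorm n cartan).

Let N1 : N 1%g = 0.
Proof. exact: rnorm1 cartan_diag. Qed.
Let NM x y : N (x * y)%g <= N x + N y.
Proof. exact: rnormM cartan_diag x y. Qed.
Let NJ x y : N (x * y * x^-1)%g = N y.
Proof. exact: rnormJ cartan_diag x y. Qed.
Let NK z x y : rker n cartan z -> N (x * z * y)%g = N (x * y)%g.
Proof. exact: rker_norm cartan_diag z x y. Qed.
Let KV z : rker n cartan z -> rker n cartan z^-1%g.
Proof. exact: rkerV cartan_diag z. Qed.
Let Ngen i : N (gen i) <= 1.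
Proof. exact: rnorm_gen cartan_diag i. Qed.

(** The bound on [a + a'] meets [rnorm_cox], so no syllable of [g] dies. Since [b] fixes the Coxeter
    generators, [g] acts like generators [i] to [j - 1], which all lie on side [t]. *)
Lemma survive t g a a' i j : i <= j <= n ->
  g = (\big[*%g/1]_(i <= x < j) hz bn gen x)%g ->
  certg N k g a -> certg N k (g^-1 * \big[*%g/1]_(0 <= x < n) gen x)%g a' -> a + a' <= n ->
  all (fun x => (x < k) == t) (index_iota i j) ->
  exists2 v, all (fun l => side k l == t) v & fpin v = g.
Proof.
move=> ijn gE ca ca' aa st.
have [u isu ug] := syllables_exist k g.
pose w1 := [seq (x, false) | x <- index_iota 0 k].
pose w2 := [seq (x, false) | x <- index_iota k n].
have wE p q : fpin [seq (x, false) | x <- index_iota p q] = (\big[*%g/1]_(p <= x < q) gen x)%g.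
  by elim: (index_iota p q) => [|x l IH]; rewrite ?big_nil // big_cons -IH -fpin_cons.
have cE : (\big[*%g/1]_(0 <= x < n) gen x = fpin w1 * fpin w2)%g.
  by rewrite !wE -big_cat_nat.
have s1 : all (fun l => side k l == true) w1.
  by apply/allP => l /mapP[x]; rewrite mem_index_iota /side => /andP[_ xk] -> /=; rewrite xk.
have s2 : all (fun l => side k l == false) w2.
  by apply/allP => l /mapP[x]; rewrite mem_index_iota /side => /andP[kx _] -> /=; rewrite ltnNge kx.
have le : a + a' <= N (fpin w1 * fpin w2)%g by rewrite -cE; exact: leq_trans aa (rnorm_cox n cartan_diag).
rewrite cE in ca'.
have ne p : p \in u -> evalw f p.2 != 1%R.
  move=> pu; apply/eqP => e1.
  have := (syllables_survive N1 NM NJ NK KV ca ca' s1 s2 le isu ug pu); apply.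
  by rewrite /rker (rho_fpin n cartan_diag).
pose w := [seq (x, false) | x <- index_iota i j].
have ws : all (fun l => side k l == t) w.
  by apply/allP => l /mapP[x xij ->]; have /allP/(_ x xij) := st.
have e : actn (flat u) [::] = actn w [::].
  rewrite -act_entries //; apply: (actw_peq k f_sq) => //.
  by apply/pinP; rewrite -!/(fpin _) ug gE fpin_entries.
have [v vs vE] := syllables_side isu ne ws e.
by exists v => //; rewrite vE.
Qed.

Let c : free_group := (\big[*%g/1]_(0 <= x < n) gen x)%g.
Let P j : free_group := (\big[*%g/1]_(0 <= x < j) hz bn gen x)%g.
Let Q j : free_group := (\big[*%g/1]_(j <= x < n) hz bn gen x)%g.

Lemma P_Q j : j <= n -> (P j * Q j = c)%g.
Proof.
move=> jn; rewrite /P /Q -big_cat_nat //; exact: hz_prod bn_bound.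
Qed.

Let certg_hz_prod i j : certg N k (\big[*%g/1]_(i <= x < j) hz bn gen x)%g (j - i).
Proof.
apply: (certg_prod N1 NM NJ).
exact: certg_hz N1 NM NJ Ngen k bn.
Qed.

Lemma prefix_side j : j <= k -> exists2 v, all (fun l => side k l == true) v & fpin v = P j.
Proof.
move=> jk; have jn := leq_trans jk kn.
apply: (survive (a := j) (a' := n - j) (i := 0) (j := j)) => //.
- by rewrite -[X in certg _ _ _ X]subn0; exact: certg_hz_prod.
- by rewrite -/c -(P_Q jn) mulKg; exact: certg_hz_prod.
- by rewrite subnKC.
- by apply/allP => x; rewrite mem_index_iota => /andP[_ xj]; rewrite (leq_trans xj jk).
Qed.

Lemma suffix_side j : k <= j <= n -> exists2 v, all (fun l => side k l == false) v & fpin v = Q j.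
Proof.
move=> /andP[kj jn].
apply: (survive (a := n - j) (a' := j) (i := j) (j := n)) => //.
- by rewrite jn leqnn.
- exact: certg_hz_prod.
(* The complement of a suffix is Q^-1 P Q, a conjugate of the prefix, and conjugation is free. *)
- rewrite -/c -(P_Q jn) mulgA.
  have := certgJ N1 NM NJ (Q j)^-1%g (certg_hz_prod 0 j).
  by rewrite subn0 invgK.
- by rewrite subnK.
- by apply/allP => x; rewrite mem_index_iota => /andP[jx _]; rewrite ltnNge (leq_trans kj jx).
Qed.

(** An entry is the quotient of two consecutive prefixes if it lies on the left, and of two
    consecutive suffixes if it lies on the right. *)
Theorem cox_stabilizer_split j : j < n ->
  exists2 v, all (fun l => (l.1 < k) == (j < k)) v & fpin v = hz bn gen j.
Proof.
move=> jn; have [jk|kj] := ltnP j k.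
  have [v vs vE] := prefix_side (ltnW jk); have [v' vs' vE'] := prefix_side jk.
  exists (winv v ++ v'); last first.
    by rewrite fpin_cat fpin_winv vE vE' /P big_nat_recr // mulKg.
  rewrite all_cat vs' andbT; apply/allP => l; rewrite mem_rev => /mapP[l' l'v ->].
  by have /allP/(_ _ l'v) := vs.
have jn' : k <= j <= n by rewrite kj ltnW.
have [v vs vE] := suffix_side jn'.
have [|v' vs' vE'] := suffix_side (j := j.+1); first by rewrite jn leqW.
exists (v ++ winv v'); last first.
  by rewrite fpin_cat fpin_winv vE vE' /Q [X in (X * _)%g]big_ltn // mulgK.
rewrite all_cat vs; apply/allP => l; rewrite mem_rev => /mapP[l' l'v ->].
by have /allP/(_ _ l'v) := vs'.
Qed.

End CoxeterStabilizer.

(** * Combing the first strand of a braid *)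

Section WordEvaluation.
Local Open Scope group_scope.
Context {G : groupType}.
Implicit Types (f : nat -> G) (u v w : word nat).

Definition eval f w : G := \prod_(l <- w) (if l.2 then (f l.1)^-1 else f l.1).

Lemma eval_cons f l w : eval f (l :: w) = (if l.2 then (f l.1)^-1 else f l.1) * eval f w.
Proof. exact: big_cons. Qed.

Lemma eval_cat f u v : eval f (u ++ v) = eval f u * eval f v.
Proof. exact: big_cat. Qed.

Lemma eval1 f i : eval f [:: (i, false)] = f i.
Proof. exact: big_seq1. Qed.

Lemma eval1V f i : eval f [:: (i, true)] = (f i)^-1.
Proof. exact: big_seq1. Qed.

Lemma eval_winv f w : eval f (winv w) = (eval f w)^-1.
Proof.
elim: w => [|[i e] w IH]; first by rewrite /eval big_nil invg1.
rewrite winv_cons eval_cat IH [in RHS]eval_cons invgM; congr (_ * _).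
by case: e; rewrite /= ?eval1 ?eval1V ?invgK.
Qed.

Lemma eval_peq f u v : peq free_rel u v -> eval f u = eval f v.
Proof.
elim=> {u v} [//|u v _ ->//|u v w _ -> _ ->//|u v i e|//].
by rewrite !eval_cat !eval_cons; case: e; rewrite /= ?mulKg ?mulVKg.
Qed.

Lemma eval_comm f x w : (forall l, l \in w -> commute x (f l.1)) -> commute x (eval f w).
Proof.
elim: w => [_|l w IH h]; first by rewrite /eval big_nil; exact: commute1.
rewrite eval_cons; apply: commuteM; last by apply: IH => l' l'w; apply: h; rewrite in_cons l'w orbT.
by case: l.2; [apply: commuteV|]; apply: h; rewrite mem_head.
Qed.

End WordEvaluation.

Section BraidIdentities.
Local Open Scope group_scope.
Variables (G : groupType) (s t a : G).
Hypothesis st : s * t * s = t * s * t.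
Hypothesis ta : commute t a.

Lemma braid_conj : s^-1 * t * s = t * s * t^-1.
Proof. by apply: (mulgI s); apply: (mulIg t); rewrite !mulgA mulgV mul1g mulgVK st. Qed.

Lemma braid_conjV : s * t^-1 * s^-1 = t^-1 * s^-1 * t.
Proof. by apply: (mulgI t); rewrite !mulgA mulgV mul1g -braid_conj mulgK. Qed.

Lemma braid_conjC : t * s^-1 * t^-1 = s^-1 * t^-1 * s.
Proof. by apply: invg_inj; rewrite !invgM !invgK !mulgA braid_conj. Qed.

(** When [a] is a loop, the right-hand element is the loop two steps further; this is the adjacent
    case of [loop_comm_low]. *)
Lemma braid_slide : commute s (t * (s * a * s^-1) * t^-1).
Proof.
have at' x : x * t * a = x * a * t by rewrite -!mulgA ta.
have stV x : x * t * s^-1 * t^-1 = x * s^-1 * t^-1 * s.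
  by rewrite -!mulgA [t * (s^-1 * _)]mulgA braid_conjC !mulgA.
by rewrite /commute !mulgA st at' stV.
Qed.

(** The inductive step of [loop_square], with neighbouring generators [s], [t] and a loop [a]. *)
Lemma braid_square : s * a * s * a = a * s * a * s ->
  t * (s * a * s^-1) * t * (s * a * s^-1) = s * a * s^-1 * t * (s * a * s^-1) * t.
Proof.
move=> sa.
have aV x : x * t^-1 * a = x * a * t^-1 by rewrite -!mulgA (commuteV (commute_sym ta)).
have at' x : x * a * t = x * t * a by rewrite -!mulgA ta.
have sa' x : x * s * a * s * a = x * a * s * a * s by have := congr1 (mulg x) sa; rewrite !mulgA.
have stV x : x * s * t^-1 * s^-1 = x * t^-1 * s^-1 * t by rewrite -!mulgA [s * (t^-1 * _)]mulgA braid_conjV !mulgA.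
have -> : t * (s * a * s^-1) * t * (s * a * s^-1) = t * s * a * (s^-1 * t * s) * a * s^-1.
  by rewrite !mulgA.
have -> : s * a * s^-1 * t * (s * a * s^-1) * t = s * a * (s^-1 * t * s) * a * s^-1 * t.
  by rewrite !mulgA.
by rewrite braid_conj !mulgA at' -st !aV sa' stV at'.
Qed.

End BraidIdentities.

Section Combing.
Local Open Scope group_scope.
Variables (G : groupType) (s : nat -> G) (m : nat).
Hypothesis s_braid : forall i, i.+1 < m -> s i * s i.+1 * s i = s i.+1 * s i * s i.+1.
Hypothesis s_comm : forall i j, i.+1 < j -> j < m -> commute (s i) (s j).

(** The braid that moves the first strand to position [j]: a coset representative for the stabilizer
    of the first position. *)
Fixpoint comb (j : nat) : G := if j is i.+1 then s i * comb i else 1.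

(* The pure braid in which the first strand winds around strand [j + 2]. *)
Fixpoint loop (j : nat) : G := if j is i.+1 then s j * loop i * (s j)^-1 else s 0 * s 0.

Lemma loopS j : loop j.+1 = s j.+1 * loop j * (s j.+1)^-1.
Proof. by []. Qed.

Lemma loop_comm_high i j : j.+1 < i -> i < m -> commute (s i) (loop j).
Proof.
elim: j => [|j IH] ji im /=.
  by apply: commuteM; apply/commute_sym/s_comm.
apply: commuteM; [apply: commuteM|apply: commuteV].
- exact/commute_sym/s_comm.
- by apply: IH => //; apply: ltnW.
- exact/commute_sym/s_comm.
Qed.

Lemma loop_comm_low i j : 0 < i < j -> j < m -> commute (s i) (loop j).
Proof.
elim: j => [|j IH] /andP[i0 ij] jm; first by [].
have [ij'|ij'] : i < j \/ i = j by lia.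
  rewrite /=; apply: commuteM; [apply: commuteM|apply: commuteV].
  - exact: s_comm.
  - by apply: IH; [rewrite i0|apply: ltnW].
  - exact: s_comm.
case: i i0 ij ij' jm {IH} => // i _ _ <- jm.
exact: braid_slide (s_braid jm) (loop_comm_high (ltnSn i.+1) jm).
Qed.

(** The braid relation of length four between a loop and the next generator; it rewrites the
    conjugates of loops by generators as words in loops. *)
Lemma loop_square i : i.+1 < m ->
  s i.+1 * loop i * s i.+1 * loop i = loop i * s i.+1 * loop i * s i.+1.
Proof.
elim: i => [|i IH] im; last first.
  exact: braid_square (s_braid im) (loop_comm_high (ltnSn i.+1) im) (IH (ltnW im)).
have e := s_braid im; rewrite /= !mulgA.
have e' x : x * s 0 * s 1 * s 0 = x * s 1 * s 0 * s 1 by have := congr1 (mulg x) e; rewrite !mulgA.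
have h : s 0 * s 1 * s 0 * s 0 * s 1 = s 1 * s 0 * s 0 * s 1 * s 0 by rewrite e -e'.
have h' x : x * s 0 * s 1 * s 0 * s 0 * s 1 = x * s 1 * s 0 * s 0 * s 1 * s 0.
  by have := congr1 (mulg x) h; rewrite !mulgA.
by rewrite h' h.
Qed.

Definition generated (f : nat -> G) p (g : G) : Prop :=
  exists2 w, all (fun l => l.1 < p) w & g = eval f w.

Lemma generatedM f p g h : generated f p g -> generated f p h -> generated f p (g * h).
Proof.
by move=> [u us ->] [v vs ->]; exists (u ++ v); rewrite ?all_cat ?us ?eval_cat.
Qed.

Lemma generatedV f p g : generated f p g -> generated f p g^-1.
Proof.
move=> [u us ->]; exists (winv u); rewrite ?eval_winv //.
by apply/allP => l; rewrite mem_rev => /mapP[l' l'u ->]; have /allP/(_ _ l'u) := us.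
Qed.

Lemma generated1 f p : generated f p 1.
Proof. by exists [::]; rewrite // /eval big_nil. Qed.

Lemma generated_gen f p i : i < p -> generated f p (f i).
Proof. by move=> ip; exists [:: (i, false)]; rewrite /= ?ip ?eval1. Qed.

Lemma generated_ind f p (Q : G -> Prop) : Q 1 ->
  (forall i g, i < p -> Q g -> Q (f i * g)) ->
  (forall i g, i < p -> Q g -> Q ((f i)^-1 * g)) ->
  forall g, generated f p g -> Q g.
Proof.
move=> Q1 QM QV g [w + ->]; elim: w => [|[i e] w IH] /=; first by rewrite /eval big_nil.
by move=> /andP[ip /IH]; rewrite eval_cons; case: e => /=; [apply: QV|apply: QM].
Qed.

Local Notation loops := (generated loop m).
Local Notation shifted := (generated (fun i => s i.+1) m.-1).

Lemma loops_conj_gen x : (forall j, j < m -> loops (x * loop j * x^-1)) ->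
  forall g, loops g -> loops (x * g * x^-1).
Proof.
move=> hx; apply: generated_ind => [|j g jm IH|j g jm IH].
- by rewrite mulg1 mulgV; apply: generated1.
- have -> : x * (loop j * g) * x^-1 = x * loop j * x^-1 * (x * g * x^-1).
    by rewrite !mulgA mulgVK.
  by apply: generatedM => //; apply: hx.
- have -> : x * ((loop j)^-1 * g) * x^-1 = (x * loop j * x^-1)^-1 * (x * g * x^-1).
    by rewrite !invgM invgK !mulgA mulgVK.
  by apply: generatedM => //; apply/generatedV/hx.
Qed.

Lemma loop_conj_cases i j : 0 < i -> i < m -> j < m ->
  [\/ commute (s i) (loop j), i = j | i = j.+1].
Proof.
move=> i0 im jm; case: (ltngtP i j) => [ij|ji|->]; last by constructor 2.
  by constructor 1; apply: loop_comm_low; rewrite ?i0.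
have [->|ne] := eqVneq i j.+1; first by constructor 3.
by constructor 1; apply: loop_comm_high => //; rewrite ltn_neqAle eq_sym ne.
Qed.

Lemma loops_conj i : 0 < i -> i < m -> forall g, loops g -> loops (s i * g * (s i)^-1).
Proof.
move=> i0 im; apply: loops_conj_gen => j jm.
case: (loop_conj_cases i0 im jm) => [c|e|e].
- by rewrite c mulgK; apply: generated_gen.
- subst j; case: i i0 im jm => // i _ im _.
  have -> : s i.+1 * loop i.+1 * (s i.+1)^-1 = (loop i.+1)^-1 * loop i * loop i.+1.
    apply: (mulgI (loop i.+1)); apply: (mulIg (s i.+1)).
    have := loop_square im; have := loopS i; move: (loop i.+1) (loop i) => _ x -> e.
    by rewrite !mulgA mulgV mul1g !mulgVK e mulgK.
  apply: generatedM; last by apply: generated_gen.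
  by apply: generatedM; [apply: generatedV|]; apply: generated_gen => //; apply: ltnW.
- by rewrite e -/(loop j.+1); apply: generated_gen; rewrite -e.
Qed.

Lemma loops_conjV i : 0 < i -> i < m -> forall g, loops g -> loops ((s i)^-1 * g * s i).
Proof.
move=> i0 im g lg; rewrite -[X in _ * X]invgK; move: g lg; apply: loops_conj_gen => j jm.
rewrite invgK; case: (loop_conj_cases i0 im jm) => [c|e|e].
- by rewrite -mulgA -c mulKg; apply: generated_gen.
- subst j; case: i i0 im jm => // i _ im _.
  by rewrite loopS !mulgA mulVg mul1g mulgVK; apply: generated_gen; apply: ltnW.
- subst i; have -> : (s j.+1)^-1 * loop j * s j.+1 = loop j * loop j.+1 * (loop j)^-1.
    apply: (mulgI (s j.+1)); apply: (mulIg (loop j)).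
    have := loop_square im; have := loopS j; move: (loop j.+1) (loop j) => _ x -> e.
    by rewrite !mulgA mulgV mul1g mulgVK e mulgK.
  by apply: generatedM; [apply: generatedM|apply: generatedV]; apply: generated_gen.
Qed.

(** In the braid group this is the stabilizer of the first strand, made of braids of the other
    strands and loops of the first. *)
Definition tail_loops g : Prop := exists b g', [/\ shifted b, loops g' & g = b * g'].

(** Shifted generators normalize the loops, so b x c y = (b c) (c^-1 x c y). *)
Lemma tail_loopsM g h : tail_loops g -> tail_loops h -> tail_loops (g * h).
Proof.
move=> [b [x [sb lx ->]]] [c [y [sc ly ->]]].
exists (b * c), (c^-1 * x * c * y); split; last by rewrite !mulgA mulgK.
  exact: generatedM.
apply: generatedM => //; move: c sc x lx {y ly}; apply: generated_ind => [x lx|i c im IH x lx|i c im IH x lx].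
- by rewrite invg1 mul1g mulg1.
- rewrite (_ : _ * _ = c^-1 * ((s i.+1)^-1 * x * s i.+1) * c); last by rewrite invgM !mulgA.
  apply: IH; apply: loops_conjV => //; lia.
- rewrite (_ : _ * _ = c^-1 * (s i.+1 * x * (s i.+1)^-1) * c); last by rewrite invgM invgK !mulgA.
  apply: IH; apply: loops_conj => //; lia.
Qed.

Lemma tail_loops_loop j : j < m -> tail_loops (loop j).
Proof. by move=> jm; exists 1, (loop j); rewrite mul1g; split=> //; [exact: generated1|exact: generated_gen]. Qed.

Lemma tail_loopsV_loop j : j < m -> tail_loops (loop j)^-1.
Proof.
by move=> jm; exists 1, (loop j)^-1; rewrite mul1g; split=> //; [exact: generated1|apply/generatedV/generated_gen].
Qed.

Lemma tail_loops_s i : i.+1 < m -> tail_loops (s i.+1).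
Proof.
move=> im; exists (s i.+1), 1; rewrite mulg1; split=> //; last exact: generated1.
by apply: (@generated_gen (fun i => s i.+1)); lia.
Qed.

Lemma tail_loopsV_s i : i.+1 < m -> tail_loops (s i.+1)^-1.
Proof.
move=> im; exists (s i.+1)^-1, 1; rewrite mulg1; split=> //; last exact: generated1.
by apply/generatedV/(@generated_gen (fun i => s i.+1)); lia.
Qed.

Lemma comb_high i j : j < i -> i < m -> s i * comb j = comb j * s i.
Proof.
move=> ji im; elim: j ji => [|j IH] ji /=; first by rewrite mulg1 mul1g.
by rewrite mulgA -(s_comm ji im) -!mulgA IH // ltnW.
Qed.

Lemma comb_square j : j < m -> s j * s j * comb j = comb j * loop j.
Proof.
elim: j => [|j IH] jm; first by rewrite /= mulg1 mul1g.
have {IH}e := IH (ltnW jm); have c := comb_high (ltnSn j) jm; have st := s_braid jm.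
rewrite /= -!/(comb j) -!/(loop j); move: (comb j) (loop j) e c => x y e c.
have -> : s j * x * (s j.+1 * y * (s j.+1)^-1) = s j * (x * s j.+1) * y * (s j.+1)^-1.
  by rewrite !mulgA.
rewrite -c !mulgA -(mulgA _ x y) -e !mulgA st -(mulgA _ x) (commuteV (commute_sym c)) !mulgA.
congr (_ * x); apply: (mulIg (s j.+1)); rewrite mulgVK -!mulgA (mulgA (s j.+1) (s j)) -st !mulgA.
by rewrite -st.
Qed.

Lemma comb_low i j : i.+1 < j -> j <= m -> s i * comb j = comb j * s i.+1.
Proof.
elim: j => // j IH ij jm; have [ij'|ij'] : i.+1 < j \/ j = i.+1 by lia.
  by rewrite /= mulgA (s_comm ij') // -!mulgA IH // ltnW.
rewrite ij' in jm *; rewrite /= !mulgA s_braid // -!mulgA.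
by congr (_ * (_ * _)); apply: comb_high.
Qed.

(** A generator on the left permutes the representatives [comb j] up to a tail; a loop appears only
    when the generator moves the first strand against the direction of its crossing. *)
Theorem combing w : all (fun l => l.1 < m) w ->
  exists j g, [/\ j <= m, tail_loops g & eval s w = comb j * g].
Proof.
elim: w => [_|[i e] w IH] /=.
  exists 0, 1; split=> //; last by rewrite /eval big_nil mul1g.
  by exists 1, 1; rewrite mulg1; split=> //; exact: generated1.
move=> /andP[im /IH[j [g [jm tg e']]]]; rewrite eval_cons /= {}e' mulgA.
suff [j' [p [j'm tp ->]]] : exists j' p, [/\ j' <= m, tail_loops p & 
    (if e then (s i)^-1 else s i) * comb j = comb j' * p].
  by exists j', (p * g); rewrite mulgA; split=> //; exact: tail_loopsM.
case: (ltngtP i j) => ij.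
- have [ij'|ij'] : i.+1 < j \/ j = i.+1 by lia.
    have im' : i.+1 < m by apply: leq_trans jm.
    exists j, (if e then (s i.+1)^-1 else s i.+1); split=> //.
      by case: e; [apply: tail_loopsV_s|apply: tail_loops_s].
    case: e; last exact: comb_low.
    by apply: (mulgI (s i)); rewrite mulVKg mulgA comb_low // mulgK.
  subst j; case: e; rewrite /= ?mulKg.
    exists i, 1; rewrite mulg1; split=> //; first exact: ltnW.
    by exists 1, 1; rewrite mulg1; split=> //; exact: generated1.
  exists i, (loop i); split; [exact: ltnW|exact: tail_loops_loop|].
  by rewrite mulgA comb_square.
- case: i im ij => // i im ij.
  exists j, (if e then (s i.+1)^-1 else s i.+1); split=> //.
    by case: e; [apply: tail_loopsV_s|apply: tail_loops_s].
  case: e; last exact: comb_high.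
  by apply: (mulgI (s i.+1)); rewrite mulVKg mulgA comb_high // mulgK.
- subst j; case: e; last first.
    exists i.+1, 1; rewrite mulg1; split=> //.
    by exists 1, 1; rewrite mulg1; split=> //; exact: generated1.
  exists i.+1, (loop i)^-1; split=> //; first exact: tail_loopsV_loop.
  by apply: (mulIg (loop i)); rewrite mulgVK -mulgA -comb_square // -!mulgA mulKg.
Qed.

End Combing.

(** * Braids preserving a splitting of the free generators *)

Section ForgetFirst.
Local Open Scope group_scope.

(** The surviving generators are renumbered from 0, in step with a braid whose first strand is
    removed. *)
Definition forget_word : word nat -> word nat :=
  omap_word (fun i => if i is j.+1 then Some j else None).

Definition forget : free_group -> free_group :=
  presmap (R := free_rel) free_rel (fun i => if i is j.+1 then Some j else None).

Lemma forget_fpin w : forget (fpin w) = fpin (forget_word w).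
Proof. by apply: presmap_pin => x y []. Qed.

Lemma forgetM g h : forget (g * h) = forget g * forget h.
Proof. by apply: presmapM => x y []. Qed.

Lemma forget1 : forget 1 = 1.
Proof. by apply: presmap1 => x y []. Qed.

Lemma forgetV g : forget g^-1 = (forget g)^-1.
Proof. by apply: presmapV => x y []. Qed.

Lemma forget_gen0 : forget (gen 0) = 1.
Proof. exact: forget_fpin. Qed.

Lemma forget_genS i : forget (gen i.+1) = gen i.
Proof. exact: forget_fpin. Qed.

Lemma forget_hz b t : (fun j => forget (hz b t j)) =1 hz b (fun j => forget (t j)).
Proof. exact: hz_morph forgetM forgetV. Qed.

(* Signed number of occurrences of the first generator in [u] whose left
   context becomes [h] when the first generator is forgotten. *)
Fixpoint count_at (h : free_group) (u : word nat) : int :=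
  if u is (i, e) :: u' then
    if i is j.+1 then count_at ((fpin [:: (j, e)])^-1 * h)%g u'
    else ((if h == 1%g then (-1) ^+ e else 0) + count_at h u')%R
  else 0%R.

Lemma count_at_cat h u v :
  count_at h (u ++ v) = (count_at h u + count_at ((fpin (forget_word u))^-1 * h)%g v)%R.
Proof.
elim: u h => [|[[|j] e] u IH] h /=.
- by rewrite invg1 mul1g GRing.add0r.
- by rewrite IH GRing.addrA.
- by rewrite IH [fpin ((j, e) :: forget_word u)]fpin_cons invgM mulgA.
Qed.

(** In a cancelling pair of first generators both letters have the same left context and opposite
    signs. *)
Lemma count_at_peq h u v : peq free_rel u v -> count_at h u = count_at h v.
Proof.
move=> uv; elim: uv h => {u v} [//|u v _ IH|u v w _ IH1 _ IH2|u v i e|//] h.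
- by rewrite IH.
- by rewrite IH1.
- rewrite !count_at_cat; congr (_ + _)%R.
  case: i => [|j] /=; last by rewrite (fpin_inv (j, e)) invgK mulVKg.
  rewrite GRing.addrA; case: ifP => _; rewrite ?GRing.addr0 ?GRing.add0r //.
  by case: e; rewrite /= ?GRing.expr0 ?GRing.expr1 ?GRing.addNr ?GRing.subrr GRing.add0r.
Qed.

Lemma count_at_occurs h u : count_at h u != 0%R ->
  exists u1 e u2, u = u1 ++ (0, e) :: u2 /\ fpin (forget_word u1) = h.
Proof.
elim: u h => [//|[[|j] e] u IH] h /=.
  case: (h =P 1) => [->|_]; first by exists [::], e, u.
  rewrite GRing.add0r => /IH[u1 [e' [u2 [-> <-]]]].
  by exists ((0, e) :: u1), e', u2.
move=> /IH[u1 [e' [u2 [-> h']]]]; exists ((j.+1, e) :: u1), e', u2; split=> //.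
by rewrite /= [fpin ((j, e) :: forget_word u1)]fpin_cons h' mulVKg.
Qed.

(** In the count at [forget V] the letters of [V] and its inverse cancel and the middle letter
    contributes 1; as the count is invariant, every word for the element has such an occurrence. *)
Lemma conj_gen0_occurs u V : fpin u = V * gen 0 * V^-1 ->
  exists u1 e u2, u = u1 ++ (0, e) :: u2 /\ fpin (forget_word u1) = forget V.
Proof.
elim/free_ind: V => v; rewrite forget_fpin => uE.
have {uE} /pinP uv : fpin u = fpin (v ++ (0, false) :: winv v).
  by rewrite uE fpin_cat (fpin_cons (0, false)) fpin_winv mulgA.
apply: count_at_occurs; rewrite (count_at_peq _ uv) count_at_cat mulVg /= eqxx.
have := count_at_peq (fpin (forget_word v)) (peq_mulwV free_rel v).
rewrite count_at_cat mulVg /= => e.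
by rewrite GRing.addrCA e.
Qed.

End ForgetFirst.

(** * Combs and loops acting on the free group *)

Section CombingWords.
Local Open Scope group_scope.

Fixpoint comb_word (j : nat) : word nat := if j is i.+1 then (i, false) :: comb_word i else [::].

Fixpoint loop_word (j : nat) : word nat :=
  if j is i.+1 then (j, false) :: loop_word i ++ [:: (j, true)] else [:: (0, false); (0, false)].

Definition loop_letter (l : nat * bool) : word nat :=
  if l.2 then winv (loop_word l.1) else loop_word l.1.

Definition loops_word (w : word nat) : word nat := flatten (map loop_letter w).

Lemma loop_letterS j e : loop_letter (j.+1, e) = (j.+1, false) :: loop_letter (j, e) ++ [:: (j.+1, true)].
Proof.
rewrite /loop_letter; case: e => //=.
by rewrite winv_cons winv_cat.
Qed.

(** The outer letters of the next loop bring the encircled entry one place closer and put it back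
    afterwards, which reduces the claim to the previous loop. *)
Lemma hz_loop_letter j e (t : nat -> free_group) : forget (t 0) = 1 ->
  (exists2 c, hz (loop_letter (j, e)) t 0 = c * t 0 * c^-1 &
     forget c = (if e then (forget (t j.+1))^-1 else forget (t j.+1))) /\
  (forall i, forget (hz (loop_letter (j, e)) t i) = forget (t i)).
Proof.
elim: j t => [|j IH] t t0.
  split; last first.
    move=> i; rewrite forget_hz; set f := fun j => forget (t j); rewrite -[RHS]/(f i).
    have : f 0 = 1 := t0; move: f => f f0.
    by case: e; case: i => [|[|i]]; rewrite /loop_letter /= /hstep /= ;
      do ?rewrite (f0, invg1, mulg1, mul1g, mulgV, mulVg).
  case: e; rewrite /loop_letter /= /hstep /=.
    by exists (t 1%N)^-1; rewrite ?invgK ?forgetV.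
  exists (t 0 * t 1%N); first by rewrite !invgM invgK !mulgA mulgVK.
  by rewrite forgetM t0 mul1g.
rewrite loop_letterS /= hz_cat /=; set t' := hstep _ t.
have t'0 : forget (t' 0) = 1 by [].
have [[c hc fc] hf] := IH t' t'0; split.
  exists c; first by rewrite /hstep /= hc.
  by rewrite fc /t' /hstep /= eqxx.
move=> i; have := hstepK j.+1 false (fun i => forget (t i)) i; rewrite -[RHS]/(forget (t i)) => <-.
have e1 := forget_hz [:: (j.+1, false)] (hz (loop_letter (j, e)) t') i.
rewrite /= in e1; rewrite e1; apply: hstep_ext => x; rewrite hf.
exact: forget_hz [:: (j.+1, true)] t x.
Qed.

(** The word [w] is recovered, as a free group element, from the image of the first generator. *)
Lemma hz_loops_word w :
  (exists2 V, hz (loops_word w) gen 0 = V * gen 0 * V^-1 & forget V = fpin w) /\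
  (forall i, forget (hz (loops_word w) gen i) = forget (gen i)).
Proof.
elim: w => [|[j e] w [[V hV fV] hf]].
  by split=> //; exists 1; rewrite ?forget1 // mul1g invg1 mulg1.
rewrite /loops_word /= hz_cat -/(loops_word w); set t := hz (loops_word w) gen.
have t0 : forget (t 0) = 1 by rewrite hf forget_gen0.
have [[c hc fc] hf'] := hz_loop_letter j e t0; split; last by move=> i; rewrite hf' hf.
exists (c * V); first by rewrite hc /t hV invgM !mulgA.
rewrite forgetM fc fV hf forget_genS (fpin_cons (j, e)); congr (_ * _).
by case: e {hc fc hf'}; rewrite // (fpin_inv (j, false)).
Qed.

Lemma hz_comb_word j (t : nat -> free_group) i :
  hz (comb_word j) t i = if i < j then t 0 * t i.+1 * (t 0)^-1 else if i == j then t 0 else t i.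
Proof.
elim: j i => [|j IH] i /=; first by case: i.
have e1 : (j.+1 < j) = false by lia.
have e2 : (j.+1 == j) = false by lia.
rewrite /hstep /= !IH ltnn eqxx e1 e2.
case: (ltngtP i j) => [ij|ji|->]; last by rewrite ltnSn.
  by rewrite ltnW // (_ : (i == j.+1) = false) //; lia.
case: (i =P j.+1) => [->|ne]; first by rewrite ltnn.
by rewrite (_ : (i < j.+1) = false) //; lia.
Qed.

End CombingWords.

Lemma peq_of_rel {A : Type} (R : word A -> word A -> Prop) x y : R x y -> peq R x y.
Proof. by move=> xy; have := @peq_rel _ R [::] [::] x y xy; rewrite /= !cats0. Qed.

(** * Combing in the braid group *)

Section BraidWords.
Local Open Scope group_scope.
Variable n : nat.
Local Notation R := (braid_nat n).

Definition sigma (i : nat) : pgroup R := pin R [:: (i, false)].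

Lemma sigma_braid i : (i.+1 < n.-1)%N -> sigma i * sigma i.+1 * sigma i = sigma i.+1 * sigma i * sigma i.+1.
Proof.
move=> im; rewrite /sigma -!pin_cat; apply/pinP.
by apply: peq_of_rel; exists i, i.+1; split=> //; left.
Qed.

Lemma sigma_comm i j : (i.+1 < j)%N -> (j < n.-1)%N -> commute (sigma i) (sigma j).
Proof.
move=> ij jm; rewrite /commute /sigma -!pin_cat; apply/pinP.
by apply: peq_of_rel; exists i, j; split=> //; right.
Qed.

Lemma pin_eval w : pin R w = eval sigma w.
Proof.
elim: w => [|[i e] w IH]; first by rewrite /eval big_nil.
by rewrite pin_cons IH eval_cons; case: e => //; rewrite pin_inv.
Qed.

Lemma pin_shift w : pin R (shiftw 1 w) = eval (fun i => sigma i.+1) w.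
Proof. by rewrite pin_eval /eval /shiftw /map_word big_map. Qed.

Lemma pin_comb_word j : pin R (comb_word j) = comb sigma j.
Proof. by elim: j => //= j <-; rewrite pin_cons. Qed.

Lemma pin_loop_word j : pin R (loop_word j) = loop sigma j.
Proof.
elim: j => [|j IH]; first by rewrite /= pin_cons.
by rewrite loopS -IH /= pin_cons pin_cat (pin_inv _ j.+1) mulgA.
Qed.

Lemma pin_loops_word w : pin R (loops_word w) = eval (loop sigma) w.
Proof.
elim: w => [|[j e] w IH]; first by rewrite /eval big_nil.
rewrite /loops_word /= pin_cat IH eval_cons /loop_letter; congr (_ * _).
by case: e; rewrite /= ?pin_winv pin_loop_word.
Qed.

Lemma peq_loops_word u v : peq free_rel u v -> peq R (loops_word u) (loops_word v).
Proof. by move=> uv; apply/pinP; rewrite !pin_loops_word; apply: eval_peq. Qed.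

Lemma braid_combing b : all (fun l => (l.1 < n.-1)%N) b ->
  exists j b' w, [/\ (j <= n.-1)%N, all (fun l => (l.1 < n.-2)%N) b' &
    peq R b (comb_word j ++ shiftw 1 b' ++ loops_word w)].
Proof.
move=> bs.
have [j [_ [jn [_ [_ [[b' b's ->] [w _ ->] ->]]] e]]] := combing sigma_braid sigma_comm bs.
exists j, b', w; split=> //; apply/pinP.
by rewrite !pin_cat pin_comb_word pin_shift pin_loops_word pin_eval.
Qed.

Lemma peq_far_comm u v : (forall x y, x \in u -> y \in v -> x.1.+1 < y.1 < n.-1)%N ->
  peq R (u ++ v) (v ++ u).
Proof.
move=> uv; apply/pinP; rewrite !pin_cat; apply/commute_sym.
rewrite !pin_eval; apply: eval_comm => x xu; apply/commute_sym/eval_comm => y yv.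
by have /andP[xy ym] := uv x y xu yv; apply: sigma_comm.
Qed.

End BraidWords.

Lemma forget_side k t v : all (fun l => (l.1 < k.+1) == t) v -> all (fun l => (l.1 < k) == t) (forget_word v).
Proof. by elim: v => //= -[[|i] e] v IH /andP[/= it /IH //]; rewrite /= => ->; rewrite andbT. Qed.

Lemma peq_shift n u v : peq (braid_nat n) u v -> peq (braid_nat n.+1) (shiftw 1 u) (shiftw 1 v).
Proof.
rewrite /shiftw !map_word_omap; apply: peq_omap => x y [i [j [jn h]]].
apply: peq_of_rel; exists i.+1, j.+1; split; first by rewrite /=; lia.
by case: h => [[<- [-> ->]]|[ij [-> ->]]]; [left|right].
Qed.

Lemma loops_word_bound k w : all (fun l => l.1 < k) w -> all (fun l => l.1 < k) (loops_word w).
Proof.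
have lb j : all (fun l => l.1 < j.+1) (loop_word j).
  elim: j => //= j IH; rewrite ltnSn all_cat /= ltnSn !andbT.
  by apply: (sub_all _ IH) => l /ltnW.
elim: w => //= -[j e] w IH /andP[/= jk /IH{}IH]; rewrite /loops_word /= all_cat IH andbT.
have {}lb : all (fun l => l.1 < k) (loop_word j) by apply: (sub_all _ (lb j)) => l lj; apply: leq_trans jk.
rewrite /loop_letter; case: e => //=; apply/allP => l.
by rewrite mem_rev => /mapP[l' l'w ->]; have /allP/(_ _ l'w) := lb.
Qed.

Definition split_entries (k n : nat) (b : word nat) : Prop := forall i, i < n ->
  exists2 v, all (fun l => (l.1 < k) == (i < k)) v & fpin v = hz b gen i.

Theorem braid_split k l b : all (fun x => x.1 < (k + l).-1) b -> split_entries k (k + l) b ->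
  exists b1 b2, [/\ all (fun x => x.1 < k.-1) b1, all (fun x => k <= x.1 < (k + l).-1) b2 &
    peq (braid_nat (k + l)) b (b1 ++ b2)].
Proof.
elim: k b => [|k IH] b bs bT; first by exists [::], b; split=> //; exact: peq_refl.
have [j [b' [w [jn b's bE]]]] := braid_combing bs.
have bT' i : i < k.+1 + l -> exists2 v, all (fun l => (l.1 < k.+1) == (i < k.+1)) v &
    fpin v = hz (comb_word j ++ shiftw 1 b' ++ loops_word w) gen i.
  by move=> /bT[v vs vE]; exists v => //; rewrite vE (hz_peq _ bE).
have {bT} [[V hV fV] hf] := hz_loops_word w; set t := hz (loops_word w) gen in hV hf.
set y := hz b' (fun i => t i.+1).
have {bT'} bT' i : i < k.+1 + l -> exists2 v, all (fun l => (l.1 < k.+1) == (i < k.+1)) v & fpin v =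
  if i < j then (t 0 * y i * (t 0)^-1)%g else if i == j then t 0 else y i.-1.
  move=> /bT'[v vs vE]; exists v => //; rewrite vE !hz_cat hz_comb_word -/t.
  rewrite hz_shift_lt // (hz_shift 1 b' t i); case: ltngtP => // ji.
  by rewrite -(prednK (leq_ltn_trans (leq0n j) ji)) (hz_shift 1 b' t).
have jkl : j < k.+1 + l by lia.
(* Entry [j] is a conjugate of the first generator, so [v] contains the letter 0. This puts [j] on
   the left side, and the part of [v] before that letter spells the loops with left generators
   only. *)
have [v vs] := bT' j jkl; rewrite ltnn eqxx hV => /conj_gen0_occurs[u1 [e [u2 [vE u1E]]]].
have {vs} vs : j <= k /\ all (fun l => l.1 < k.+1) u1.
  move: vs; rewrite vE all_cat /= => /and3P[u1s /eqP ej _].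
  by rewrite -ltnS -ej; split=> //; apply: sub_all u1s => x; rewrite -ej eqb_id.
have [jk u1s] := vs.
pose w0 := forget_word u1.
have w0s : all (fun x => x.1 < k) w0.
  have := @forget_side k true u1; rewrite (@eq_all _ _ (fun x => x.1 < k.+1)); last by move=> x; rewrite eqb_id.
  by move=> /(_ u1s); apply: sub_all => x; rewrite eqb_id.
have ww0 : peq (braid_nat (k.+1 + l)) (loops_word w) (loops_word w0).
  by apply: peq_loops_word; apply/pinP; rewrite -!/(fpin _) -fV -u1E.
(* Forgetting the first generator erases comb and loops from the entries, up to the shift of indices
   past [j], so [b'] inherits the splitting. *)
have [b1 [b2 [b1s b2s b'E]]] : exists b1 b2, [/\ all (fun x => x.1 < k.-1) b1, 
    all (fun x => k <= x.1 < (k + l).-1) b2 & peq (braid_nat (k + l)) b' (b1 ++ b2)].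
  apply: IH => // i ikl.
  have yE : forget (hz b' (fun i => t i.+1) i) = hz b' gen i.
    by rewrite forget_hz; apply: hz_ext => x; rewrite hf forget_genS.
  have [ij|ij] := ltnP i j.
    have [|v' v's] := bT' i; first by lia.
    rewrite ij => v'E; exists (forget_word v'); last first.
      by rewrite -forget_fpin v'E !forgetM forgetV hf forget_gen0 invg1 mulg1 mul1g.
    have ik : i < k by apply: leq_trans ij jk.
    by move: v's; rewrite ik (ltnW ik : i < k.+1); apply: forget_side.
  have [|v' v's] := bT' i.+1; first by lia.
  rewrite ltnNge (leqW ij) /= gtn_eqF ?ltnS // => v'E.
  exists (forget_word v'); last by rewrite -forget_fpin v'E.
  exact: forget_side.
exists (comb_word j ++ shiftw 1 b1 ++ loops_word w0), (shiftw 1 b2); split.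
- rewrite !all_cat loops_word_bound // andbT; apply/andP; split.
    by elim: (j) jk => //= i IHi ik; rewrite ik IHi // ltnW.
  by apply/allP => x /mapP[x' x'b ->] /=; have /allP/(_ _ x'b) := b1s; lia.
- by apply/allP => x /mapP[x' x'b ->] /=; have /allP/(_ _ x'b) := b2s; lia.
- apply: peq_trans bE _; rewrite -catA; apply: peq_catl.
  apply: peq_trans (peq_catl _ ww0) _.
  apply: peq_trans (peq_catr _ (peq_shift b'E)) _.
  (* The loops of [w0] use indices below [k], the shifted [b2] indices above [k], so they
     commute. *)
  rewrite shiftw_cat -!catA; apply: peq_catl; apply: peq_sym; apply: peq_far_comm => x x2 xw /mapP[x' x'b ->] /=.
  have /allP/(_ _ x'b) := b2s; have /allP/(_ _ xw) := loops_word_bound w0s; lia.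
Qed.

(** * Stabilizers in a free product *)

Section Stabilizers.
Local Open Scope group_scope.

Definition pgens n (R : word 'I_n -> word 'I_n -> Prop) (j : nat) : pgroup R :=
  pin R (nth [::] (gens n) j).

Lemma pgensE n (R : word 'I_n -> word 'I_n -> Prop) (j : 'I_n) :
  pgens R j = pin R [:: (j, false)].
Proof. by rewrite /pgens nth_gens. Qed.

Lemma stabilizesP n (R : word 'I_n -> word 'I_n -> Prop) (b : word 'I_(n.-1)) :
  stabilizes R (gens n) b <->
  (forall i, (i < n)%N -> hz (map_word val b) (pgens R) i = pgens R i).
Proof.
rewrite /stabilizes size_map size_enum_ord; split=> h i i_n.
  by rewrite -pin_hurwitz; apply/pinP/h.
by apply/pinP; rewrite pin_hurwitz; apply: h.
Qed.

Lemma braid_eq_nat n (b b' : word 'I_(n.-1)) : braid_eq (p := n) b b' ->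
  peq (braid_nat n) (map_word val b) (map_word val b').
Proof.
rewrite !map_word_omap; apply: peq_omap => x y [i [j h]].
apply: peq_of_rel; exists (val i), (val j); split; first exact: ltn_ord.
by case: h => [[ij [-> ->]]|[ij [-> ->]]]; [left|right].
Qed.

Lemma stabilizes_braid_eq n (R : word 'I_n -> word 'I_n -> Prop) b b' :
  braid_eq (p := n) b b' -> stabilizes R (gens n) b <-> stabilizes R (gens n) b'.
Proof.
move=> /braid_eq_nat e; have eh := hz_peq (pgens R) e.
by rewrite !stabilizesP; split=> h i i_n; rewrite -(h i i_n) eh.
Qed.

Lemma fixed_presmap (A B : choiceType) R R' (f : A -> option B) p (w : word nat)
    (t : nat -> pgroup R) (t' : nat -> pgroup R') :
  (forall x y, R x y -> peq R' (omap_word f x) (omap_word f y)) ->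
  all (fun l => (l.1 < p.-1)%N) w -> (forall i, (i < p)%N -> presmap R' f (t i) = t' i) ->
  (forall i, (i < p)%N -> hz w t i = t i) -> forall i, (i < p)%N -> hz w t' i = t' i.
Proof.
move=> fR wp tt' wt i ip; rewrite -(tt' i ip) -(wt i ip).
rewrite (hz_morph _ _ (presmapM fR) (presmapV fR)).
by apply: (hz_local wp) => // j jp; rewrite tt'.
Qed.

Variables (k l : nat) (R : word 'I_(k + l) -> word 'I_(k + l) -> Prop).
Variables (R1 : word 'I_k -> word 'I_k -> Prop) (R2 : word 'I_l -> word 'I_l -> Prop).

Definition projL (i : 'I_(k + l)) : option 'I_k := if split i is inl a then Some a else None.
Definition projR (i : 'I_(k + l)) : option 'I_l := if split i is inr a then Some a else None.
Definition injL (i : 'I_k) : option 'I_(k + l) := Some (lshift l i).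
Definition injR (i : 'I_l) : option 'I_(k + l) := Some (rshift k i).

Hypothesis RL : forall x y, R x y -> peq R1 (omap_word projL x) (omap_word projL y).
Hypothesis RR : forall x y, R x y -> peq R2 (omap_word projR x) (omap_word projR y).
Hypothesis R1R : forall x y, R1 x y -> peq R (omap_word injL x) (omap_word injL y).
Hypothesis R2R : forall x y, R2 x y -> peq R (omap_word injR x) (omap_word injR y).

Lemma map_word_emb (b1 : word 'I_(k.-1)) (b2 : word 'I_(l.-1)) :
  map_word val (map_word (@embL k l) b1 ++ map_word (@embR k l) b2) =
  map_word val b1 ++ shiftw k (map_word val b2).
Proof. by rewrite /shiftw /map_word map_cat -!map_comp. Qed.

Lemma map_val_bound n (b : word 'I_n) : all (fun l => (l.1 < n)%N) (map_word val b).
Proof. by apply/allP => x /mapP[[i e] _ ->] /=. Qed.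

Lemma splitL (i : 'I_k) : split (lshift l i) = inl i.
Proof. exact: (unsplitK (inl i)). Qed.

Lemma splitR (i : 'I_l) : split (rshift k i) = inr i.
Proof. exact: (unsplitK (inr i)). Qed.

Lemma pgensL i (ik : (i < k)%N) : pgens R i = pin R [:: (lshift l (Ordinal ik), false)].
Proof. by rewrite -pgensE. Qed.

Lemma pgensR i (il : (i < l)%N) : pgens R (k + i) = pin R [:: (rshift k (Ordinal il), false)].
Proof. by rewrite -pgensE. Qed.

(** The injections carry the fixed-point equations of the factors into the product, and the
    retractions carry them back. *)
Theorem stabilizes_free_product (b1 : word 'I_(k.-1)) (b2 : word 'I_(l.-1)) :
  stabilizes R (gens (k + l)) (map_word (@embL k l) b1 ++ map_word (@embR k l) b2) <->
  stabilizes R1 (gens k) b1 /\ stabilizes R2 (gens l) b2.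
Proof.
rewrite !stabilizesP map_word_emb.
have b1s := map_val_bound b1; have b2s := map_val_bound b2.
move: (map_word val b1) (map_word val b2) b1s b2s => w1 w2 w1s w2s.
have hL i : (i < k)%N -> hz (w1 ++ shiftw k w2) (pgens R) i = hz w1 (pgens R) i.
  by rewrite hz_cat; apply: hz_local => // j jk; rewrite hz_shift_lt.
have hR i : hz (w1 ++ shiftw k w2) (pgens R) (k + i) = hz w2 (fun j => pgens R (k + j)) i.
  rewrite hz_cat hz_out ?hz_shift //.
  by apply/allP => x /(allP w1s) /= xk; apply/andP; split; lia.
have tL i (ik : (i < k)%N) : presmap R1 projL (pgens R i) = pgens R1 i.
  by rewrite pgensL (presmap_pin RL) (pgensE _ (Ordinal ik)) /omap_word /= /projL splitL.
have tR i (il : (i < l)%N) : presmap R2 projR (pgens R (k + i)) = pgens R2 i.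
  by rewrite pgensR (presmap_pin RR) (pgensE _ (Ordinal il)) /omap_word /= /projR splitR.
have tL' i (ik : (i < k)%N) : presmap R injL (pgens R1 i) = pgens R i.
  by rewrite (pgensE _ (Ordinal ik)) (presmap_pin R1R) pgensL.
have tR' i (il : (i < l)%N) : presmap R injR (pgens R2 i) = pgens R (k + i).
  by rewrite (pgensE _ (Ordinal il)) (presmap_pin R2R) pgensR.
split=> [h|[h1 h2]].
  split.
    apply: (fixed_presmap RL w1s tL) => i ik.
    by rewrite -hL // h // (leq_trans ik) ?leq_addr.
  apply: (fixed_presmap RR w2s tR) => i il.
  by rewrite -hR h // ltn_add2l.
move=> i ikl; have [ik|ki] := ltnP i k.
  by rewrite hL //; apply: (fixed_presmap R1R w1s tL').
have il : (i - k < l)%N by lia.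
rewrite -(subnKC ki) hR.
exact: (fixed_presmap R2R w2s tR' h2 il).
Qed.

End Stabilizers.

(** * Coxeter and Artin relators under partial maps of generators *)

Definition alt_cox (n : nat) (i j : 'I_n) (p : nat) : word 'I_n :=
  flatten (nseq p [:: (i, false); (j, false)]).

Lemma altS n (i j : 'I_n) p : alt i j p.+1 = (i, false) :: alt j i p.
Proof.
rewrite /alt /mkseq /= -[1]/(1 + 0) iotaDl -map_comp; congr (_ :: _).
by apply: eq_map => t /=; case: (odd t).
Qed.

Section OmapRelators.
Variables (p q : nat) (f : 'I_p -> option 'I_q) (i j : 'I_p).

Lemma omap_alt a b r : f i = Some a -> f j = Some b -> omap_word f (alt i j r) = alt a b r.
Proof.
have gen x y a' b' : f x = Some a' -> f y = Some b' -> omap_word f (alt x y r) = alt a' b' r.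
  elim: r x y a' b' => [|r IH] x y a' b' fx fy //.
  by rewrite !altS /= fx /=; congr (_ :: _); apply: IH.
exact: gen.
Qed.

Lemma omap_alt0 r : f i = None -> f j = None -> omap_word f (alt i j r) = [::].
Proof.
have gen x y : f x = None -> f y = None -> omap_word f (alt x y r) = [::].
  by elim: r x y => [|r IH] x y fx fy //; rewrite altS /= fx /=; apply: IH.
exact: gen.
Qed.

Lemma omap_alt_cox a b r : f i = Some a -> f j = Some b ->
  omap_word f (alt_cox i j r) = alt_cox a b r.
Proof. by move=> fi fj; elim: r => //= r IH; rewrite fi fj /= IH. Qed.

Lemma omap_alt_cox0 r : f i = None -> f j = None -> omap_word f (alt_cox i j r) = [::].
Proof. by move=> fi fj; elim: r => //= r IH; rewrite fi fj. Qed.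

End OmapRelators.

Section OmapMatrix.
Variables (p q : nat) (f : 'I_p -> option 'I_q).
Variables (m : 'I_p -> 'I_p -> nat) (m' : 'I_q -> 'I_q -> nat).
Hypothesis fm : forall i j, m i j != 0 ->
  match f i, f j with Some a, Some b => m' a b = m i j | None, None => True | _, _ => False end.

(** The generators of a relator are both kept, with the same exponent, or both erased. *)
Lemma cox_rel_omap x y : cox_rel m x y -> peq (cox_rel m') (omap_word f x) (omap_word f y).
Proof.
move=> [i [j [mij [-> ->]]]]; have := fm mij; rewrite -/(alt_cox i j _) /=.
case fi: (f i) => [a|]; case fj: (f j) => [b|] // e.
  rewrite (omap_alt_cox _ fi fj); apply: peq_of_rel; exists a, b.
  by rewrite e.
by rewrite omap_alt_cox0 //; apply: peq_refl.
Qed.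

Lemma art_rel_omap x y : art_rel m x y -> peq (art_rel m') (omap_word f x) (omap_word f y).
Proof.
move=> [i [j [mij [-> ->]]]]; have := fm mij.
case fi: (f i) => [a|]; case fj: (f j) => [b|] // e.
  rewrite (omap_alt _ fi fj) (omap_alt _ fj fi); apply: peq_of_rel; exists a, b.
  by rewrite e.
by rewrite !omap_alt0 //; apply: peq_refl.
Qed.

End OmapMatrix.

(** With involutive generators, [alt i j p] equals the p-th power of i j times [alt j i p], and for
    p = [m i j] that power is a Coxeter relator. *)
Lemma art_rel_cox n (m : 'I_n -> 'I_n -> nat) x y : coxeter_matrix m ->
  art_rel m x y -> peq (cox_rel m) x y.
Proof.
move=> [_ [mdiag _]] [i [j [mij [-> ->]]]].
pose s (i : 'I_n) := pin (cox_rel m) [:: (i, false)].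
have s2 a : (s a * s a = 1)%g.
  rewrite /s -pin_cat; apply/pinP/peq_of_rel; exists a, a.
  by rewrite mdiag.
have sS a w : pin (cox_rel m) ((a, false) :: w) = (s a * pin (cox_rel m) w)%g := pin_cons _ _ _.
have st p a b : pin (cox_rel m) (alt_cox a b p) = ((s a * s b) ^+ p)%g.
  elim: p => [|p IH] //; by rewrite expgS -IH /s -!pin_cat.
have swap p a b : pin (cox_rel m) (alt a b p) = ((s a * s b) ^+ p * pin (cox_rel m) (alt b a p))%g.
  elim: p a b => [|p IH] a b; first by rewrite expg0 mul1g.
  rewrite !altS (sS a (alt b a p)) (sS b (alt a b p)) (IH b a).
  have -> : ((s a * s b) ^+ p.+1 * (s b * pin (cox_rel m) (alt a b p)) =
             (s a * s b) ^+ p * s a * pin (cox_rel m) (alt a b p))%g.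
    by rewrite expgSr !mulgA -(mulgA _ (s b) (s b)) s2 mulg1.
  rewrite mulgA; congr (_ * _)%g; elim: p {IH} => [|p IH]; first by rewrite !expg0 mulg1 mul1g.
  by rewrite expgS [in RHS]expgS -!mulgA -IH !mulgA.
apply/pinP; rewrite (swap (m i j) i j) -st (_ : pin _ (alt_cox i j _) = 1)%g ?mul1g //.
by apply/pinP/peq_of_rel; exists i, j.
Qed.

(** * The Coxeter matrix of a free product *)

Section FreeProductMatrix.
Variables (k l : nat) (M1 : 'I_k -> 'I_k -> nat) (M2 : 'I_l -> 'I_l -> nat).
Local Notation M := (free_product_matrix M1 M2).

Lemma splitK_inj (i j : 'I_(k + l)) : split i = split j -> i = j.
Proof. by move=> e; rewrite -(splitK i) e splitK. Qed.

Lemma coxeter_free_product : coxeter_matrix M1 -> coxeter_matrix M2 -> coxeter_matrix M.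
Proof.
move=> [sym1 [diag1 off1]] [sym2 [diag2 off2]]; rewrite /free_product_matrix; split; [|split].
- by move=> i j; case: (split i) => a; case: (split j) => b.
- by move=> i; case: (split i) => a.
- move=> i j ij; case si: (split i) => [a|a]; case sj: (split j) => [b|b] //.
    by apply: off1; apply: contra_neq ij => ab; apply: splitK_inj; rewrite si sj ab.
  by apply: off2; apply: contra_neq ij => ab; apply: splitK_inj; rewrite si sj ab.
Qed.

Lemma free_product_same_side i j : M i j != 0 -> (i < k) = (j < k).
Proof.
rewrite /free_product_matrix.
by case: (splitP i); case: (splitP j).
Qed.

Lemma projL_matrix i j : M i j != 0 ->
  match projL i, projL j with Some a, Some b => M1 a b = M i j | None, None => True | _, _ => False end.
Proof. by rewrite /free_product_matrix /projL; case: (split i) => a; case: (split j) => b. Qed.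

Lemma projR_matrix i j : M i j != 0 ->
  match projR i, projR j with Some a, Some b => M2 a b = M i j | None, None => True | _, _ => False end.
Proof. by rewrite /free_product_matrix /projR; case: (split i) => a; case: (split j) => b. Qed.

Lemma injL_matrix i j : M1 i j != 0 ->
  match injL l i, injL l j with Some a, Some b => M a b = M1 i j | None, None => True | _, _ => False end.
Proof. by rewrite /injL /free_product_matrix !splitL. Qed.

Lemma injR_matrix i j : M2 i j != 0 ->
  match injR k i, injR k j with Some a, Some b => M a b = M2 i j | None, None => True | _, _ => False end.
Proof. by rewrite /injR /free_product_matrix !splitR. Qed.

Lemma H_cox_emb b1 b2 : H_cox M (map_word (@embL k l) b1 ++ map_word (@embR k l) b2) <->
  H_cox M1 b1 /\ H_cox M2 b2.
Proof.
apply: stabilizes_free_product; apply: cox_rel_omap.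
- exact: projL_matrix.
- exact: projR_matrix.
- exact: injL_matrix.
- exact: injR_matrix.
Qed.

Lemma H_art_emb b1 b2 : H_art M (map_word (@embL k l) b1 ++ map_word (@embR k l) b2) <->
  H_art M1 b1 /\ H_art M2 b2.
Proof.
apply: stabilizes_free_product; apply: art_rel_omap.
- exact: projL_matrix.
- exact: projR_matrix.
- exact: injL_matrix.
- exact: injR_matrix.
Qed.

Lemma H_art_cox n (m : 'I_n -> 'I_n -> nat) b : coxeter_matrix m -> H_art m b -> H_cox m b.
Proof. by move=> mcox hb i hi; apply: peq_mono (hb i hi) => x y; apply: art_rel_cox. Qed.

(** The factors found over [nat] are brought back to ordinals by [insub]; their index bounds
    guarantee that no letter is erased on the way. *)
Lemma H_cox_split b : coxeter_matrix M1 -> coxeter_matrix M2 -> H_cox M b ->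
  exists (b1 : word 'I_(k.-1)) (b2 : word 'I_(l.-1)),
    @braid_eq (k + l) b (map_word (@embL k l) b1 ++ map_word (@embR k l) b2).
Proof.
move=> c1 c2 hb; have mcox := coxeter_free_product c1 c2.
have [w1 [w2 [w1s w2s e]]] := braid_split (map_val_bound b)
  (cox_stabilizer_split mcox (leq_addr l k) free_product_same_side hb).
exists (omap_word insub w1), (omap_word (fun i => insub (i - k)) w2).
pose f : nat -> option 'I_((k + l).-1) := insub.
have fval u : omap_word f (map_word val u) = u.
  by elim: u => //= -[i e'] u IH; rewrite /= /f valK /= -/f -/(map_word _ _) IH.
have fR x y : braid_nat (k + l) x y -> peq (@braid_rel (k + l)) (omap_word f x) (omap_word f y).
  move=> [i [j [jn h]]].
  have i_n : i < (k + l).-1 by case: h => [[<- _]|[ij _]] in jn *; lia.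
  have fi : f i = Some (Ordinal i_n) by rewrite /f insubT.
  have fj : f j = Some (Ordinal jn) by rewrite /f insubT.
  apply: peq_of_rel; exists (Ordinal i_n), (Ordinal jn).
  by case: h => [[ij [-> ->]]|[ij [-> ->]]]; rewrite /= fi fj; [left|right].
have := peq_omap fR e; rewrite fval omap_word_cat /braid_eq.
rewrite (_ : omap_word f w1 = map_word (@embL k l) (omap_word insub w1)); last first.
  elim: w1 w1s {e} => //= -[i e'] w1 IH /andP[/= ik /IH ->].
  have ikl : i < (k + l).-1 by lia.
  rewrite /f (insubT (fun i => i < (k + l).-1) ikl) (insubT (fun i => i < k.-1) ik) /=.
  by congr ((_, _) :: _); apply: val_inj.
rewrite (_ : omap_word f w2 = map_word (@embR k l) (omap_word (fun i => insub (i - k)) w2)) //.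
elim: w2 w2s {e} => //= -[i e'] w2 IH /andP[/= /andP[ki ikl] /IH ->].
have ikl' : i - k < l.-1 by lia.
rewrite /f (insubT (fun i => i < (k + l).-1) ikl) (insubT (fun i => i < l.-1) ikl') /=.
by congr ((_, _) :: _); apply: val_inj; rewrite /= subnKC.
Qed.

End FreeProductMatrix.

Theorem theorem5p4 (k l : nat) (M1 : 'I_k -> 'I_k -> nat) (M2 : 'I_l -> 'I_l -> nat) :
  coxeter_matrix M1 -> coxeter_matrix M2 ->
  (forall b : word 'I_((k + l).-1),
     H_cox (free_product_matrix M1 M2) b <->
     exists (b1 : word 'I_(k.-1)) (b2 : word 'I_(l.-1)),
       H_cox M1 b1 /\ H_cox M2 b2 /\
       @braid_eq (k + l) b (map_word (@embL k l) b1 ++ map_word (@embR k l) b2)) /\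
  (forall b : word 'I_((k + l).-1),
     H_art (free_product_matrix M1 M2) b <->
     exists (b1 : word 'I_(k.-1)) (b2 : word 'I_(l.-1)),
       H_art M1 b1 /\ H_art M2 b2 /\
       @braid_eq (k + l) b (map_word (@embL k l) b1 ++ map_word (@embR k l) b2)) /\
  (well_stabilized M1 -> well_stabilized M2 ->
   well_stabilized (free_product_matrix M1 M2)).
Proof.
move=> c1 c2; have mcox := coxeter_free_product c1 c2.
have cox b : H_cox (free_product_matrix M1 M2) b <->
    exists b1 b2, H_cox M1 b1 /\ H_cox M2 b2 /\
      @braid_eq (k + l) b (map_word (@embL k l) b1 ++ map_word (@embR k l) b2).
  split=> [hb|[b1 [b2 [h1 [h2 e]]]]].
    have [b1 [b2 e]] := H_cox_split c1 c2 hb; exists b1, b2.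
    by have /H_cox_emb[] := (stabilizes_braid_eq _ e).1 hb.
  by apply/(stabilizes_braid_eq _ e)/H_cox_emb.
have art b : H_art (free_product_matrix M1 M2) b <->
    exists b1 b2, H_art M1 b1 /\ H_art M2 b2 /\
      @braid_eq (k + l) b (map_word (@embL k l) b1 ++ map_word (@embR k l) b2).
  split=> [hb|[b1 [b2 [h1 [h2 e]]]]].
    have [b1 [b2 e]] := H_cox_split c1 c2 (H_art_cox mcox hb); exists b1, b2.
    by have /H_art_emb[] := (stabilizes_braid_eq _ e).1 hb.
  by apply/(stabilizes_braid_eq _ e)/H_art_emb.
split=> //; split=> // w1 w2 b; rewrite cox art.
by split=> -[b1 [b2 [h1 [h2 e]]]]; exists b1, b2; split; [apply/w1|split; [apply/w2|]|apply/w1|split; [apply/w2|]].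
Qed.
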